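(* Let $\gamma\in[0,1]$, $\gamma\ne\frac12$, $p\in(2,3)$, and let $\pi=(\pi^n)_{n\in\mathbb N}$ be a sequence of partitions of $[0,T]$ with mesh size $|\pi^n|\to0$. Let $K\subset\widehat{\mathscr C}^p([0,T];\mathbb R^{\hat d})$ be a compact subset, bounded with respect to the rough path norm, and let $f\colon K\to\mathbb R$ be continuous. For $L>0$ let $K_{\gamma,\pi,L}\subset K$ be the set of all $\widehat{\mathbf X}^{\gamma,\pi}=(\widehat X,\widehat{\mathbb X}^{\gamma,\pi,(2)})\in K$ such that $X$ satisfies Property $\gamma$-(RIE) relative to $\gamma$, $p$ and $\pi$, and $\|(\widehat X,\widehat{\mathbb X}^{\gamma,\pi,(2)})\|_p+\|[\widehat X]^{\gamma,\pi}\|_{p/2}\le L$. Then for every $\varepsilon>0$ there exists $\ell^\gamma\in T(\mathbb R^{\hat d})$ such that $$\sup_{\widehat{\mathbf X}^{\gamma,\pi}\in K_{\gamma,\pi,L}}\big|f(\widehat{\mathbf X}^{\gamma,\pi})-\langle\ell^\gamma,\widehat{\mathbb X}^{\gamma,\pi}_T\rangle\big|<\varepsilon,$$ where $\widehat{\mathbb X}^{\gamma,\pi}$ denotes the $\gamma$-signature of $\widehat X$.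
   Context: Fix $T>0$, $d\in\mathbb N$; $\Delta_T=\{(s,t)\in[0,T]^2:s\le t\}$, $X_{s,t}:=X_t-X_s$. $T(\mathbb R^m)=\bigoplus_{n\ge0}(\mathbb R^m)^{\otimes n}$, $T((\mathbb R^m))=\prod_{n\ge0}(\mathbb R^m)^{\otimes n}$; $e_I=e_{i_1}\otimes\cdots\otimes e_{i_n}$ for $I=(i_1,\dots,i_n)$; $I'=(i_1,\dots,i_{n-1})$; $\langle\ell,\mathbf a\rangle=\sum_I\ell_I\langle e_I,\mathbf a\rangle$ for $\ell=\sum_I\ell_Ie_I\in T(\mathbb R^m)$, $\mathbf a\in T((\mathbb R^m))$, with $\langle e_I,\mathbf a\rangle$ the $e_I$-coordinate. Variation and rough paths: $\|X\|_p=(\sup_{\mathcal P}\sum_{[u,v]\in\mathcal P}|X_{u,v}|^p)^{1/p}$ for paths, $\|A\|_r=(\sup_{\mathcal P}\sum_{[u,v]\in\mathcal P}|A_{u,v}|^r)^{1/r}$ for two-parameter functions. $\mathscr C^p([0,T];\mathbb R^m)$ is the space of rough paths $\mathbf X=(X,\mathbb X^{(2)})$: $X$ continuous with $\|X\|_p<\infty$, $\mathbb X^{(2)}\colon\Delta_T\to\mathbb R^{m\times m}$ continuous with $\|\mathbb X^{(2)}\|_{p/2}<\infty$, $\mathbb X^{(2)}_{s,t}=\mathbb X^{(2)}_{s,u}+\mathbb X^{(2)}_{u,t}+X_{s,u}\otimes X_{u,t}$ for $s\le u\le t$. Norm $\|\mathbf X\|_p=\|X\|_p+\|\mathbb X^{(2)}\|_{p/2}$;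 topology from the distance $\|X-Y\|_p+\|\mathbb X^{(2)}-\mathbb Y^{(2)}\|_{p/2}$. Bracket: $[\mathbf X]_t=X_{0,t}\otimes X_{0,t}-(\mathbb X^{(2)}_{0,t}+(\mathbb X^{(2)}_{0,t})^\top)$. $\widehat{\mathscr C}^p([0,T];\mathbb R^{\hat d})$, $\hat d=1+d+\frac{d(d+1)}2$: the set of $(\widehat X,\widehat{\mathbb X}^{(2)})\in\mathscr C^p([0,T];\mathbb R^{\hat d})$ arising from some $\mathbf X=(X,\mathbb X^{(2)})\in\mathscr C^p([0,T];\mathbb R^d)$ by $\widehat X_t=(t,X_t,([\mathbf X]^{ij}_t)_{1\le i\le j\le d})$ (coordinates indexed $0,\dots,\hat d-1$), with $(\widehat{\mathbb X}^{(2)})^{ij}=(\mathbb X^{(2)})^{ij}$ for $i,j\in\{1,\dots,d\}$ and $(\widehat{\mathbb X}^{(2)}_{s,t})^{ij}=\int_s^t\widehat X^i_{s,r}\mathrm d\widehat X^j_r$ (Young integral) if $i,j$ are not both in $\{1,\dots,d\}$. Property $\gamma$-(RIE): let $X\colon[0,T]\to\mathbb R^m$ be continuous, $\gamma\in[0,1]$, $p\in(2,3)$, $\pi^n=\{0=t^n_0<\dots<t^n_{N_n}=T\}$ with $\sup_k|X_{t^n_k,t^n_{k+1}}|\to0$. $X$ satisfies Property $\gamma$-(RIE) relative to $\gamma,p,\pi$ if (i) $\int_0^tX_r\otimes\mathrm d^{\gamma,\pi^n}X_r:=\sum_{k=0}^{N_n-1}(X_{t^n_k}+\gamma X_{t^n_k,t^n_{k+1}})\otimes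 X_{t^n_k\wedge t,t^n_{k+1}\wedge t}$ converges uniformly in $t\in[0,T]$ as $n\to\infty$, the limit being denoted $\int_0^tX_r\otimes\mathrm d^{\gamma,\pi}X_r$; and (ii) there are a constant $C$ and a control function $c$ (nonnegative continuous superadditive function on $\Delta_T$ vanishing on the diagonal) with $$\sup_{(s,t)\in\Delta_T}\frac{|X_{s,t}|^p}{c(s,t)}+\sup_n\sup_{0\le k<\ell\le N_n}\frac{|(\int_0^\cdot X_r\otimes\mathrm d^{\gamma,\pi^n}X_r)_{t^n_k,t^n_\ell}-X_{t^n_k}\otimes X_{t^n_k,t^n_\ell}|^{p/2}}{c(t^n_k,t^n_\ell)}\le C\qquad(0/0:=0).$$ Then $\mathbf X^{\gamma,\pi}=(X,\mathbb X^{\gamma,\pi,(2)})$ with $\mathbb X^{\gamma,\pi,(2)}_{s,t}=\int_0^tX_r\otimes\mathrm d^{\gamma,\pi}X_r-\int_0^sX_r\otimes\mathrm d^{\gamma,\pi}X_r-X_s\otimes X_{s,t}$ is a rough path, and one sets $[X^i,X^j]^{\gamma,\pi}_t=X^i_tX^j_t-X^i_0X^j_0-\int_0^tX^i_r\mathrm d^{\gamma,\pi}X^j_r-\int_0^tX^j_r\mathrm d^{\gamma,\pi}X^i_r$ for $\gamma\neq\frac12$, and $[X^i,X^j]^{\gamma,\pi}:=0$ for $\gamma=\frac12$; $[X]^{\gamma,\pi}=([X^i,X^j]^{\gamma,\pi})_{i,j}$. For $X\colon[0,T]\to\mathbb R^d$ satisfying Property $\gamma$-(RIE), $\widehat X_t:=(t,X_t,([X^i,X^j]^{\gamma,\pi}_t)_{1\le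 i\le j\le d})$; then $\widehat X$ again satisfies Property $\gamma$-(RIE) relative to $\gamma,p,\pi$, and $\widehat{\mathbf X}^{\gamma,\pi}=(\widehat X,\widehat{\mathbb X}^{\gamma,\pi,(2)})$ denotes its lift as just defined (applied to $\widehat X$), and $[\widehat X]^{\gamma,\pi}$ its bracket. The $\gamma$-signature $\mathbb X^{\gamma,\pi}\colon[0,T]\to T((\mathbb R^m))$ of a path $X$ satisfying Property $\gamma$-(RIE) is given by $\langle e_\emptyset,\mathbb X^{\gamma,\pi}_t\rangle=1$, $\langle e_{(i)},\mathbb X^{\gamma,\pi}_t\rangle=X^i_{0,t}$, $\langle e_{(i,j)},\mathbb X^{\gamma,\pi}_t\rangle=(\mathbb X^{\gamma,\pi,(2)}_{0,t})^{ij}$, and for $|I|>2$, $\langle e_I,\mathbb X^{\gamma,\pi}_t\rangle=\lim_{n\to\infty}\sum_{k=0}^{N_n-1}\big(\langle e_{I'},\mathbb X^{\gamma,\pi}_{t^n_k}\rangle+\gamma(\langle e_{I'},\mathbb X^{\gamma,\pi}_{t^n_{k+1}}\rangle-\langle e_{I'},\mathbb X^{\gamma,\pi}_{t^n_k}\rangle)\big)X^{i_{|I|}}_{t^n_k\wedge t,t^n_{k+1}\wedge t}$. Equivalently, it is $t\mapsto\mathbb X_{0,t}$ for Lyons' extension of $\mathbf X^{\gamma,\pi}$, the unique continuous $\mathbb X\colon\Delta_T\to T((\mathbb R^m))$ extending $(1,X_{s,t},\mathbb X^{\gamma,\pi,(2)}_{s,t})$, satisfying $\mathbb X_{s,u}\otimes\mathbb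 X_{u,t}=\mathbb X_{s,t}$ and with $n$-th level of finite $p/n$-variation for all $n$. *)

(* Defs.v *)
From HB Require Import structures.
From mathcomp Require Import all_boot all_order all_algebra finmap.
From mathcomp Require Import all_classical all_reals all_analysis.
From mathcomp Require Import ring lra zify.

Set Implicit Arguments.
Unset Strict Implicit.
Unset Printing Implicit Defensive.

Import Order.TTheory GRing.Theory Num.Theory.
Import numFieldNormedType.Exports.

Local Open Scope classical_set_scope.
Local Open Scope ring_scope.

(* Paths on [0, T] and two-parameter functions on the simplex are represented
   by total functions on R and R * R; only their values on [0, T], respectively
   on the simplex, are ever used. *)

Section Basics.
Context {R : realType}.

Definition simplex (T : R) : set (R * R) :=
  [set st | [/\ 0 <= st.1, st.1 <= st.2 & st.2 <= T]].

Definition incr {m n : nat} (X : R -> 'M[R]_(m, n)) (s t : R) : 'M[R]_(m, n) :=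
  X t - X s.

Definition tens {m n : nat} (x : 'rV[R]_m) (y : 'rV[R]_n) : 'M[R]_(m, n) :=
  x^T *m y.

(* Euclidean norm (Hilbert-Schmidt norm on 2-tensors); the norm which the
   library puts on matrices is the maximum norm. *)
Definition enorm {m n : nat} (A : 'M[R]_(m, n)) : R :=
  Num.sqrt (\sum_i \sum_j A i j ^+ 2).

(* A partition of [a, b] is a sequence s with [itv_partition a b s]: it lists
   the points of the partition except a, so that its points are
   [node a s 0 = a], ..., [node a s (size s) = b]. *)
Definition node (a : R) (s : seq R) (k : nat) : R := nth a (a :: s) k.

Definition mesh (a : R) (s : seq R) : R :=
  \big[Num.max/0]_(k < size s) (node a s k.+1 - node a s k).

Definition pvar_sum {m n : nat} (r : R) (A : R -> R -> 'M[R]_(m, n))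
    (s : seq R) : R :=
  \sum_(k < size s) enorm (A (node 0 s k) (node 0 s k.+1)) `^ r.

Definition pvar {m n : nat} (T r : R) (A : R -> R -> 'M[R]_(m, n)) : \bar R :=
  poweR (ereal_sup [set (pvar_sum r A s)%:E | s in itv_partition 0 T]) r^-1.

Lemma pvar_ge0 m n (T r : R) (A : R -> R -> 'M[R]_(m, n)) :
  (0 <= pvar T r A)%E.
Proof. exact: poweR_ge0. Qed.

Lemma enorm_ge0 m n (A : 'M[R]_(m, n)) : 0 <= enorm A.
Proof. exact: sqrtr_ge0. Qed.

Lemma enorm0 m n : enorm (0 : 'M[R]_(m, n)) = 0.
Proof.
rewrite /enorm big1 ?sqrtr0// => i _; rewrite big1// => j _.
by rewrite mxE expr0n.
Qed.

Lemma enormN m n (A : 'M[R]_(m, n)) : enorm (- A) = enorm A.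
Proof.
rewrite /enorm; congr Num.sqrt; apply: eq_bigr => i _; apply: eq_bigr => j _.
by rewrite mxE sqrrN.
Qed.

Lemma enorm_sqr m n (A : 'M[R]_(m, n)) :
  enorm A ^+ 2 = \sum_i \sum_j A i j ^+ 2.
Proof.
by rewrite sqr_sqrtr// sumr_ge0// => i _; rewrite sumr_ge0// => j _; exact: sqr_ge0.
Qed.

Lemma enorm_eq0 m n (A : 'M[R]_(m, n)) : enorm A = 0 -> A = 0.
Proof.
move=> A0; have /eqP : \sum_i \sum_j A i j ^+ 2 = 0.
  by rewrite -enorm_sqr A0 expr0n.
rewrite psumr_eq0; last first.
  by move=> i _; rewrite sumr_ge0// => j _; exact: sqr_ge0.
move=> /allP H; apply/matrixP => i j; rewrite mxE.
have /= := H i (mem_index_enum _); rewrite psumr_eq0; last first.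
  by move=> k _; exact: sqr_ge0.
by move=> /allP /(_ j (mem_index_enum _)) /=; rewrite sqrf_eq0 => /eqP.
Qed.

Lemma ler_enormD m n (A B : 'M[R]_(m, n)) :
  enorm (A + B) <= enorm A + enorm B.
Proof.
have [/enorm_eq0 ->|a0] := eqVneq (enorm A) 0.
  by rewrite enorm0 !add0r.
have [/enorm_eq0 ->|b0] := eqVneq (enorm B) 0.
  by rewrite enorm0 !addr0.
have {}a0 : 0 < enorm A by rewrite lt_neqAle eq_sym a0 enorm_ge0.
have {}b0 : 0 < enorm B by rewrite lt_neqAle eq_sym b0 enorm_ge0.
set a := enorm A in a0 *; set b := enorm B in b0 *.
rewrite -(@ler_pXn2r _ 2%N)// ?nnegrE ?enorm_ge0 ?addr_ge0 ?enorm_ge0//.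
have -> : (a + b) ^+ 2 = (1 + b / a) * a ^+ 2 + (1 + a / b) * b ^+ 2.
  by field; rewrite !gt_eqF.
rewrite /a /b !enorm_sqr -/a -/b !mulr_sumr -big_split/=; apply: ler_sum => i _.
rewrite !mulr_sumr -big_split/=; apply: ler_sum => j _; rewrite mxE.
set x := A i j; set y := B i j.
rewrite -subr_ge0.
have -> : (1 + b / a) * x ^+ 2 + (1 + a / b) * y ^+ 2 - (x + y) ^+ 2 =
    (b * x - a * y) ^+ 2 / (a * b) by field; rewrite !gt_eqF.
by rewrite divr_ge0 ?sqr_ge0// mulr_ge0// ltW.
Qed.


Lemma powR_conv_le (r l x y : R) : 1 <= r -> 0 <= l <= 1 -> 0 <= x -> 0 <= y ->
  (l * x + (1 - l) * y) `^ r <= l * x `^ r + (1 - l) * y `^ r.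
Proof.
move=> r1 /andP[l0 l1] x0 y0.
by apply: (convex_powR r1 (Itv01 l0 l1)) => //=;
  rewrite inE/= in_itv/= andbT.
Qed.

Lemma pvar_leP m n (T r a : R) (A : R -> R -> 'M[R]_(m, n)) :
  0 < r -> 0 <= a ->
  (pvar T r A <= a%:E)%E <->
  (forall s : seq R, itv_partition 0 T s -> pvar_sum r A s <= a `^ r).
Proof.
move=> r0 a0.
have sum_ge0 s : 0 <= pvar_sum r A s by apply: sumr_ge0 => k _; exact: powR_ge0.
have arK : (a `^ r) `^ r^-1 = a by rewrite -powRrM mulfV ?gt_eqF// powRr1.
split=> [H s hs|H].
- have ub : ((pvar_sum r A s)%:E <= ereal_sup
      [set (pvar_sum r A s)%:E | s in itv_partition (0 : R)%R T])%E.
    by apply: ereal_sup_ubound; exists s.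
  have : (poweR (pvar_sum r A s)%:E r^-1 <= a%:E)%E.
    apply: le_trans H; apply: gt0_ler_poweR => //.
    + by rewrite invr_ge0 ltW.
    + by rewrite in_itv/= lee_fin sum_ge0 leey.
    + by rewrite in_itv/= leey andbT (le_trans _ ub)// lee_fin.
  rewrite poweR_EFin lee_fin => {}H.
  have -> : pvar_sum r A s = (pvar_sum r A s `^ r^-1) `^ r.
    by rewrite -powRrM mulVf ?gt_eqF// powRr1.
  by apply: ge0_ler_powR; rewrite ?nnegrE ?powR_ge0// ltW.
- have : (ereal_sup [set (pvar_sum r A s)%:E | s in itv_partition (0 : R)%R T]
      <= (a `^ r)%:E)%E.
    by apply: ge_ereal_sup => _ [s hs <-]; rewrite lee_fin H.
  have [[s0 hs0]|ns] := pselect (exists s, itv_partition 0 T s); last first.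
    move=> _; rewrite /pvar (_ : [set _ | _ in _] = set0).
      by rewrite ereal_sup0/= invr_eq0 gt_eqF// lee_fin.
    by rewrite -subset0 => x [s hs _]; apply: ns; exists s.
  have ub : ((pvar_sum r A s0)%:E <= ereal_sup
      [set (pvar_sum r A s)%:E | s in itv_partition (0 : R)%R T])%E.
    by apply: ereal_sup_ubound; exists s0.
  rewrite /pvar; move: ub; case: ereal_sup => [x| |]//= ub xa.
  rewrite lee_fin -[leRHS]arK.
  apply: ge0_ler_powR; rewrite ?nnegrE ?powR_ge0// ?invr_ge0 ?(ltW r0)//.
  by rewrite -lee_fin (le_trans _ ub)// lee_fin.
Qed.

Lemma pvar0 m n (T r : R) (A : R -> R -> 'M[R]_(m, n)) :
  0 < r -> (forall s t, A s t = 0) -> pvar T r A = 0%E.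
Proof.
move=> r0 A0; apply/eqP; rewrite eq_le pvar_ge0 andbT; apply/pvar_leP => // s _.
by rewrite /pvar_sum big1 ?powR_ge0// => k _; rewrite A0 enorm0 powR0// gt_eqF.
Qed.

Lemma pvarN m n (T r : R) (A B : R -> R -> 'M[R]_(m, n)) :
  (forall s t, B s t = - A s t) -> pvar T r B = pvar T r A.
Proof.
move=> BA; have E s : pvar_sum r B s = pvar_sum r A s.
  by apply: eq_bigr => k _; rewrite BA enormN.
by rewrite /pvar; under eq_imagel => s _ do rewrite E.
Qed.

Lemma le_pvarD_fin m n (T r a b : R) (A B C : R -> R -> 'M[R]_(m, n)) :
  1 <= r -> (forall s t, C s t = A s t + B s t) -> 0 < a -> 0 < b ->
  (pvar T r A <= a%:E)%E -> (pvar T r B <= b%:E)%E ->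
  (pvar T r C <= (a + b)%:E)%E.
Proof.
move=> r1 CE a0 b0 Aa Bb; have r0 : 0 < r by exact: lt_le_trans r1.
have ab0 : 0 < a + b by exact: addr_gt0.
apply/(pvar_leP _ _ r0 (ltW ab0)) => s hs.
have {}Aa := (pvar_leP _ _ r0 (ltW a0)).1 Aa s hs.
have {}Bb := (pvar_leP _ _ r0 (ltW b0)).1 Bb s hs.
pose l := a / (a + b).
have l01 : 0 <= l <= 1.
  by rewrite /l (divr_ge0 (ltW a0) (ltW ab0))/= ler_pdivrMr// mul1r lerDl (ltW b0).
have lE : 1 - l = b / (a + b).
  by rewrite /l -[X in X - _](mulfV (lt0r_neq0 ab0)) -mulrBl addrC addKr.
have term k : enorm (C (node 0 s k) (node 0 s k.+1)) `^ r <=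
    (a + b) `^ r * (l * (enorm (A (node 0 s k) (node 0 s k.+1)) `^ r / a `^ r) +
      (1 - l) * (enorm (B (node 0 s k) (node 0 s k.+1)) `^ r / b `^ r)).
  rewrite CE; set x := A _ _; set y := B _ _.
  have powRV z c : 0 <= z -> 0 < c -> z `^ r / c `^ r = (z / c) `^ r.
    move=> z0 c0; rewrite [RHS]powRM ?invr_ge0 ?(ltW c0)//; congr (_ * _).
    by rewrite -[c^-1]powR_inv1 ?(ltW c0)// powRAC powR_inv1 ?powR_ge0.
  rewrite !powRV ?enorm_ge0//.
  apply: (@le_trans _ _ ((a + b) `^ r *
      (l * (enorm x / a) + (1 - l) * (enorm y / b)) `^ r)); last first.
    rewrite ler_wpM2l ?powR_ge0//; apply: powR_conv_le => //.
    - by rewrite divr_ge0 ?enorm_ge0// ltW.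
    - by rewrite divr_ge0 ?enorm_ge0// ltW.
  have xy0 : 0 <= l * (enorm x / a) + (1 - l) * (enorm y / b).
    case/andP: l01 => l0 l1.
    by rewrite addr_ge0// mulr_ge0 ?subr_ge0// divr_ge0 ?enorm_ge0// ltW.
  rewrite -powRM ?(ltW ab0)//; apply: ge0_ler_powR.
  - exact: ltW.
  - by rewrite nnegrE enorm_ge0.
  - by rewrite nnegrE mulr_ge0// ltW.
  - suff -> : (a + b) * (l * (enorm x / a) + (1 - l) * (enorm y / b)) =
        enorm x + enorm y by exact: ler_enormD.
    by rewrite lE /l; field; rewrite !gt_eqF.
rewrite /pvar_sum.
apply: (@le_trans _ _ (\sum_(k < size s) (a + b) `^ r *
    (l * (enorm (A (node 0 s k) (node 0 s k.+1)) `^ r / a `^ r) +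
     (1 - l) * (enorm (B (node 0 s k) (node 0 s k.+1)) `^ r / b `^ r)))).
  by apply: ler_sum => k _; exact: term.
rewrite -mulr_sumr big_split/= -!mulr_sumr -!mulr_suml ler_piMr ?powR_ge0//.
case/andP: l01 => l0 l1.
apply: (@le_trans _ _ (l * 1 + (1 - l) * 1)); last by rewrite !mulr1 subrKC.
apply: lerD; apply: ler_wpM2l; rewrite ?subr_ge0//.
  by rewrite ler_pdivrMr ?powR_gt0// mul1r.
by rewrite ler_pdivrMr ?powR_gt0// mul1r.
Qed.

Lemma le_pvarD m n (T r : R) (A B C : R -> R -> 'M[R]_(m, n)) :
  1 <= r -> (forall s t, C s t = A s t + B s t) ->
  (pvar T r C <= pvar T r A + pvar T r B)%E.
Proof.
move=> r1 CE.
have := @le_pvarD_fin m n T r _ _ A B C r1 CE.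
move: (pvar_ge0 T r A) (pvar_ge0 T r B).
case: (pvar T r A) => [a| |]//; case: (pvar T r B) => [b| |]//; rewrite ?leey//.
rewrite !lee_fin => a0 b0 H; apply/lee_addgt0Pr => e e0.
have e2 : 0 < e / 2 by exact: divr_gt0.
rewrite -!EFinD [in leRHS](splitr e) addrACA; apply: H.
- by rewrite ltr_wpDl.
- by rewrite ltr_wpDl.
- by rewrite lee_fin lerDl ltW.
- by rewrite lee_fin lerDl ltW.
Qed.

End Basics.

(* The exponent condition is a field so that the p-variation distance between
   two elements is known to satisfy the triangle inequality. *)
Record rough_path (R : realType) (T p : R) (m : nat) := RoughPath {
  rp_path : R -> 'rV[R]_m ;
  rp_area : R -> R -> 'M[R]_m ;
  rp_exponent : 2 < p < 3 ;
  rp_path_continuous : {within `[0, T], continuous rp_path} ;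
  rp_path_pvar : (pvar T p (incr rp_path) < +oo)%E ;
  rp_area_continuous :
    {within simplex T, continuous (fun st : R * R => rp_area st.1 st.2)} ;
  rp_area_pvar : (pvar T (p / 2) rp_area < +oo)%E ;
  rp_chen : forall s u t, 0 <= s -> s <= u -> u <= t -> t <= T ->
    rp_area s t = rp_area s u + rp_area u t +
                  tens (incr rp_path s u) (incr rp_path u t)
}.

Section RoughPathTopology.
Context (R : realType) (T p : R) (m : nat).
Notation RP := (rough_path T p m).

Definition rp_norm (x : RP) : \bar R :=
  (pvar T p (incr (rp_path x)) + pvar T (p / 2) (rp_area x))%E.

Definition rp_dist (x y : RP) : \bar R :=
  (pvar T p (incr (fun t => (rp_path x t - rp_path y t)%R)) +
   pvar T (p / 2) (fun s t => (rp_area x s t - rp_area y s t)%R))%E.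

Definition rp_ball (x : RP) (e : R) : set RP := [set y | (rp_dist x y < e%:E)%E].

Lemma rp_ball_center (x : RP) (e : R) : 0 < e -> rp_ball x e x.
Proof.
move=> e0; have /andP[p2 _] := rp_exponent x.
rewrite /rp_ball/= /rp_dist !pvar0 ?adde0 ?lte_fin//.
- by rewrite divr_gt0// (lt_trans _ p2).
- by move=> s t; rewrite subrr.
- by rewrite (lt_trans _ p2).
- by move=> s t; rewrite /incr !subrr.
Qed.

Lemma rp_ball_sym (x y : RP) (e : R) : rp_ball x e y -> rp_ball y e x.
Proof.
rewrite /rp_ball/= /rp_dist.
rewrite -(@pvarN _ _ _ T p _ (incr (fun t => rp_path y t - rp_path x t))).
  rewrite -(@pvarN _ _ _ T (p / 2) _ (fun s t => rp_area y s t - rp_area x s t))//.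
  by move=> s t; rewrite opprB.
by move=> s t; rewrite /incr -(opprB (rp_path x t)) -(opprB (rp_path x s)) -opprD.
Qed.

Lemma rp_ball_triangle (x y z : RP) (e1 e2 : R) :
  rp_ball x e1 y -> rp_ball y e2 z -> rp_ball x (e1 + e2) z.
Proof.
rewrite /rp_ball/= => xy yz; have /andP[p2 _] := rp_exponent x.
rewrite EFinD; apply: le_lt_trans (lteD xy yz).
rewrite /rp_dist addeACA; apply: leeD; apply: le_pvarD.
- by rewrite ltW// (lt_trans _ p2)// ltr1n.
- by move=> s t; rewrite /incr [RHS]addrACA -opprD !subrKA.
- by rewrite ler_pdivlMr// mul1r ltW.
- by move=> s t; rewrite subrKA.
Qed.

HB.instance Definition _ := gen_eqMixin RP.
HB.instance Definition _ := gen_choiceMixin RP.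
HB.instance Definition _ := hasNbhs.Build RP (nbhs_ (entourage_ rp_ball)).
HB.instance Definition _ := @Nbhs_isPseudoMetric.Build R RP
  (entourage_ rp_ball) erefl rp_ball
  rp_ball_center rp_ball_sym rp_ball_triangle erefl.

Definition rp_bracket (x : RP) (t : R) : 'M[R]_m :=
  tens (incr (rp_path x) 0 t) (incr (rp_path x) 0 t) -
  (rp_area x 0 t + (rp_area x 0 t)^T).

End RoughPathTopology.

Section Extension.
Context {R : realType} {d : nat}.

Definition upper_pairs : seq ('I_d * 'I_d) :=
  [seq (i, j) | i : 'I_d <- enum 'I_d, j : 'I_d <- [seq j : 'I_d <- enum 'I_d | (i <= j)%N]].

Lemma size_upper_pairs : size upper_pairs = (d * d.+1)./2.
Proof.
rewrite size_allpairs_dep sumnE big_map big_enum/=.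
have E (i : 'I_d) : size [seq j : 'I_d <- enum 'I_d | (i <= j)%N] = (d - i)%N.
  rewrite size_filter -(count_map (@nat_of_ord d) (leq i)) val_enum_ord.
  have id : (i <= d)%N by exact: ltnW.
  rewrite -[in iota _ _](subnKC id) iotaD count_cat add0n.
  have -> : count (leq i) (iota 0 i) = 0%N.
    apply/eqP; rewrite -leqn0 leqNgt -has_count; apply/hasPn => k.
    by rewrite mem_iota -ltnNge.
  have /eqP -> : count (leq i) (iota i (d - i)) == size (iota i (d - i)).
    by rewrite -all_count; apply/allP => k; rewrite mem_iota => /andP[].
  by rewrite size_iota.
under eq_bigr do rewrite E.
rewrite -(big_mkord xpredT (fun i => d - i)%N) big_nat_rev/=.
rewrite (@eq_big_nat _ _ _ _ _ _ (fun i => i.+1)) => [|i /andP[_ id]]; last lia.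
elim: {E}d => [|n IH]; first by rewrite big_nil.
rewrite big_nat_recr//= IH; have : ~~ odd (n * n.+1) by rewrite oddM /= andbN.
lia.
Qed.

Definition hat_dim (n : nat) : nat := 1 + n + (n * n.+1)./2.

(* (B^{ij})_{1 <= i <= j <= d} in lexicographic order *)
Definition upper_entries (B : 'M[R]_d) : 'rV[R]_(d * d.+1)./2 :=
  \row_k nth 0 [seq B ij.1 ij.2 | ij <- upper_pairs] k.

Definition hat_vec (t : R) (x : 'rV[R]_d) (B : 'M[R]_d) : 'rV[R]_(hat_dim d) :=
  row_mx (row_mx (t%:M : 'rV[R]_1) x) (upper_entries B).

Definition mid (i : 'I_d) : 'I_(hat_dim d) := lshift _ (rshift 1 i).

(* Young integral, as the limit of left-point Riemann sums over partitions
   with mesh tending to 0 *)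
Definition is_young_integral (a b : R) (f g : R -> R) (v : R) : Prop :=
  forall e, 0 < e -> exists2 h, 0 < h & forall s : seq R,
    itv_partition a b s -> mesh a s < h ->
    `| \sum_(k < size s) f (node a s k) * (g (node a s k.+1) - g (node a s k))
       - v | < e.

Definition is_hat_lift {T p : R} (x : rough_path T p d)
    (y : rough_path T p (hat_dim d)) : Prop :=
  [/\ forall t, 0 <= t -> t <= T ->
        rp_path y t = hat_vec t (rp_path x t) (rp_bracket x t),
      forall s t, 0 <= s -> s <= t -> t <= T -> forall i j : 'I_d,
        rp_area y s t (mid i) (mid j) = rp_area x s t i j &
      forall s t, 0 <= s -> s <= t -> t <= T -> forall i j : 'I_(hat_dim d),
        ~~ ((1 <= i <= d)%N && (1 <= j <= d)%N) ->
        is_young_integral s t (fun r => incr (rp_path y) s r 0 i)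
          (fun r => rp_path y r 0 j) (rp_area y s t i j)].

End Extension.

Definition hat_rough_paths {R : realType} (T p : R) (d : nat) :
  set (rough_path T p (hat_dim d)) :=
  [set y | exists x : rough_path T p d, is_hat_lift x y].
Arguments hat_rough_paths {R} T p d.

(* A sequence of partitions is a map [pi : nat -> seq R], with the encoding of
   [node]; the number of intervals of the n-th partition is [size (pi n)]. *)
Section RIE.
Context {R : realType} {m : nat}.
Implicit Types (X : R -> 'rV[R]_m) (pi : nat -> seq R).

Definition gamma_sum (gam : R) (s : seq R) X (t : R) : 'M[R]_m :=
  \sum_(k < size s)
    tens (X (node 0 s k) + gam *: incr X (node 0 s k) (node 0 s k.+1))
         (incr X (Num.min (node 0 s k) t) (Num.min (node 0 s k.+1) t)).

Definition is_control (T : R) (c : R -> R -> R) : Prop :=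
  [/\ forall s t, 0 <= s -> s <= t -> t <= T -> 0 <= c s t,
      {within simplex T, continuous (fun st : R * R => c st.1 st.2)},
      forall s u t, 0 <= s -> s <= u -> u <= t -> t <= T ->
        c s u + c u t <= c s t &
      forall t, 0 <= t -> t <= T -> c t t = 0].

(* The quotients are those of \bar R, where 0 / 0 = 0 and a / 0 = +oo if
   0 < a. *)
Definition RIE_bound (gam T p : R) pi X (c : R -> R -> R) : \bar R :=
  (ereal_sup [set y | exists s t : R, [/\ (0 <= s)%R, (s <= t)%R, (t <= T)%R &
       y = (enorm (incr X s t) `^ p)%:E / (c s t)%:E]] +
   ereal_sup [set y | exists n k l : nat,
       let s := node 0 (pi n) k in let t := node 0 (pi n) l in
       [/\ (k < l)%N, (l <= size (pi n))%N &
       y = (enorm (incr (gamma_sum gam (pi n) X) s t -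
                   tens (X s) (incr X s t))%R `^ (p / 2))%:E / (c s t)%:E]])%E.

Definition RIE (gam T p : R) pi X : Prop :=
  [/\ {within `[0, T], continuous X},
      \big[Num.max/0]_(k < size (pi n))
        enorm (incr X (node 0 (pi n) k) (node 0 (pi n) k.+1)) @[n --> \oo] --> 0,
      exists I : R -> 'M[R]_m,
        {uniform `[0, T], (fun n => gamma_sum gam (pi n) X) @ \oo --> I} &
      exists (C : R) (c : R -> R -> R),
        is_control T c /\ (RIE_bound gam T p pi X c <= C%:E)%E].

Definition gamma_int (gam : R) pi X (t : R) : 'M[R]_m :=
  lim (gamma_sum gam (pi n) X t @[n --> \oo]).

Definition gamma_area (gam : R) pi X (s t : R) : 'M[R]_m :=
  gamma_int gam pi X t - gamma_int gam pi X s - tens (X s) (incr X s t).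

Definition gamma_bracket (gam : R) pi X (t : R) : 'M[R]_m :=
  if gam == 2^-1 then 0
  else tens (X t) (X t) - tens (X 0) (X 0)
       - gamma_int gam pi X t - (gamma_int gam pi X t)^T.

(* The recursion runs on the reversed word: [gamma_signature_rev (i :: w)] is
   the coordinate of the word [rcons (rev w) i]. *)
Fixpoint gamma_signature_rev (gam : R) pi X (w : seq 'I_m) : R -> R :=
  match w with
  | [::] => fun=> 1
  | i :: w' =>
    match w' with
    | [::] => fun t => incr X 0 t 0 i
    | [:: j] => fun t => gamma_area gam pi X 0 t j i
    | _ => let S := gamma_signature_rev gam pi X w' in fun t =>
        lim (\sum_(k < size (pi n))
          (S (node 0 (pi n) k) +
             gam * (S (node 0 (pi n) k.+1) - S (node 0 (pi n) k))) *
          incr X (Num.min (node 0 (pi n) k) t) (Num.min (node 0 (pi n) k.+1) t)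
            0 i @[n --> \oo])
    end
  end.

Definition gamma_signature (gam : R) pi X (t : R) (I : seq 'I_m) : R :=
  gamma_signature_rev gam pi X (rev I) t.

(* Elements of T(R^m) are the finitely supported families of coordinates
   indexed by words, elements of T((R^m)) are arbitrary families. *)
Definition tensor_pairing (l : {fsfun seq 'I_m -> R with 0})
    (a : seq 'I_m -> R) : R :=
  \sum_(I <- finsupp l) l I * a I.

End RIE.

Definition gamma_hat {R : realType} {d : nat} (gam : R) (pi : nat -> seq R)
    (X : R -> 'rV[R]_d) (t : R) : 'rV[R]_(hat_dim d) :=
  hat_vec t (X t) (gamma_bracket gam pi X t).

Definition is_gamma_hat_lift {R : realType} {T p : R} {d : nat} (gam : R)
    (pi : nat -> seq R) (X : R -> 'rV[R]_d)
    (y : rough_path T p (hat_dim d)) : Prop :=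
  (forall t, 0 <= t -> t <= T -> rp_path y t = gamma_hat gam pi X t) /\
  (forall s t, 0 <= s -> s <= t -> t <= T ->
     rp_area y s t = gamma_area gam pi (gamma_hat gam pi X) s t).

(* The elements of K_{gam,pi,L}, each with a path X from which it arises *)
Definition K_gamma {R : realType} {T p : R} {d : nat}
    (K : set (rough_path T p (hat_dim d))) (gam : R) (pi : nat -> seq R)
    (L : R) : set (rough_path T p (hat_dim d) * (R -> 'rV[R]_d)) :=
  [set yX | [/\ K yX.1, RIE gam T p pi yX.2, is_gamma_hat_lift gam pi yX.2 yX.1 &
    (rp_norm yX.1 +
       pvar T (p / 2) (incr (gamma_bracket gam pi (gamma_hat gam pi yX.2)))
     <= L%:E)%E]].

(* Main.v *)
(* The continuous function f is approximated on K, by the Stone-Weierstrass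
   theorem, by polynomials in the moments int_0^T t^k Y^i_{0,t} dt and
   int_0^T t^k YY^{ij}_{0,t} dt of a rough path (Y, YY): these are obviously
   continuous for the rough path distance, and by the Weierstrass theorem they
   separate points at positive distance. So the signature itself need not be
   shown to be continuous on K.

   It remains to write a polynomial in the moments as a linear functional of
   the gamma-signature, with coefficients independent of the path. This is a
   statement on a single path X with Property gamma-(RIE): its bracket is a
   component of the extended path, hence for gamma <> 1/2 products of
   coordinates of the gamma-signature obey a quasi-shuffle product rule
   (an increment product Y^i Y^j is YY^{ij} + YY^{ji} + [Y]^{ij}), and the word
   w0, where 0 is the letter of time, is the Riemann integral of the word w.

   Existence of the limits defining the gamma-signature, and local expansions
   of each coordinate up to an error of order 3/p > 1 of an additive control,
   come from a sewing argument carried out on the partition points, uniformly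
   in the partition; identities then follow because a path with increments of
   order 3/p is constant. *)
Require Import Defs.
From mathcomp Require Import all_boot all_order all_algebra finmap.
From mathcomp Require Import all_classical all_reals all_analysis.
From mathcomp Require Import ring lra zify.
Import Order.TTheory GRing.Theory Num.Theory.
Import numFieldNormedType.Exports.
Set Implicit Arguments.
Unset Strict Implicit.
Unset Printing Implicit Defensive.
Local Open Scope classical_set_scope.
Local Open Scope ring_scope.

(** Over a single partition interval, a summand of a gamma-sum differs from the rough integral germ
    (value times increment plus derivative times limit area) by a term of order 2 only, which is too
    large for sewing. Each partition therefore carries its own area, read off its gamma-sums. For
    the letters of [X] this area is, over one interval, exactly [gam] times the product of the
    increments; it satisfies Chen's relation at partition points and converges to the limit area.
    The germs of the n-th partition are built with it, and the continuous germ appears only in the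
    limit.

    Time and the brackets have increments of order 2, a bracket increment being a product of
    increments minus two areas. Their areas with any component are thus of order 3 and are set to 0,
    and their brackets need no letter: the quasi-shuffle product closes on the [hat_dim d] letters.
    Controls and constants depend on the path, but the words are computed from letters alone, so a
    single functional serves all paths. *)

(** * Stone-Weierstrass theorem on a compact set, without a Hausdorff assumption *)

Section StoneWeierstrass.
Context {R : realType} {U : topologicalType} (K : set U).
Implicit Types (u v f : U -> R) (A : set (U -> R)).

(** The classical iteration increasing to the square root of [y] in [0, 1]. Each iterate is a
    polynomial in [y], so it stays in any algebra containing [y]. *)
Fixpoint sqrt_iter (n : nat) (y : R) : R :=
  if n is m.+1 then sqrt_iter m y + (y - sqrt_iter m y ^+ 2) / 2 else 0.

(** One step multiplies the error by [1 - (a + q) / 2], and [(1 - a / 2) * (2 + (n + 1) * a)] is at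
    most [2 + n * a]. The weight [2 + n * a] is chosen so that this closes the induction; it makes
    the error decay like [1 / n] uniformly in [a]. *)
Lemma sqrt_iter_bound (a : R) n : 0 <= a <= 1 ->
  0 <= sqrt_iter n (a ^+ 2) <= a /\
  (a - sqrt_iter n (a ^+ 2)) * (2 + n%:R * a) <= 2 * a.
Proof.
move=> /andP[a0 a1]; elim: n => [|n [/andP[q0 qa] IH]] /=.
  by rewrite lexx a0; split=> //; lra.
move: IH q0 qa; set q := sqrt_iter _ _ => IH q0 qa.
have n0 : 0 <= n%:R :> R by [].
split; first by apply/andP; split; nra.
rewrite -natr1; move: n0 IH; set N : R := n%:R => n0 IH.
have -> : a - (q + (a ^+ 2 - q ^+ 2) / 2) = (a - q) * (1 - (a + q) / 2) by field.
have h1 : (1 - (a + q) / 2) * (2 + (N + 1) * a) <= 2 + N * a.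
  have : 0 <= q * (2 + (N + 1) * a) by rewrite mulr_ge0//; nra.
  have : 0 <= (N + 1) * a ^+ 2 by rewrite mulr_ge0 ?sqr_ge0//; lra.
  nra.
rewrite -mulrA; apply: le_trans IH; apply: ler_wpM2l => //; lra.
Qed.

Lemma sqrt_iter_cvg (a : R) n : 0 <= a <= 1 ->
  `|a - sqrt_iter n.+1 (a ^+ 2)| <= 2 / n.+1%:R.
Proof.
move=> a01; have [/andP[q0 qa] H] := sqrt_iter_bound n.+1 a01.
rewrite ger0_norm ?subr_ge0// ler_pdivlMr ?ltr0n//.
move/andP: a01 => [a0 a1]; move: H qa q0.
set q := sqrt_iter _ _; have : 0 < n.+1%:R :> R by rewrite ltr0n.
set N : R := n.+1%:R => N0 H qa q0.
have [->|an0] := eqVneq a 0; first by nra.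
have a_gt0 : 0 < a by rewrite lt_neqAle eq_sym an0.
rewrite -(ler_pM2r a_gt0); nra.
Qed.

Lemma within_cvgP u : {within K, continuous u} <->
  forall x, K x -> forall e : R, 0 < e ->
    \forall x' \near x, K x' -> `|u x - u x'| < e.
Proof.
split=> [/subspace_continuousP H x Kx e e0|H].
  by have /cvgrPdist_lt /(_ e e0) := H x Kx.
by apply/subspace_continuousP => x Kx; apply/cvgrPdist_lt => e e0; exact: H.
Qed.

Hypothesis cptK : compact K.

Lemma continuous_bounded u : {within K, continuous u} ->
  exists2 M : R, 0 < M & forall x, K x -> `|u x| <= M.
Proof.
move=> cu; have /compact_bounded[M [_ HM]] := continuous_compact cu cptK.
exists (Num.max M 0 + 1); first by rewrite ltr_wpDl// le_max lexx orbT.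
move=> x Kx; apply: (HM (Num.max M 0 + 1)); last by exists x.
by rewrite ltr_pwDr// le_max lexx.
Qed.

Variable A : set (U -> R).
Hypothesis A_cont : forall u, A u -> {within K, continuous u}.
Hypothesis A_cst : forall c, A (fun=> c).
Hypothesis A_add : forall u v, A u -> A v -> A (fun x => u x + v x).
Hypothesis A_mul : forall u v, A u -> A v -> A (fun x => u x * v x).

Definition unif_approx u := {within K, continuous u} /\
  forall e : R, 0 < e -> exists2 v, A v & forall x, K x -> `|u x - v x| < e.

Lemma unif_approx_alg u : A u -> unif_approx u.
Proof.
move=> Au; split=> [|e e0]; first exact: A_cont.
by exists u => // x _; rewrite subrr normr0.
Qed.

Lemma unif_approxD u v : unif_approx u -> unif_approx v ->
  unif_approx (fun x => u x + v x).
Proof.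
move=> [cu Hu] [cv Hv]; split.
  by move=> x; apply: cvgD; [exact: cu|exact: cv].
move=> e e0; have e2 : 0 < e / 2 by rewrite divr_gt0.
have [u' Au' Hu'] := Hu _ e2; have [v' Av' Hv'] := Hv _ e2.
exists (fun x => u' x + v' x); first exact: A_add.
move=> x Kx; rewrite opprD addrACA [ltRHS]splitr.
by apply: le_lt_trans (ler_normD _ _) _; apply: ltrD; [exact: Hu'|exact: Hv'].
Qed.

Lemma unif_approxZ c u : unif_approx u -> unif_approx (fun x => c * u x).
Proof.
move=> [cu Hu]; split; first by move=> x; apply: cvgMr; exact: cu.
move=> e e0; have c0 : 0 < `|c| + 1 by rewrite ltr_wpDl.
have [v Av Hv] := Hu (e / (`|c| + 1)) (divr_gt0 e0 c0).
exists (fun x => c * v x); first by apply: A_mul.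
move=> x Kx; rewrite -mulrBr normrM; have := Hv x Kx.
rewrite ltr_pdivlMr// mulrC; apply: le_lt_trans.
by rewrite ler_wpM2r// lerDl.
Qed.

Lemma alg_sqrt_iter n u : A u -> A (fun x => sqrt_iter n (u x)).
Proof.
move=> Au; elim: n => [|n IH] /=; first exact: A_cst.
apply: A_add => //.
rewrite (_ : (fun _ => _) = fun x =>
  (u x + (-1) * (sqrt_iter n (u x) * sqrt_iter n (u x))) * 2^-1); last first.
  by apply/funext => x; rewrite mulN1r -expr2.
apply: A_mul => //; apply: A_add => //; apply: A_mul => //.
exact: A_mul.
Qed.

Lemma unif_approx_norm u : unif_approx u -> unif_approx (fun x => `|u x|).
Proof.
move=> [cu Hu]; split.
  move=> x; apply: (@cvg_comp _ _ _ u (@Num.norm _ R)); first exact: cu.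
  exact: norm_continuous.
move=> e e0; have e2 : 0 < e / 2 by rewrite divr_gt0.
have [v Av Hv] := Hu _ e2.
have [M M0 HM] := continuous_bounded (A_cont Av).
(* The square root of [(v / M) ^ 2] has error at most [2 / n.+1]; rescaled by [M], this must not
   exceed [e / 2]. *)
pose n := Num.truncn (2 * M / (e / 2)).
have nP : 2 * M / (e / 2) < n.+1%:R by exact: truncnS_gt.
exists (fun x => M * sqrt_iter n.+1 (M^-1 * v x * (M^-1 * v x))).
  by apply: A_mul => //; apply: alg_sqrt_iter; apply: A_mul; apply: A_mul.
move=> x Kx; rewrite [ltRHS]splitr.
apply: le_lt_trans (ler_distD `|v x| _ _) _; apply: ltr_leD.
  by apply: le_lt_trans (Hv x Kx); exact: ler_dist_dist.
have vE : `|v x| = M * (`|v x| / M) by field; rewrite gt_eqF.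
have -> : M^-1 * v x * (M^-1 * v x) = (`|v x| / M) ^+ 2.
  by rewrite -expr2 exprMn [in RHS]exprMn real_normK ?num_real// mulrC.
rewrite {1}vE -mulrBr normrM gtr0_norm//.
have a01 : 0 <= `|v x| / M <= 1.
  by rewrite divr_ge0 ?(ltW M0)//= ler_pdivrMr// mul1r; exact: HM.
apply: le_trans (ler_wpM2l (ltW M0) (sqrt_iter_cvg n a01)) _.
rewrite mulrA ler_pdivrMr ?ltr0n//.
by move/ltW: nP; rewrite ler_pdivrMr// (mulrC M) (mulrC (e / 2)).
Qed.

Lemma unif_approx_max u v : unif_approx u -> unif_approx v ->
  unif_approx (fun x => Num.max (u x) (v x)).
Proof.
move=> Hu Hv; rewrite (_ : (fun _ => _) = fun x =>
    2^-1 * (u x + v x + `|u x + -1 * v x|)); last first.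
  by apply/funext => x; rewrite maxr_absE mulN1r mulrC.
apply: unif_approxZ; apply: unif_approxD; first exact: unif_approxD.
by apply: unif_approx_norm; apply: unif_approxD => //; exact: unif_approxZ.
Qed.

Lemma unif_approx_min u v : unif_approx u -> unif_approx v ->
  unif_approx (fun x => Num.min (u x) (v x)).
Proof.
move=> Hu Hv; rewrite (_ : (fun _ => _) = fun x =>
    -1 * Num.max (-1 * u x) (-1 * v x)); last first.
  by apply/funext => x; rewrite !mulN1r -oppr_min opprK.
by apply: unif_approxZ; apply: unif_approx_max; exact: unif_approxZ.
Qed.

(* Applied to a family of approximants of [f] which is directed upwards and
   exceeds [f - e] near each point of [K]. *)
Lemma directed_cover (B : set (U -> R)) f :
  B !=set0 ->
  (forall u v, B u -> B v -> B (fun x => Num.max (u x) (v x))) ->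
  (forall y, K y -> exists2 u, B u &
     \forall y' \near y, K y' -> f y' < u y') ->
  exists2 u, B u & forall y, K y -> f y < u y.
Proof.
move=> [u0 Bu0] Bmax H.
(* The sets of members of [B] lying above a given one form a filter because [B] is directed. The
   near-covering form of compactness along this filter replaces the choice of a finite subcover. *)
pose F := filter_from B (fun u => [set w | B w /\ forall x, u x <= w x]).
have FF : Filter F.
  apply: filter_from_filter; first by exists u0.
  move=> u v Bu Bv; exists (fun x => Num.max (u x) (v x)); first exact: Bmax.
  move=> w /= [Bw Hw]; split; split=> // x; apply: le_trans (Hw x);
    by rewrite le_max lexx ?orbT.
have /near_covering_withinP/(_ _ F (fun u y => f y < u y) FF) :=
  (compact_near_coveringP K).1 cptK.
case.
  move=> y Ky; have [u Bu Hu] := H y Ky.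
  exists ([set y' | K y' -> f y' < u y'], [set w | B w /\ forall x, u x <= w x]).
    by split=> //=; exists u.
  by move=> [y' w] /= [h1 [_ h2]] Ky'; apply: lt_le_trans (h2 y'); exact: h1.
move=> u Bu Hu; exists u => // y Ky; exact: (Hu u _ y Ky).
Qed.

Hypothesis A_sep : forall x y, K x -> K y -> forall f,
  {within K, continuous f} -> f x <> f y -> exists2 u, A u & u x <> u y.

(** Interpolation at two points uses a constant when [f] takes the same value there, so [A_sep] asks
    for separation only of points that some continuous function tells apart. This suits a
    pseudometric space, where distinct points may be at distance 0. *)
Theorem stone_weierstrass f : {within K, continuous f} -> forall e : R, 0 < e ->
  exists2 u, A u & forall x, K x -> `|f x - u x| < e.
Proof.
move=> cf e e0.
have interp x y : K x -> K y ->
    exists u, [/\ A u, u x = f x & u y = f y].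
  move=> Kx Ky; have [fxy|/eqP fxy] := eqVneq (f x) (f y).
    by exists (fun=> f x).
  have [u Au /eqP uxy] := A_sep Kx Ky cf fxy.
  have d0 : u x - u y != 0 by rewrite subr_eq0.
  exists (fun z => f y + (f x - f y) / (u x - u y) * (u z + -1 * u y)).
  split.
  - by apply: A_add => //; apply: A_mul => //; apply: A_add.
  - by field.
  - by field.
have e2 : 0 < e / 2 by rewrite divr_gt0.
have nearA u y : unif_approx u -> K y -> u y = f y -> 
    \forall y' \near y, K y' -> `|u y' - f y'| < e / 2.
  move=> [cu _] Ky uy; have e4 : 0 < e / 2 / 2 by rewrite divr_gt0.
  have h1 := (within_cvgP u).1 cu y Ky _ e4.
  have h2 := (within_cvgP f).1 cf y Ky _ e4.
  move: h1 h2; apply: filterS2 => y' /[swap] b /[swap] Ky' /(_ Ky').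
  move: (b Ky') => {b}.
  rewrite uy => a b; rewrite (_ : u y' - f y' = (f y - f y') - (f y - u y')); last by ring.
  by apply: le_lt_trans (ler_normB _ _) _; rewrite [ltRHS]splitr ltrD.
(* Maxima of interpolants through the value at [x] stay equal to [f x] there, while rising above
   [f - e / 2] on the whole of [K]. *)
have upper x : K x -> exists u, [/\ unif_approx u, u x = f x &
    forall y, K y -> f y - e / 2 < u y].
  move=> Kx; have [|||u [Bu ux] Hu] := @directed_cover
      [set u | unif_approx u /\ u x = f x] (fun y => f y - e / 2).
  - by have [u [Au ux _]] := interp x x Kx Kx; exists u; split=> //; exact: unif_approx_alg.
  - move=> u v [Bu ux] [Bv vx]; split; first exact: unif_approx_max.
    by rewrite ux vx maxxx.
  - move=> y Ky; have [u [Au ux uy]] := interp x y Kx Ky.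
    have Bu := unif_approx_alg Au; exists u => //.
    have := nearA u y Bu Ky uy; apply: filterS => z /[apply]; rewrite ltr_norml; lra.
  by exists u; split.
have [/set0P[x0 Kx0]|/negPn/eqP K0] := boolP (K != set0); last first.
  by exists (fun=> 0) => // x; rewrite K0.
(* The same covering is applied to [- f]: negation turns minima of the functions just built into
   maxima, and equality with [f] at the base point gives the strict bound near it. *)
have [|||u [Bu Hu1] Hu2] := @directed_cover
   [set u | unif_approx (fun x => -1 * u x) /\
     forall y, K y -> f y - e / 2 < -1 * u y] (fun y => - f y - e / 2).
- have [u [Bu _ Hu]] := upper x0 Kx0; exists (fun x => -1 * u x) => /=.
  by under eq_fun do rewrite mulrA mulrNN mulr1 mul1r; split=> // y Ky;
    rewrite mulrA mulrNN mulr1 mul1r; exact: Hu.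
- move=> u v [Bu Hu] [Bv Hv]; split.
    rewrite (_ : (fun _ => _) = fun x => Num.min (-1 * u x) (-1 * v x)).
      exact: unif_approx_min.
    by apply/funext => x; rewrite !mulN1r oppr_max.
  by move=> y Ky; rewrite mulN1r oppr_max lt_min -(mulN1r (u y)) -(mulN1r (v y)) Hu ?Hv.
- move=> y Ky; have [u [Bu uy Hu]] := upper y Ky.
  exists (fun x => -1 * u x) => /=.
    by under eq_fun do rewrite mulrA mulrNN mulr1 mul1r; split=> // z Kz;
      rewrite mulrA mulrNN mulr1 mul1r; exact: Hu.
  have := nearA u y Bu Ky uy; apply: filterS => z /[apply]; rewrite ltr_norml; lra.
have [v Av Hv] := Bu.2 _ e2.
exists v => // x Kx; have := Hv x Kx; have := Hu1 x Kx; have := Hu2 x Kx.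
rewrite !ltr_norml; lra.
Qed.

End StoneWeierstrass.

(** * Continuity of real powers in the base *)

Section PowR.
Context {R : realType}.

(** Away from 0 the power is [expR (r * ln _)]. At 0, where [powR] takes its default value, the
    inverse power of [e] provides the neighbourhood. *)
Lemma cvg_powR_base {I : Type} {F : set_system I} {FF : Filter F}
    (u : I -> R) (x r : R) : 0 < r -> (forall i, 0 <= u i) -> 0 <= x ->
  u i @[i --> F] --> x -> u i `^ r @[i --> F] --> x `^ r.
Proof.
move=> r0 u0; rewrite le_eqVlt => /predU1P[<- |x0] ux.
  rewrite powR0 ?gt_eqF//; apply/cvgrPdist_lt => e e0.
  move/cvgrPdist_lt : ux => /(_ (e `^ r^-1)); rewrite powR_gt0// => /(_ isT).
  apply: filterS => i; rewrite !sub0r !normrN !ger0_norm ?powR_ge0// => ui.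
  rewrite -[ltRHS](@powRr1 _ e) ?(ltW e0)// -(mulVf (lt0r_neq0 r0)) powRrM.
  by apply: gt0_ltr_powR => //; rewrite nnegrE ?powR_ge0.
have unz : \forall i \near F, u i != 0.
  move/cvgrPdist_lt : ux => /(_ x x0); apply: filterS => i.
  by apply: contraPneq => ->; rewrite subr0 gtr0_norm ?ltxx.
rewrite {2}/powR gt_eqF//.
apply: (@cvg_trans _ ((expR (r * ln (u i))) @[i --> F])).
  apply: near_eq_cvg; move: unz; apply: filterS => i; rewrite /powR.
  by move/negPf => ->.
apply: (@cvg_comp _ _ _ _ expR); last exact: continuous_expR.
apply: cvgMr; apply: (@cvg_comp _ _ _ u (@ln R)); first exact: ux.
exact: continuous_ln.
Qed.

End PowR.

(** * Discrete sewing and bisection along an additive control *)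

Section Sewing.
Context {R : realType} (th : R).
Hypothesis th1 : 1 < th.

(** The ratio by which the sum of two errors of the form [x ^ th] shrinks against one when [x] is
    halved; [th > 1] makes it less than 1. *)
Definition halving_factor : R := 2 * (2^-1) `^ th.

(** The fixed point of [x = x * halving_factor + 3]. The 3 counts the two defects and the one step
    error that a splitting produces. *)
Definition sewing_cst : R := 3 / (1 - halving_factor).

Lemma halving_factor_ge0 : 0 <= halving_factor.
Proof. by rewrite mulr_ge0// powR_ge0. Qed.

Lemma halving_factor_lt1 : halving_factor < 1.
Proof.
have h2 : 0 < 2^-1 :> R by rewrite invr_gt0.
have th0 : 0 < th - 1 by rewrite subr_gt0.
rewrite /halving_factor -mulr_powRB1 ?(ltW h2) ?(lt_trans _ th1)//.
rewrite mulrA divff// mul1r.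
apply: (@lt_le_trans _ _ (1 `^ (th - 1))); last by rewrite powR1.
by apply: gt0_ltr_powR => //; rewrite ?nnegrE ?(ltW h2)// invf_lt1// ltr1n.
Qed.

Lemma sewing_cst_ge0 : 0 <= sewing_cst.
Proof. by rewrite divr_ge0// subr_ge0 ltW// halving_factor_lt1. Qed.

Lemma sewing_cstE : sewing_cst * halving_factor + 3 = sewing_cst.
Proof.
by rewrite /sewing_cst; field; rewrite subr_eq0 gt_eqF// halving_factor_lt1.
Qed.

Lemma powR_half (x : R) : 0 <= x -> 2 * (x / 2) `^ th = halving_factor * x `^ th.
Proof. by move=> x0; rewrite powRM// /halving_factor mulrCA [RHS]mulrC mulrCA. Qed.

Lemma le_powR_base (r x y : R) : 0 <= r -> 0 <= x -> x <= y -> x `^ r <= y `^ r.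
Proof.
by move=> r0 x0 xy; apply: ge0_ler_powR; rewrite ?nnegrE// (le_trans x0).
Qed.

Let th0 : 0 <= th. Proof. by rewrite ltW// (lt_trans _ th1). Qed.

(* Instead of removing one point at a time, split the index interval at the
   step in which the additive control [G] crosses its midpoint. *)
Lemma discrete_sewing (G c : nat -> R) (Xi : nat -> nat -> R) (K : R)
    (n a b : nat) : 0 <= K -> (b <= n)%N ->
  (forall i j, (i <= j)%N -> (j <= n)%N -> G i <= G j) ->
  (forall i j k, (i <= j)%N -> (j <= k)%N -> (k <= n)%N ->
     `|Xi i k - Xi i j - Xi j k| <= K * (G k - G i) `^ th) ->
  (forall k, (k < n)%N -> `|c k - Xi k k.+1| <= K * (G k.+1 - G k) `^ th) ->
  (a <= b)%N ->
  `|\sum_(a <= k < b) c k - Xi a b| <= sewing_cst * K * (G b - G a) `^ th.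
Proof.
move=> K0 bn Gn dXi cXi.
(* At three equal indices the defect bound is a power of 0, hence 0. *)
have Xi0 i : (i <= n)%N -> Xi i i = 0.
  move=> ni; have := dXi i i i (leqnn _) (leqnn _) ni.
  rewrite subrr sub0r normrN subrr powR0 ?gt_eqF ?(lt_trans _ th1)// mulr0.
  by rewrite normr_le0 => /eqP.
have [m] := ubnP (b - a)%N; elim: m a b bn => // m IH a b bn bam ab.
have [ab'|anb] := eqVneq a b.
  rewrite -ab' big_geq// Xi0 ?ab'// subrr normr0.
  apply: mulr_ge0; last exact: powR_ge0.
  by apply: mulr_ge0 => //; exact: sewing_cst_ge0.
have {}ab : (a < b)%N by rewrite ltn_neqAle anb.
set w := G b - G a; have w0 : 0 <= w by rewrite subr_ge0 Gn// ltnW.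
pose P := fun i => (a <= i < b)%N && (G i - G a <= w / 2).
have Pa : P a by rewrite /P leqnn ab subrr divr_ge0.
have Pub i : P i -> (i <= b)%N by move=> /andP[/andP[_ /ltnW]].
case: (ex_maxnP (ex_intro _ a Pa) Pub) => j /andP[/andP[aj jb] Gj] jmax.
(* By maximality of [j], the index [j.+1] is either [b] or already beyond the midpoint of the
   control. *)
have Gj1 : G b - G j.+1 <= w / 2.
  have [-> |j1b] := eqVneq j.+1 b; first by rewrite subrr divr_ge0.
  rewrite leNgt; apply/negP => H.
  suff /jmax : P j.+1 by rewrite ltnn.
  rewrite /P (leq_trans aj)//= ltn_neqAle j1b jb/=.
  by move: H; rewrite /w; lra.
have jn := leq_trans jb bn.
have e1 := IH a j (ltnW jn) ltac:(lia) aj.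
have e2 := IH j.+1 b bn ltac:(lia) jb.
have d1 := dXi a j b aj (ltnW jb) bn.
have d2 := dXi j j.+1 b (leqnSn _) jb bn.
have d3 := cXi j jn.
have le1 : (G j - G a) `^ th <= (w / 2) `^ th by apply: le_powR_base; rewrite ?subr_ge0 ?Gn// ltnW.
have le2 : (G b - G j.+1) `^ th <= (w / 2) `^ th by apply: le_powR_base; rewrite ?subr_ge0 ?Gn.
have Gaj : G a <= G j by apply: Gn => //; exact: ltnW.
have Gjj : G j <= G j.+1 by exact: Gn.
have Gjb : G j.+1 <= G b by exact: Gn.
have le3 : (G b - G j) `^ th <= w `^ th.
  by apply: le_powR_base; rewrite ?subr_ge0 /w//; lra.
have le4 : (G j.+1 - G j) `^ th <= w `^ th.
  by apply: le_powR_base; rewrite ?subr_ge0 /w//; lra.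
have sK : 0 <= sewing_cst * K by apply: mulr_ge0 => //; exact: sewing_cst_ge0.
have {e1} e1 := le_trans e1 (ler_wpM2l sK le1).
have {e2} e2 := le_trans e2 (ler_wpM2l sK le2).
have {d2} d2 := le_trans d2 (ler_wpM2l K0 le3).
have {d3} d3 := le_trans d3 (ler_wpM2l K0 le4).
rewrite (big_cat_nat (leq_trans aj (leqnSn _)) jb)/= big_nat_recr//=.
move: e1 e2 d1 d2 d3; rewrite -/w.
set s1 := \sum_(_ <= _ < j) _; set s2 := \sum_(_ <= _ < b) _ => e1 e2 d1 d2 d3.
(* The crossing step from [j] to [j.+1] is isolated, so each of the two remaining blocks carries at
   most half of the control. *)
have -> : s1 + c j + s2 - Xi a b = (s1 - Xi a j) + (s2 - Xi j.+1 b) +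
   (c j - Xi j j.+1) - (Xi a b - Xi a j - Xi j b) -
   (Xi j b - Xi j j.+1 - Xi j.+1 b) by ring.
apply: (le_trans (ler_normB _ _)).
have -> : sewing_cst * K * w `^ th = sewing_cst * K * (w / 2) `^ th +
    sewing_cst * K * (w / 2) `^ th + K * w `^ th + K * w `^ th + K * w `^ th.
  rewrite -[in LHS]sewing_cstE.
  transitivity (sewing_cst * K * (halving_factor * w `^ th) + 3 * (K * w `^ th)); first by ring.
  by rewrite -powR_half//; ring.
apply: lerD => //; apply: (le_trans (ler_normB _ _)); apply: lerD => //.
apply: (le_trans (ler_normD _ _)); apply: lerD => //.
by apply: (le_trans (ler_normD _ _)); apply: lerD.
Qed.

(** Cutting at the point where [g], rather than time, is halved multiplies the total bound by
    [halving_factor]; iterating drives it to 0. The relation [Q s t b], read as: a quantity over the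
    interval is at most [b], is left abstract to cover both Cauchy estimates and the constancy of a
    path. *)
Lemma bisection (T : R) (g : R -> R) (Q : R -> R -> R -> Prop) (K : R) :
  {within `[0, T], continuous g} ->
  (forall s t, 0 <= s -> s <= t -> t <= T -> g s <= g t) ->
  (forall s u t b c, 0 <= s -> s <= u -> u <= t -> t <= T ->
     Q s u b -> Q u t c -> Q s t (b + c)) ->
  (forall s t b c, b <= c -> Q s t b -> Q s t c) ->
  (forall s t, 0 <= s -> s <= t -> t <= T -> Q s t (K * (g t - g s) `^ th)) ->
  forall e s t, 0 < e -> 0 <= s -> s <= t -> t <= T -> Q s t e.
Proof.
move=> cg gn Qadd Qmon QK e s t e0 s0 st tT.
have iter n : forall s t, 0 <= s -> s <= t -> t <= T ->
    Q s t (halving_factor ^+ n * (K * (g t - g s) `^ th)).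
  elim: n => [|n IH] {s t s0 st tT} s t s0 st tT.
    by rewrite expr0 mul1r; exact: QK.
  have gst : g s <= g t by exact: gn.
  have [|||u] := @IVT _ g s t ((g s + g t) / 2).
  - exact: st.
  - apply: continuous_subspaceW cg => x /=; rewrite !in_itv/= => /andP[sx xt].
    by rewrite (le_trans s0 sx) (le_trans xt tT).
  - by rewrite min_l// max_r//; lra.
  rewrite in_itv/= => /andP[su ut] gu.
  apply: Qmon (Qadd s u t _ _ s0 su ut tT (IH _ _ _ _ _) (IH _ _ _ _ _)) => //;
    [|exact: le_trans ut tT|exact: le_trans s0 su].
  rewrite gu (_ : (g s + g t) / 2 - g s = (g t - g s) / 2); last by field.
  rewrite (_ : g t - (g s + g t) / 2 = (g t - g s) / 2); last by field.
  set x := ((g t - g s) / 2) `^ th.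
  have H : 2 * x = halving_factor * (g t - g s) `^ th.
    by rewrite /x powR_half// subr_ge0.
  rewrite exprS -mulrA.
  rewrite le_eqVlt; apply/orP; left; apply/eqP.
  transitivity (halving_factor ^+ n * (K * (2 * x))); first by ring.
  by rewrite H; ring.
have : halving_factor ^+ n * (K * (g t - g s) `^ th) @[n --> \oo] --> 0 * (K * (g t - g s) `^ th).
  apply: cvgMl; apply: cvg_expr.
  by rewrite ger0_norm ?halving_factor_ge0// halving_factor_lt1.
rewrite mul0r => /cvgrPdist_lt /(_ e e0) [n _ /(_ n (leqnn n)) /=].
rewrite sub0r normrN => /ltW H; apply: Qmon (iter n s t s0 st tT).
exact: le_trans (ler_norm _) H.
Qed.

End Sewing.

(** * Partition points and gamma-sums along one partition *)

Section Nodes.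
Context {R : realType} (T : R) (s : seq R).
Hypothesis hs : itv_partition 0 T s.

(* Index of the last partition point [<= t]; the point 0 is not listed in [s]. *)
Definition floor_idx (t : R) : nat := count (fun x => x <= t) s.

Definition floor_node (t : R) : R := node 0 s (floor_idx t).

Lemma node_ltS k : (k < size s)%N -> node 0 s k < node 0 s k.+1.
Proof. by move=> ks; case: hs => /(pathP 0) /(_ k ks). Qed.

Lemma node_le i j : (i <= j)%N -> (j <= size s)%N -> node 0 s i <= node 0 s j.
Proof.
elim: j => [|j IH]; first by rewrite leqn0 => /eqP ->.
rewrite leq_eqVlt => /predU1P[-> //|]; rewrite ltnS => ij js.
by apply: (le_trans (IH ij (ltnW js))); apply/ltW/node_ltS.
Qed.

Lemma node_size : node 0 s (size s) = T.
Proof. exact: itv_partition_nth_size hs. Qed.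

Lemma node_ge0 k : (k <= size s)%N -> 0 <= node 0 s k.
Proof. by move=> ks; exact: (@node_le 0 k). Qed.

Lemma node_leT k : (k <= size s)%N -> node 0 s k <= T.
Proof. by move=> ks; rewrite -node_size; exact: node_le. Qed.

Lemma floor_idx_le t : (floor_idx t <= size s)%N.
Proof. exact: count_size. Qed.

Lemma floor_idx_mono t u : t <= u -> (floor_idx t <= floor_idx u)%N.
Proof. by move=> tu; apply: sub_count => x /= /le_trans; apply. Qed.

Let sorted_s : sorted <=%R s.
Proof.
case: hs => /path_sorted + _; apply: sub_sorted => x y; exact: ltW.
Qed.

Lemma floor_node_le t : 0 <= t -> floor_node t <= t.
Proof.
move=> t0; rewrite /floor_node /node; case E : (floor_idx t) => [//|k] /=.
by apply: (nth_count_le _ sorted_s); rewrite -/(floor_idx t) E.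
Qed.

Lemma floor_idx_gt t k : (floor_idx t <= k < size s)%N -> t < node 0 s k.+1.
Proof. exact: nth_count_gt sorted_s. Qed.

Lemma floor_node_bound t : 0 <= t -> 0 <= floor_node t <= T.
Proof. by move=> t0; rewrite node_ge0 ?floor_idx_le// node_leT ?floor_idx_le. Qed.

Lemma node_diff_mesh k : (k < size s)%N ->
  node 0 s k.+1 - node 0 s k <= mesh 0 s.
Proof.
move=> ks; rewrite /mesh.
exact: (le_bigmax _ (fun k : 'I_(size s) => node 0 s k.+1 - node 0 s k) (Ordinal ks)).
Qed.

Lemma floor_node_mesh t : 0 <= t -> t <= T -> `|t - floor_node t| <= mesh 0 s.
Proof.
move=> t0 tT; rewrite ger0_norm ?subr_ge0 ?floor_node_le//.
have := floor_idx_le t; rewrite leq_eqVlt => /predU1P[E|lts].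
  rewrite /floor_node E node_size; apply: (@le_trans _ _ 0); first by rewrite subr_le0.
  exact: bigmax_ge_id.
apply: le_trans (node_diff_mesh lts); rewrite lerB// ltW//.
by apply: floor_idx_gt; rewrite leqnn.
Qed.

Definition gamma_coeff (gam : R) (V : R -> R) (k : nat) : R :=
  V (node 0 s k) + gam * (V (node 0 s k.+1) - V (node 0 s k)).

Definition scalar_gamma_sum (gam : R) (V Z : R -> R) (t : R) : R :=
  \sum_(k < size s) gamma_coeff gam V k *
    (Z (Num.min (node 0 s k.+1) t) - Z (Num.min (node 0 s k) t)).

(** Intervals ending before [t] contribute fully, the one containing [t] partially, later ones not
    at all. At [t = T] the floor index is [size s], and the partial term vanishes with its
    increment. *)
Lemma scalar_gamma_sum_floor gam V Z t : 0 <= t -> t <= T ->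
  scalar_gamma_sum gam V Z t =
  \sum_(0 <= k < floor_idx t) gamma_coeff gam V k *
     (Z (node 0 s k.+1) - Z (node 0 s k)) +
  gamma_coeff gam V (floor_idx t) * (Z t - Z (floor_node t)).
Proof.
move=> t0 tT; rewrite /scalar_gamma_sum.
rewrite -(big_mkord xpredT (fun k => gamma_coeff gam V k *
  (Z (Num.min (node 0 s k.+1) t) - Z (Num.min (node 0 s k) t)))).
rewrite (big_cat_nat (leq0n _) (floor_idx_le t))/=; congr (_ + _).
  apply: eq_big_nat => k /andP[_ kt].
  have kn j : (j <= floor_idx t)%N -> node 0 s j <= t.
    by move=> jt; apply: le_trans (floor_node_le t0); apply: node_le => //; exact: floor_idx_le.
  by rewrite !min_l ?kn// ltnW.
have := floor_idx_le t; rewrite leq_eqVlt => /predU1P[E|lts].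
  rewrite E big_geq// /floor_node E node_size.
  have -> : t = T.
    apply/eqP; rewrite eq_le tT -node_size -E.
    exact: floor_node_le.
  by rewrite subrr mulr0.
rewrite big_ltn// big_nat big1 ?addr0.
  rewrite min_r; last by apply/ltW/floor_idx_gt; rewrite leqnn.
  by rewrite min_l// floor_node_le.
move=> k /andP[tk ks]; rewrite !min_r ?subrr ?mulr0//.
- case: k tk ks => // k tk ks; apply/ltW/floor_idx_gt.
  by rewrite -ltnS tk ltnW.
- by apply/ltW/floor_idx_gt; rewrite ks andbT ltnW.
Qed.

Lemma scalar_gamma_sum0 gam V Z : scalar_gamma_sum gam V Z 0 = 0.
Proof.
rewrite /scalar_gamma_sum big1// => k _; rewrite !min_r ?node_ge0 ?subrr ?mulr0//.
exact: ltnW.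
Qed.

Lemma scalar_gamma_sum_cst gam Z t : 0 <= t -> t <= T ->
  scalar_gamma_sum gam (fun=> 1) Z t = Z t - Z 0.
Proof.
move=> t0 tT; rewrite scalar_gamma_sum_floor//.
have E k : gamma_coeff gam (fun=> 1) k = 1 by rewrite /gamma_coeff subrr mulr0 addr0.
under eq_bigr do rewrite E mul1r.
by rewrite telescope_sumr// E mul1r -/(floor_node t) addrC addrA subrK.
Qed.

End Nodes.

(** * Convergence of gamma-sums along the partitions *)

Section GammaIntegral.
Context {R : realType} (T gam p : R) (pi : nat -> seq R) (g : R -> R).
Hypothesis gam01 : 0 <= gam <= 1.
Hypothesis p23 : 2 < p < 3.
Hypothesis hpi : forall n, itv_partition 0 T (pi n).
Hypothesis pi_mesh : mesh 0 (pi n) @[n --> \oo] --> 0.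
Hypothesis g_cont : {within `[0, T], continuous g}.
Hypothesis g_mono : forall s t, 0 <= s -> s <= t -> t <= T -> g s <= g t.

Local Notation node := (node 0).

(** The size of a path increment of finite p-variation. All errors are measured in its powers, the
    third being the first whose exponent [3 / p] exceeds 1. *)
Definition ctrl_root (s t : R) : R := (g t - g s) `^ p^-1.
Local Notation h := ctrl_root.

Lemma p_gt0 : 0 < p. Proof. by case/andP: p23 => + _; apply: lt_trans. Qed.

Lemma ctrl_root_ge0 s t : 0 <= h s t. Proof. exact: powR_ge0. Qed.

Lemma ctrl_root_exp s t k : 0 <= s -> s <= t -> t <= T ->
  h s t ^+ k = (g t - g s) `^ (k%:R / p).
Proof.
by move=> s0 st tT; rewrite -powR_mulrn ?powR_ge0// -powRrM mulrC.
Qed.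

Lemma ctrl_root_le s t s' t' : 0 <= s' -> s' <= s -> s <= t -> t <= t' -> t' <= T ->
  h s t <= h s' t'.
Proof.
move=> s'0 ss st tt tT; have s0 := le_trans s'0 ss; have tT' := le_trans tt tT.
apply: le_powR_base; first by rewrite invr_ge0 ltW// p_gt0.
  by rewrite subr_ge0 g_mono.
apply: lerB; apply: g_mono => //; [exact: le_trans st|exact: le_trans tT'].
Qed.

Lemma floor_node_cvg t : 0 <= t -> t <= T ->
  floor_node (pi n) t @[n --> \oo] --> t.
Proof.
move=> t0 tT; apply/cvgrPdist_le => e e0.
move/cvgrPdist_le : pi_mesh => /(_ e e0); apply: filterS => n; rewrite sub0r normrN.
apply: le_trans; apply: le_trans (floor_node_mesh (hpi n) t0 tT) (ler_norm _).
Qed.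

Lemma within_floor_node_cvg (f : R -> R) t : {within `[0, T], continuous f} ->
  0 <= t -> t <= T -> f (floor_node (pi n) t) @[n --> \oo] --> f t.
Proof.
move=> /within_cvgP cf t0 tT; apply/cvgrPdist_lt => e e0.
have tin : `[0, T]%classic t by rewrite /= in_itv/= t0.
have H : \forall n \near \oo, `[0, T]%classic (floor_node (pi n) t) ->
    `|f t - f (floor_node (pi n) t)| < e.
  exact: floor_node_cvg t0 tT _ (cf t tin e e0).
move: H; apply: filterS => n; apply.
by rewrite /= in_itv/=; exact: floor_node_bound.
Qed.

Lemma g_floor_cvg t : 0 <= t -> t <= T ->
  g (floor_node (pi n) t) @[n --> \oo] --> g t.
Proof. exact: within_floor_node_cvg. Qed.

Lemma floor_node_mono n s t : s <= t -> floor_node (pi n) s <= floor_node (pi n) t.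
Proof.
by move=> st; apply: (node_le (hpi n)); [exact: floor_idx_mono|exact: floor_idx_le].
Qed.

Lemma h_floor_cvg r s t : 0 < r -> 0 <= s -> s <= t -> t <= T ->
  (g (floor_node (pi n) t) - g (floor_node (pi n) s)) `^ r @[n --> \oo]
    --> (g t - g s) `^ r.
Proof.
move=> r0 s0 st tT; have t0 := le_trans s0 st; have sT := le_trans st tT.
apply: cvg_powR_base => //.
- move=> n; rewrite subr_ge0; apply: g_mono.
  + by have /andP[] := floor_node_bound (hpi n) s0.
  + exact: floor_node_mono.
  + by have /andP[] := floor_node_bound (hpi n) t0.
- by rewrite subr_ge0 g_mono.
- by apply: cvgB; exact: g_floor_cvg.
Qed.

Lemma h_rest_cvg t : 0 <= t -> t <= T ->
  h (floor_node (pi n) t) t @[n --> \oo] --> 0.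
Proof.
move=> t0 tT; rewrite [X in _ --> X](_ : 0 = (g t - g t) `^ p^-1); last first.
  by rewrite subrr powR0// invr_eq0 gt_eqF// p_gt0.
apply: cvg_powR_base.
- by rewrite invr_gt0 p_gt0.
- move=> n; rewrite subr_ge0; apply: g_mono => //.
  + by have /andP[] := floor_node_bound (hpi n) t0.
  + exact: (floor_node_le (hpi n)).
- by rewrite subrr.
- by apply: cvgB; [exact: cvg_cst|exact: g_floor_cvg].
Qed.

Definition gamma_cst : R := sewing_cst (3 / p).

Lemma gamma_exp_gt1 : 1 < 3 / p.
Proof. by rewrite ltr_pdivlMr ?p_gt0// mul1r; case/andP: p23. Qed.

(** * From germs on partition points to the limit of gamma-sums *)

Section Convergence.
Context (V Z : R -> R) (Xi : nat -> nat -> nat -> R) (Xil : R -> R -> R) (K B : R).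
Hypothesis K0 : 0 <= K.
Hypothesis V_bound : forall t, 0 <= t -> t <= T -> `|V t| <= B.
Hypothesis Z_root : forall s t, 0 <= s -> s <= t -> t <= T ->
  `|Z t - Z s| <= K * h s t.
Hypothesis Xi_defect : forall n i j k, (i <= j)%N -> (j <= k)%N ->
  (k <= size (pi n))%N ->
  `|Xi n i k - Xi n i j - Xi n j k| <=
    K * h (node (pi n) i) (node (pi n) k) ^+ 3.
Hypothesis Xi_step : forall n k, (k < size (pi n))%N ->
  `|gamma_coeff (pi n) gam V k * (Z (node (pi n) k.+1) - Z (node (pi n) k))
    - Xi n k k.+1| <= K * h (node (pi n) k) (node (pi n) k.+1) ^+ 3.
Hypothesis Xi_cvg : forall s t, 0 <= s -> s <= t -> t <= T ->
  Xi n (floor_idx (pi n) s) (floor_idx (pi n) t) @[n --> \oo] --> Xil s t.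

Local Notation D n := (scalar_gamma_sum (pi n) gam V Z).

Lemma gamma_coeff_bound n k : (k <= size (pi n))%N ->
  `|gamma_coeff (pi n) gam V k| <= 3 * B.
Proof.
move=> ks; have h1 := V_bound (node_ge0 (hpi n) ks) (node_leT (hpi n) ks).
have B0 : 0 <= B by exact: le_trans h1.
have h2 : `|V (node (pi n) k.+1)| <= B.
  have [ks'|ks'] := ltnP k (size (pi n)).
    exact: V_bound (node_ge0 (hpi n) ks') (node_leT (hpi n) ks').
  (* Past the last partition point [node] returns its default 0, which still lies in [[0, T]]. *)
  rewrite /Defs.node nth_default//; apply: V_bound => //.
  by have := node_leT (hpi n) (leq0n _).
have [g0 g1] := andP gam01.
rewrite /gamma_coeff; apply: le_trans (ler_normD _ _) _.
rewrite (_ : 3 * B = B + (B + B)); last by ring.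
apply: lerD => //; rewrite normrM ger0_norm//.
apply: le_trans (ler_wpM2r (normr_ge0 _) g1) _; rewrite mul1r.
by apply: le_trans (ler_normB _ _) _; exact: lerD.
Qed.

Lemma gamma_rest_cvg t : 0 <= t -> t <= T ->
  gamma_coeff (pi n) gam V (floor_idx (pi n) t) *
    (Z t - Z (floor_node (pi n) t)) @[n --> \oo] --> 0.
Proof.
move=> t0 tT.
have H : 3 * B * (K * h (floor_node (pi n) t) t) @[n --> \oo] --> (0 : R).
  rewrite -(mulr0 (3 * B)) -(mulr0 K).
  by apply: cvgMr; apply: cvgMr; exact: h_rest_cvg.
apply/norm_cvg0P.
apply: (squeeze_cvgr _ (cvg_cst 0) H).
near=> n; rewrite normr_ge0 /= normrM; apply: ler_pM => //.
  exact: gamma_coeff_bound (floor_idx_le _ _).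
apply: Z_root => //; last exact: floor_node_le (hpi n) _ t0.
by have /andP[] := floor_node_bound (hpi n) t0.
Unshelve. all: by end_near. Qed.

(** Sewing between the floor indices of [s] and [t] compares the n-th sum with the n-th germ, with a
    constant independent of n; germ, control and incomplete intervals then pass to the limit. The
    slack [e] is there because the sums are not yet known to converge. *)
Lemma gamma_sum_near s t e : 0 < e -> 0 <= s -> s <= t -> t <= T ->
  \forall n \near \oo, `|D n t - D n s - Xil s t| <=
    gamma_cst * K * (g t - g s) `^ (3 / p) + e.
Proof.
move=> e0 s0 st tT; have t0 := le_trans s0 st; have sT := le_trans st tT.
pose rest n t := gamma_coeff (pi n) gam V (floor_idx (pi n) t) *
    (Z t - Z (floor_node (pi n) t)).
pose b n := gamma_cst * K *
  (g (floor_node (pi n) t) - g (floor_node (pi n) s)) `^ (3 / p).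
have th0 : 0 < 3 / p by rewrite (lt_trans _ gamma_exp_gt1).
have bc : b n @[n --> \oo] --> gamma_cst * K * (g t - g s) `^ (3 / p).
  by apply: cvgMr; exact: h_floor_cvg.
(* A quarter each for the control at the floor nodes, the germ and the two incomplete intervals. *)
have e4 : 0 < e / 4 by rewrite divr_gt0.
have step n : `|\sum_(floor_idx (pi n) s <= k < floor_idx (pi n) t)
    (gamma_coeff (pi n) gam V k * (Z (node (pi n) k.+1) - Z (node (pi n) k)))
    - Xi n (floor_idx (pi n) s) (floor_idx (pi n) t)| <= b n.
  have nb k : (k <= size (pi n))%N -> 0 <= node (pi n) k <= T.
    by move=> ks; rewrite (node_ge0 (hpi n) ks) (node_leT (hpi n) ks).
  apply: (@discrete_sewing R (3 / p) gamma_exp_gt1 (fun k => g (node (pi n) k))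
    _ (Xi n) K (size (pi n))) => //.
  - exact: floor_idx_le.
  - move=> i j ij jn; have /andP[i0 _] := nb i (leq_trans ij jn).
    have /andP[_ jT] := nb j jn.
    by apply: g_mono => //; exact: (node_le (hpi n)).
  - move=> i j k ij jk kn; have := Xi_defect ij jk kn; rewrite ctrl_root_exp//.
    + by have /andP[] := nb i (leq_trans ij (leq_trans jk kn)).
    + by apply: (node_le (hpi n)) => //; exact: leq_trans jk.
    + by have /andP[] := nb k kn.
  - move=> k kn; have := Xi_step kn; rewrite ctrl_root_exp//.
    + by have /andP[] := nb k (ltnW kn).
    + exact: (node_le (hpi n)).
    + by have /andP[] := nb _ kn.
  - exact: floor_idx_mono.
have DE n : D n t - D n s = \sum_(floor_idx (pi n) s <= k < floor_idx (pi n) t)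
    (gamma_coeff (pi n) gam V k * (Z (node (pi n) k.+1) - Z (node (pi n) k)))
    + rest n t - rest n s.
  rewrite !(scalar_gamma_sum_floor (hpi n))//.
  rewrite (big_cat_nat (leq0n _) (floor_idx_mono (pi n) st))/=.
  by rewrite /rest; ring.
have /cvgrPdist_le /(_ _ e4) N1 := bc.
have /cvgrPdist_le /(_ _ e4) N2 := Xi_cvg s0 st tT.
have /cvgrPdist_le /(_ _ e4) N3 := gamma_rest_cvg t0 tT.
have /cvgrPdist_le /(_ _ e4) N4 := gamma_rest_cvg s0 sT.
apply: filterS (filterI (filterI N4 N3) (filterI N2 N1)) => n /= [[+ +] [+ +]].
rewrite -/(rest n s) -/(rest n t) !sub0r !normrN => r1 r2 r3 r4.
have := step n; rewrite DE; set S := \sum_(_ <= _ < _) _ => r5.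
move: r1 r2 r3 r4 r5; rewrite !ler_norml; lra.
Qed.

(** Two sums of high rank are close to the same limit germ, so their difference has increments of
    order [3 / p], up to slack; bisection makes it arbitrarily small. *)
Lemma gamma_sum_cauchy t : 0 <= t -> t <= T -> cvgn (fun n => D n t).
Proof.
move=> t0 tT.
(* The slack is quantified inside [Q], so the rank may depend on the interval; joining two intervals
   halves the slack. *)
pose Q s t b := forall e, 0 < e -> \forall m & n \near \oo,
  `|(D m t - D m s) - (D n t - D n s)| <= b + e.
have H e : 0 < e -> Q 0 t e.
  move=> e0; apply: (@bisection R (3 / p) gamma_exp_gt1 T g Q
     (2 * (gamma_cst * K)) g_cont g_mono) => //.
  - move=> s u v b c s0 su uv vT Qb Qc d d0.
    have d2 : 0 < d / 2 by rewrite divr_gt0.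
    move: (Qb _ d2) (Qc _ d2); apply: filterS2 => -[m n] /=.
    rewrite !ler_norml; lra.
  - move=> s u b c bc Qb d d0; move: (Qb d d0).
    by apply: filterS => -[m n] /= /le_trans; apply; rewrite lerD2r.
  - move=> s u s0 su uT d d0; have d2 : 0 < d / 2 by rewrite divr_gt0.
    have N := gamma_sum_near d2 s0 su uT.
    near=> m n.
    have : `|D m u - D m s - Xil s u| <= gamma_cst * K * (g u - g s) `^ (3 / p) + d / 2.
      by near: m; apply: N.
    have : `|D n u - D n s - Xil s u| <= gamma_cst * K * (g u - g s) `^ (3 / p) + d / 2.
      by near: n; apply: N.
    rewrite !ler_norml; lra.
apply/cauchy_cvgP/cauchyP => e e0.
have e3 : 0 < e / 3 by rewrite divr_gt0.
have [[A1 A2] /= [A1n A2n] HA] := H _ e3 _ e3.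
have [n [A1n' A2n']] := filter_ex (filterI A1n A2n).
exists (D n t); move: A1n; apply: filterS => m A1m.
have := HA (m, n) (conj A1m A2n'); rewrite /= !(scalar_gamma_sum0 (hpi _)) !subr0.
rewrite /ball/= distrC => H1; apply: le_lt_trans H1 _; lra.
Unshelve. all: by end_near. Qed.

Lemma gamma_integral_estimate s t : 0 <= s -> s <= t -> t <= T ->
  `|limn (fun n => D n t) - limn (fun n => D n s) - Xil s t| <=
     gamma_cst * K * h s t ^+ 3.
Proof.
move=> s0 st tT; have t0 := le_trans s0 st; have sT := le_trans st tT.
rewrite ctrl_root_exp//; apply/ler_addgt0Pr => e e0.
have C : `|D n t - D n s - Xil s t| @[n --> \oo] -->
  `|limn (fun n => D n t) - limn (fun n => D n s) - Xil s t|.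
  apply: cvg_norm; apply: cvgB; last exact: cvg_cst.
  by apply: cvgB; exact: gamma_sum_cauchy.
apply: (cvgr_to_le C); exact: gamma_sum_near.
Qed.

End Convergence.
End GammaIntegral.

(** * Integrals over segments and the moment problem *)

Section SegmentIntegral.
Context {R : realType}.

Definition seg_integral (f : R -> R) (a b : R) : R :=
  \int[@lebesgue_measure R]_(x in `[a, b]) f x.

Lemma segment_integrable (f : R -> R) a b : {within `[a, b], continuous f} ->
  (@lebesgue_measure R).-integrable `[a, b] (EFin \o f).
Proof. exact: continuous_compact_integrable (@segment_compact R a b). Qed.

Lemma eq_seg_integral (f f' : R -> R) a b :
  (forall x, a <= x -> x <= b -> f x = f' x) ->
  seg_integral f a b = seg_integral f' a b.
Proof.
move=> E; apply: eq_Rintegral => x; rewrite inE/= in_itv/= => /andP[ax xb].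
exact: E.
Qed.

Lemma seg_integralD (f f' : R -> R) a b :
  {within `[a, b], continuous f} -> {within `[a, b], continuous f'} ->
  seg_integral (fun x => f x + f' x) a b = seg_integral f a b + seg_integral f' a b.
Proof.
by move=> cf cf'; apply: RintegralD => //; exact: segment_integrable.
Qed.

Lemma seg_integralZ c (f : R -> R) a b : {within `[a, b], continuous f} ->
  seg_integral (fun x => c * f x) a b = c * seg_integral f a b.
Proof. by move=> cf; apply: RintegralZl => //; exact: segment_integrable. Qed.

Lemma seg_integral_cst c (a b : R) : a <= b -> seg_integral (fun=> c) a b = c * (b - a).
Proof.
move=> ab; rewrite /seg_integral Rintegral_cst//; congr (_ * _).
have E := @lebesgue_measure_itv R `[a, b].
rewrite [X in fine X]E/= lte_fin; case: ltP => //= ba.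
have -> : a = b by apply/eqP; rewrite eq_le ab.
by rewrite subrr.
Qed.

Lemma le_seg_integral (f f' : R -> R) a b :
  {within `[a, b], continuous f} -> {within `[a, b], continuous f'} ->
  (forall x, a <= x -> x <= b -> f x <= f' x) ->
  seg_integral f a b <= seg_integral f' a b.
Proof.
move=> cf cf' ff'; apply: le_Rintegral => //; [exact: segment_integrable..|].
by move=> x; rewrite /= in_itv/= => /andP[ax xb]; exact: ff'.
Qed.

Lemma seg_integral_bounds (f : R -> R) T s t m M : {within `[0, T], continuous f} ->
  0 <= s -> s <= t -> t <= T ->
  (forall r, s <= r -> r <= t -> m <= f r <= M) ->
  m * (t - s) <= seg_integral f 0 t - seg_integral f 0 s <= M * (t - s).
Proof.
move=> cf s0 st tT H.
have sub a b : 0 <= a -> b <= T -> {within `[a, b], continuous f}.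
  move=> a0 bT; apply: continuous_subspaceW cf => x /=; rewrite !in_itv/=.
  by move=> /andP[ax xb]; rewrite (le_trans a0 ax) (le_trans xb bT).
have cst c : {within `[s, t], continuous (fun=> c : R)}.
  by apply: continuous_subspaceT => x; exact: cvg_cst.
have -> : seg_integral f 0 t - seg_integral f 0 s = seg_integral f s t.
  rewrite /seg_integral Rintegral_itvB ?bnd_simp//; last exact: segment_integrable (sub _ _ _ _).
  rewrite Rintegral_itv_obnd_cbnd//; apply: integrableS (segment_integrable (sub s t s0 tT)) => //.
  exact: subset_itv_oc_cc.
rewrite -!seg_integral_cst//; apply/andP; split.
  by apply: le_seg_integral => //; [exact: sub|move=> x sx xt; have /andP[] := H x sx xt].
by apply: le_seg_integral => //; [exact: sub|move=> x sx xt; have /andP[] := H x sx xt].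
Qed.

Lemma seg_integral_same (f : R -> R) a : seg_integral f a a = 0.
Proof. by rewrite /seg_integral set_itv1 Rintegral_set1. Qed.

Lemma within_continuousM (A : set R) (f f' : R -> R) : {within A, continuous f} ->
  {within A, continuous f'} -> {within A, continuous (fun x => f x * f' x)}.
Proof. by move=> cf cf' x; apply: cvgM; [exact: cf|exact: cf']. Qed.

Lemma within_continuousB (A : set R) (f f' : R -> R) : {within A, continuous f} ->
  {within A, continuous f'} -> {within A, continuous (fun x => f x - f' x)}.
Proof. by move=> cf cf' x; apply: cvgB; [exact: cf|exact: cf']. Qed.

Lemma within_continuousX (A : set R) k : {within A, continuous (fun x : R => x ^+ k)}.
Proof. by apply: continuous_subspaceT; exact: exprn_continuous. Qed.

Lemma seg_integral_sqr0 (f : R -> R) T : 0 < T -> {within `[0, T], continuous f} ->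
  seg_integral (fun x => f x * f x) 0 T <= 0 ->
  forall t, 0 <= t -> t <= T -> f t = 0.
Proof.
move=> T0 cf I0 t t0 tT; apply/eqP/negPn/negP => ft0.
have cff := within_continuousM cf cf.
have c0 : 0 < f t * f t by rewrite -expr2 exprn_even_gt0.
have c20 : 0 < f t * f t / 2 by rewrite divr_gt0.
have tin : `[0, T]%classic t by rewrite /= in_itv/= t0.
have [e /= e0 He] := (within_cvgP _ _).1 cff t tin _ c20.
(* An interval around [t], clipped to [[0, T]], on which the square stays above half of its value at
   [t]. *)
pose a := Num.max 0 (t - e / 2); pose b := Num.min T (t + e / 2).
have e2 : 0 < e / 2 by rewrite divr_gt0.
have a0 : 0 <= a by rewrite /a le_max lexx.
have bT : b <= T by rewrite /b ge_min lexx.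
have ab : a < b by rewrite /a /b lt_min !gt_max; apply/andP; split; apply/andP; split; lra.
have nneg x y : 0 <= x -> x <= y -> y <= T ->
    seg_integral (fun x => f x * f x) 0 x <= seg_integral (fun x => f x * f x) 0 y.
  move=> x0 xy yT; have [M M0 HM] := continuous_bounded (@segment_compact R 0 T) cff.
  have := @seg_integral_bounds _ T x y 0 M cff x0 xy yT.
  case/(_ _)/andP; last by rewrite mul0r subr_ge0.
  move=> r xr ry; rewrite -expr2 sqr_ge0/= expr2; apply: le_trans (ler_norm _) _.
  by apply: HM; rewrite /= in_itv/= (le_trans x0 xr) (le_trans ry yT).
have [M M0 HM] := continuous_bounded (@segment_compact R 0 T) cff.
have := @seg_integral_bounds _ T a b (f t * f t / 2) M cff a0 (ltW ab) bT.
case/(_ _)/andP.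
  move=> r ar rb; have rin : `[0, T]%classic r.
    by rewrite /= in_itv/= (le_trans a0 ar) (le_trans rb bT).
  have := HM r rin; have : `|f t * f t - f r * f r| < f t * f t / 2.
    apply: He => //=; rewrite ltr_norml.
    move: ar rb; rewrite /a /b ge_max le_min => /andP[_ h1] /andP[_ h2]; lra.
  rewrite ltr_norml ler_norml; lra.
have h1 := nneg 0 a (lexx 0) a0 (le_trans (ltW ab) bT).
have h2 := nneg b T (le_trans a0 (ltW ab)) bT (lexx T).
rewrite seg_integral_same in h1.
have : 0 < f t * f t / 2 * (b - a) by rewrite mulr_gt0// subr_gt0.
lra.
Qed.

(** Vanishing moments make [f] orthogonal to every polynomial. For [P] close to [f], the integral of
    [f ^ 2] equals that of [(f - P) * f]; accuracy [e / (M * (T + 1))], where [M] bounds [f], makes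
    it at most [e]. *)
Lemma moments_eq0 (f : R -> R) T : 0 < T -> {within `[0, T], continuous f} ->
  (forall k, seg_integral (fun t => t ^+ k * f t) 0 T = 0) ->
  forall t, 0 <= t -> t <= T -> f t = 0.
Proof.
move=> T_gt0 cf mom t t0 tT; have T0 := ltW T_gt0.
apply: (seg_integral_sqr0 T_gt0 cf) => //; apply/ler_addgt0Pr => e e0; rewrite add0r.
have [M M0 HM] := continuous_bounded (@segment_compact R 0 T) cf.
pose A := [set u : R -> R | exists P : {poly R}, u = fun x => P.[x]].
have c0 : 0 < M * (T + 1) by rewrite mulr_gt0// ltr_wpDl.
have := @stone_weierstrass R R `[0, T]%classic (@segment_compact R 0 T) A.
case/(_ _ _ _ _ _ f cf (e / (M * (T + 1))) (divr_gt0 e0 c0)).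
- by move=> u [P ->]; apply: continuous_subspaceT; exact: continuous_horner.
- by move=> c; exists c%:P; apply/funext => x; rewrite hornerC.
- by move=> u v [P ->] [Q ->]; exists (P + Q); apply/funext => x; rewrite hornerD.
- by move=> u v [P ->] [Q ->]; exists (P * Q); apply/funext => x; rewrite hornerM.
- move=> x y _ _ w _ wxy; exists id; first by exists 'X; apply/funext => z; rewrite hornerX.
  by move=> xy; apply: wxy; rewrite xy.
move=> _ [P ->] HP.
have cP : {within `[0, T], continuous (fun x => P.[x])}.
  by apply: continuous_subspaceT; exact: continuous_horner.
have momP : seg_integral (fun x => P.[x] * f x) 0 T = 0.
  have H n : {within `[0, T], continuous (fun x => (\sum_(i < n) P`_i * x ^+ i) * f x)} /\
     seg_integral (fun x => (\sum_(i < n) P`_i * x ^+ i) * f x) 0 T = 0.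
    elim: n => [|n [IH1 IH2]].
      have -> : (fun x => (\sum_(i < 0) P`_i * x ^+ i) * f x) = fun=> 0.
        by apply/funext => x; rewrite big_ord0 mul0r.
      split.
        by apply: continuous_subspaceT => x; exact: cvg_cst.
      by rewrite seg_integral_cst// mul0r.
    have E : (fun x => (\sum_(i < n.+1) P`_i * x ^+ i) * f x) =
        fun x => (\sum_(i < n) P`_i * x ^+ i) * f x + P`_n * (x ^+ n * f x).
      by apply/funext => x; rewrite big_ord_recr/= mulrDl mulrA.
    have c1 : {within `[0, T], continuous (fun x => x ^+ n * f x)}.
      by apply: within_continuousM => //; exact: within_continuousX.
    have c2 : {within `[0, T], continuous (fun x => P`_n * (x ^+ n * f x))}.
      by move=> x; apply: cvgMr; exact: c1.
    rewrite E; split; first by move=> x; apply: cvgD; [exact: IH1|exact: c2].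
    by rewrite seg_integralD// IH2 add0r seg_integralZ// mom mulr0.
  by rewrite -[RHS](H (size P)).2; apply: eq_seg_integral => x _ _; rewrite horner_coef.
have cPf := within_continuousM cP cf.
have cff := within_continuousM cf cf.
have -> : seg_integral (fun x => f x * f x) 0 T =
    seg_integral (fun x => f x * f x + -1 * (P.[x] * f x)) 0 T.
  rewrite seg_integralD//; last by move=> x; apply: cvgMr; exact: cPf.
  by rewrite seg_integralZ// momP mulr0 addr0.
apply: (@le_trans _ _ (seg_integral (fun=> e / (T + 1)) 0 T)).
  apply: le_seg_integral.
  - by move=> x; apply: cvgD; [exact: cff|apply: cvgMr; exact: cPf].
  - by apply: continuous_subspaceT => x; exact: cvg_cst.
  - move=> x x0 xT; have xin : `[0, T]%classic x by rewrite /= in_itv/= x0.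
    rewrite mulN1r -mulrBl; apply: le_trans (ler_norm _) _; rewrite normrM.
    have -> : e / (T + 1) = e / (M * (T + 1)) * M.
      by field; rewrite !gt_eqF// ltr_wpDl.
    by apply: ler_pM => //; [exact/ltW/HP|exact: HM].
rewrite seg_integral_cst// subr0 -mulrA ger_pMr// mulrC ler_pdivrMr ?ltr_wpDl//.
by rewrite mul1r lerDl.
Qed.

End SegmentIntegral.

(** * Words, controlled paths and the quasi-shuffle product *)

Section Words.
Context {R : realType} (m : nat).
Local Notation I := 'I_m.

(* Words are reversed, as in [gamma_signature_rev]: the head is the last letter. *)
Fixpoint quasi_shuffle (br : I -> I -> option I) (w : seq I) :
    seq I -> seq (seq I) :=
  match w with
  | [::] => fun v => [:: v]
  | i :: w' =>
    fix aux (v : seq I) : seq (seq I) :=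
      match v with
      | [::] => [:: i :: w']
      | j :: v' =>
        map (cons i) (quasi_shuffle br w' (j :: v')) ++
        map (cons j) (aux v') ++
        (if br i j is Some k then map (cons k) (quasi_shuffle br w' v')
         else [::])
      end
  end.

(** Multiplication of the coordinate [w] by the k-th power of time, one quasi-shuffle with the
    letter of time at each step. *)
Fixpoint time_words (br : I -> I -> option I) (i0 : I) (k : nat) (w : seq I) :
    seq (seq I) :=
  if k is k'.+1 then
    flatten [seq quasi_shuffle br [:: i0] u | u <- time_words br i0 k' w]
  else [:: w].

Context (T gam p : R) (pi : nat -> seq R) (g : R -> R).

Local Notation node := (node 0).
Local Notation h := (ctrl_root p g).

(* The relations of a rough path [(Y, A)], up to errors of order 3. [A] is set
   to 0 unless both letters satisfy [mid], since the actual area is then of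
   order 3; [br i j] is the letter of the bracket of the letters [i] and [j].
   [An n] is the area obtained from gamma-sums, between two points of the n-th
   partition given by their indices. *)
Record approx_rough_path (mid : pred I) (br : I -> I -> option I)
  (Y : I -> R -> R) (A : I -> I -> R -> R -> R)
  (An : nat -> I -> I -> nat -> nat -> R) (K : R) : Prop := ApproxRoughPath {
  arp_K0 : 0 <= K ;
  arp_path : forall i s t, 0 <= s -> s <= t -> t <= T ->
    `|Y i t - Y i s| <= K * h s t ;
  arp_path2 : forall i s t, ~~ mid i -> 0 <= s -> s <= t -> t <= T ->
    `|Y i t - Y i s| <= K * h s t ^+ 2 ;
  arp_area : forall i j s t, 0 <= s -> s <= t -> t <= T ->
    `|A i j s t| <= K * h s t ^+ 2 ;
  arp_area0 : forall i j s t, ~~ (mid i && mid j) -> A i j s t = 0 ;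
  arp_br : forall i j k, br i j = Some k -> ~~ mid k ;
  arp_bracket : forall i j s t, 0 <= s -> s <= t -> t <= T ->
    `|(Y i t - Y i s) * (Y j t - Y j s) - A i j s t - A j i s t
      - (if br i j is Some k then Y k t - Y k s else 0)| <= K * h s t ^+ 3 ;
  arp_darea : forall n i j a b, (a <= b)%N -> (b <= size (pi n))%N ->
    `|An n i j a b| <= K * h (node (pi n) a) (node (pi n) b) ^+ 2 ;
  arp_dchen : forall n i j a b c, (a <= b)%N -> (b <= c)%N ->
    (c <= size (pi n))%N ->
    `|An n i j a c - An n i j a b - An n i j b c -
      (Y i (node (pi n) b) - Y i (node (pi n) a)) *
      (Y j (node (pi n) c) - Y j (node (pi n) b))| <=
      K * h (node (pi n) a) (node (pi n) c) ^+ 3 ;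
  arp_dstep : forall n i j k, (k < size (pi n))%N ->
    `|An n i j k k.+1 - gam * (Y i (node (pi n) k.+1) - Y i (node (pi n) k)) *
      (Y j (node (pi n) k.+1) - Y j (node (pi n) k))| <=
      K * h (node (pi n) k) (node (pi n) k.+1) ^+ 3 ;
  arp_dcvg : forall i j s t, 0 <= s -> s <= t -> t <= T ->
    An n i j (floor_idx (pi n) s) (floor_idx (pi n) t) @[n --> \oo] -->
    A i j s t
}.

Hypothesis T0 : 0 <= T.
Hypothesis gam01 : 0 <= gam <= 1.
Hypothesis p23 : 2 < p < 3.
Hypothesis hpi : forall n, itv_partition 0 T (pi n).
Hypothesis pi_mesh : mesh 0 (pi n) @[n --> \oo] --> 0.
Hypothesis g_cont : {within `[0, T], continuous g}.
Hypothesis g_mono : forall s t, 0 <= s -> s <= t -> t <= T -> g s <= g t.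

(** Landau's relation [f = O(h ^ k)], uniform over all intervals. Its rules of calculation spare the
    bookkeeping of constants. *)
Definition order_ctrl (k : nat) (f : R -> R -> R) : Prop :=
  exists2 C : R, 0 <= C & forall s t, 0 <= s -> s <= t -> t <= T ->
    `|f s t| <= C * h s t ^+ k.

Lemma order_ctrl_ext k f f' :
  (forall s t, 0 <= s -> s <= t -> t <= T -> f s t = f' s t) ->
  order_ctrl k f -> order_ctrl k f'.
Proof.
by move=> E [C C0 H]; exists C => // s t s0 st tT; rewrite -E// H.
Qed.

Lemma order_ctrlD k f f' : order_ctrl k f -> order_ctrl k f' ->
  order_ctrl k (fun s t => f s t + f' s t).
Proof.
move=> [C C0 H] [C' C'0 H']; exists (C + C'); first exact: addr_ge0.
move=> s t s0 st tT; rewrite mulrDl; apply: le_trans (ler_normD _ _) _.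
by apply: lerD; [exact: H|exact: H'].
Qed.

Lemma order_ctrlN k f : order_ctrl k f -> order_ctrl k (fun s t => - f s t).
Proof.
by move=> [C C0 H]; exists C => // s t s0 st tT; rewrite normrN H.
Qed.

Lemma order_ctrlB k f f' : order_ctrl k f -> order_ctrl k f' ->
  order_ctrl k (fun s t => f s t - f' s t).
Proof. by move=> H H'; apply: order_ctrlD => //; exact: order_ctrlN. Qed.

Lemma order_ctrl0 k : order_ctrl k (fun _ _ => 0).
Proof. by exists 0 => // s t *; rewrite normr0 mul0r. Qed.

Lemma order_ctrlM k k' f f' : order_ctrl k f -> order_ctrl k' f' ->
  order_ctrl (k + k') (fun s t => f s t * f' s t).
Proof.
move=> [C C0 H] [C' C'0 H']; exists (C * C'); first exact: mulr_ge0.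
move=> s t s0 st tT; rewrite normrM exprD mulrACA.
by apply: ler_pM => //; [exact: H|exact: H'].
Qed.

Lemma order_ctrl_bounded k u f : (exists B, forall t, 0 <= t -> t <= T -> `|u t| <= B) ->
  order_ctrl k f -> order_ctrl k (fun s t => u s * f s t).
Proof.
move=> [B HB] Hf; apply: (@order_ctrlM 0 k (fun s _ => u s)) => //.
exists B; first by apply: le_trans (HB 0 _ _).
by move=> s t s0 st tT; rewrite expr0 mulr1 HB// (le_trans st).
Qed.

Lemma order_ctrlW k f : order_ctrl k.+1 f -> order_ctrl k f.
Proof.
move=> [C C0 H]; exists (C * h 0 T); first by rewrite mulr_ge0// powR_ge0.
move=> s t s0 st tT; apply: le_trans (H s t s0 st tT) _.
rewrite exprS mulrA ler_wpM2r ?exprn_ge0 ?powR_ge0// ler_wpM2l//.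
exact: (ctrl_root_le p23 g_mono).
Qed.

Lemma order_ctrl_sum k (J : Type) (r : seq J) (f : J -> R -> R -> R) :
  (forall j, order_ctrl k (f j)) ->
  order_ctrl k (fun s t => \sum_(j <- r) f j s t).
Proof.
move=> H; elim: r => [|j r IH].
  by apply: order_ctrl_ext (order_ctrl0 k) => s t *; rewrite big_nil.
apply: order_ctrl_ext (order_ctrlD (H j) IH) => s t *.
by rewrite big_cons.
Qed.

Lemma order_ctrl3_const (f : R -> R) : order_ctrl 3 (fun s t => f t - f s) ->
  forall t, 0 <= t -> t <= T -> f t = f 0.
Proof.
move=> [C C0 H] t t0 tT; apply/eqP; rewrite -subr_eq0 -normr_le0.
apply/ler_addgt0Pr => e e0; rewrite add0r.
apply: (@bisection R (3 / p) (gamma_exp_gt1 p23) T g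
  (fun s t b => `|f t - f s| <= b) C g_cont g_mono) => //.
- move=> s u v b c _ _ _ _; rewrite !ler_norml; lra.
- by move=> s u b c bc /le_trans; apply.
- by move=> s u s0 su uT; rewrite -(ctrl_root_exp p g 3 s0 su uT); exact: H.
Qed.

Lemma order_ctrl1_floor_cvg (u : R -> R) t :
  order_ctrl 1 (fun s t => u t - u s) -> 0 <= t -> t <= T ->
  u (floor_node (pi n) t) @[n --> \oo] --> u t.
Proof.
move=> [C C0 H] t0 tT; apply/cvgrPdist_lt => e e0.
have : C * h (floor_node (pi n) t) t @[n --> \oo] --> C * 0.
  by apply: cvgMr; exact: (h_rest_cvg p23 hpi pi_mesh g_cont g_mono).
rewrite mulr0 => /cvgrPdist_lt /(_ e e0); apply: filterS => n.
rewrite sub0r normrN; apply: le_lt_trans; apply: le_trans (ler_norm _).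
have /andP[f0 _] := floor_node_bound (hpi n) t0.
by have := H _ t f0 (floor_node_le (hpi n) t0) tT; rewrite expr1.
Qed.

Context (mid : pred I) (br : I -> I -> option I).
Context (Y : I -> R -> R) (A : I -> I -> R -> R -> R).
Context (An : nat -> I -> I -> nat -> nat -> R) (K : R).
Hypothesis arp : approx_rough_path mid br Y A An K.

(** Paths controlled by [Y] in Gubinelli's sense, with derivative [V']. *)
Definition controlled (V : R -> R) (V' : I -> R -> R) : Prop :=
  [/\ exists B, forall t, 0 <= t -> t <= T -> `|V t| <= B,
      forall l, exists B, forall t, 0 <= t -> t <= T -> `|V' l t| <= B,
      order_ctrl 1 (fun s t => V t - V s),
      forall l, order_ctrl 1 (fun s t => V' l t - V' l s) &
      order_ctrl 2 (fun s t => V t - V s - \sum_l V' l s * (Y l t - Y l s))].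

Lemma common_bound (J : finType) (P : J -> R -> Prop) :
  (forall j b c, b <= c -> P j b -> P j c) ->
  (forall j, exists b, P j b) -> exists2 b, 0 <= b & forall j, P j b.
Proof.
move=> Pm /choice [b Hb]; exists (\sum_j `|b j|); first exact: sumr_ge0.
move=> j; apply: Pm (Hb j); rewrite (bigD1 j)//=.
apply: le_trans (ler_norm _) _; rewrite lerDl; exact: sumr_ge0.
Qed.

Lemma controlled_cst V V' : controlled V V' ->
  exists2 C, 0 <= C & [/\ forall t, 0 <= t -> t <= T -> `|V t| <= C,
    forall l t, 0 <= t -> t <= T -> `|V' l t| <= C,
    forall l s t, 0 <= s -> s <= t -> t <= T -> `|V' l t - V' l s| <= C * h s t &
    forall s t, 0 <= s -> s <= t -> t <= T ->
     `|V t - V s - \sum_l V' l s * (Y l t - Y l s)| <= C * h s t ^+ 2].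
Proof.
move=> [[B1 H1] H2 _ H4 [B5 B50 H5]].
have [|B2 B20 {}H2] := @common_bound I
    (fun l B => forall t, 0 <= t -> t <= T -> `|V' l t| <= B) _ H2.
  by move=> j b c bc H t t0 tT; apply: le_trans bc; exact: H.
have [||B4 B40 {}H4] := @common_bound I (fun l B => forall s t, 0 <= s -> s <= t -> t <= T ->
     `|V' l t - V' l s| <= B * h s t) _ _.
- move=> j b c bc H s t s0 st tT; apply: le_trans (H s t s0 st tT) _.
  by rewrite ler_wpM2r// powR_ge0.
- move=> l; have [B _ HB] := H4 l; exists B => s t s0 st tT.
  by have := HB s t s0 st tT; rewrite expr1.
have B10 : 0 <= B1 by apply: le_trans (H1 0 _ _).
exists (B1 + B2 + B4 + B5); first by rewrite !addr_ge0.
split.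
- move=> t t0 tT; apply: le_trans (H1 t t0 tT) _; lra.
- move=> l t t0 tT; apply: le_trans (H2 l t t0 tT) _; lra.
- move=> l s t s0 st tT; apply: le_trans (H4 l s t s0 st tT) _.
  by rewrite ler_wpM2r ?powR_ge0//; lra.
- move=> s t s0 st tT; apply: le_trans (H5 s t s0 st tT) _.
  by rewrite ler_wpM2r ?exprn_ge0 ?powR_ge0//; lra.
Qed.

Definition gamma_integral (V : R -> R) (i : I) (t : R) : R :=
  limn (fun n => scalar_gamma_sum (pi n) gam V (Y i) t).

Lemma sum_bound (F : I -> R) b : (forall l, `|F l| <= b) ->
  `|\sum_l F l| <= m%:R * b.
Proof.
move=> H; apply: le_trans (ler_norm_sum _ _ _) _.
apply: le_trans (ler_sum _ (fun l _ => H l)) _.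
by rewrite sumr_const card_ord mulr_natl.
Qed.

(** The germ at partition points uses the discrete area [An]. Over one interval the summand exceeds
    the left-point term by [gam * (V t - V s) * (Y i t - Y i s)], and the one-step value of [An]
    matches exactly this up to order 3. The limit of [An] turns the germ into the one with [A]. *)
Lemma gamma_integral_controlled V V' i : controlled V V' ->
  (forall t, 0 <= t -> t <= T ->
    cvgn (fun n => scalar_gamma_sum (pi n) gam V (Y i) t)) /\
  order_ctrl 3 (fun s t => gamma_integral V i t - gamma_integral V i s -
     (V s * (Y i t - Y i s) + \sum_l V' l s * A l i s t)).
Proof.
move=> cV; have [C C0 [HV HV' dV' RV]] := controlled_cst cV.
have K0 := arp_K0 arp.
pose Xi n a b := V (node (pi n) a) * (Y i (node (pi n) b) - Y i (node (pi n) a)) +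
  \sum_l V' l (node (pi n) a) * An n l i a b.
(* [K] bounds the increments of [Y]. The other summand collects the defect: one [C * K] from the
   remainder of [V], and [m] of them from each of the two sums over letters. *)
pose K' := K + (1 + 2 * m%:R) * (C * K).
have CK0 : 0 <= C * K by exact: mulr_ge0.
have m0 : 0 <= m%:R :> R by [].
have mCK0 : 0 <= m%:R * (C * K) by exact: mulr_ge0.
have K'0 : 0 <= K' by rewrite /K'; nra.
have nodeP n a b : (a <= b)%N -> (b <= size (pi n))%N ->
    [/\ 0 <= node (pi n) a, node (pi n) a <= node (pi n) b & node (pi n) b <= T].
  move=> ab bn; split; first exact: (node_ge0 (hpi n) (leq_trans ab bn)).
    exact: (node_le (hpi n)).
  exact: (node_leT (hpi n)).
have HY s t : 0 <= s -> s <= t -> t <= T -> `|Y i t - Y i s| <= K' * h s t.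
  move=> s0 st tT; apply: le_trans (arp_path arp i s0 st tT) _.
  by rewrite ler_wpM2r ?powR_ge0// /K'; nra.
have defect n a b c : (a <= b)%N -> (b <= c)%N -> (c <= size (pi n))%N ->
   `|Xi n a c - Xi n a b - Xi n b c| <= K' * h (node (pi n) a) (node (pi n) c) ^+ 3.
  move=> ab bc cn; have ac := leq_trans ab bc; have bn := leq_trans bc cn.
  have [s0 su uT] := nodeP n a b ab bn; have [u0 ut tT] := nodeP n b c bc cn.
  have [_ st _] := nodeP n a c ac cn.
  move: s0 su uT u0 ut tT st; rewrite /Xi.
  set s := node (pi n) a; set u := node (pi n) b; set t := node (pi n) c.
  move=> s0 su uT u0 ut tT st.
  have hsu : h s u <= h s t by exact: (ctrl_root_le p23 g_mono).
  have hut : h u t <= h s t by exact: (ctrl_root_le p23 g_mono).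
  have h0 : 0 <= h s t by exact: powR_ge0.
  (* The defect splits into the remainder of [V] times an increment, the error in Chen's relation
     weighted by [V'], and increments of [V'] against the area; each is of order 3. *)
  rewrite (_ : _ - _ - _ = - ((V u - V s - \sum_l V' l s * (Y l u - Y l s)) * (Y i t - Y i u)) +
     \sum_l V' l s * (An n l i a c - An n l i a b - An n l i b c -
        (Y l u - Y l s) * (Y i t - Y i u)) -
     \sum_l (V' l u - V' l s) * An n l i b c); last first.
    rewrite (_ : \sum_l V' l s * (An n l i a c - An n l i a b - An n l i b c -
        (Y l u - Y l s) * (Y i t - Y i u)) = \sum_l V' l s * An n l i a c -
      \sum_l V' l s * An n l i a b - \sum_l V' l s * An n l i b c -
      (\sum_l V' l s * (Y l u - Y l s)) * (Y i t - Y i u)); last first.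
      by rewrite mulr_suml -!sumrB; apply: eq_bigr => l _; ring.
    rewrite (_ : \sum_l (V' l u - V' l s) * An n l i b c = \sum_l V' l u * An n l i b c -
       \sum_l V' l s * An n l i b c); last first.
      by rewrite -sumrB; apply: eq_bigr => l _; ring.
    by ring.
  have b1 : `|(V u - V s - \sum_l V' l s * (Y l u - Y l s)) * (Y i t - Y i u)| <=
      C * K * h s t ^+ 3.
    rewrite normrM (_ : C * K * h s t ^+ 3 = (C * h s t ^+ 2) * (K * h s t)); last by ring.
    apply: ler_pM => //.
      apply: le_trans (RV s u s0 su uT) _; apply: ler_wpM2l => //.
      by rewrite ler_pXn2r// nnegrE powR_ge0.
    apply: le_trans (arp_path arp i u0 ut tT) _; exact: ler_wpM2l.
  have b2 : `|\sum_l V' l s * (An n l i a c - An n l i a b - An n l i b c -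
        (Y l u - Y l s) * (Y i t - Y i u))| <= m%:R * (C * K * h s t ^+ 3).
    apply: sum_bound => l; rewrite normrM -mulrA; apply: ler_pM => //.
      by apply: HV' => //; exact: le_trans uT.
    exact: (arp_dchen arp).
  have b3 : `|\sum_l (V' l u - V' l s) * An n l i b c| <= m%:R * (C * K * h s t ^+ 3).
    apply: sum_bound => l; rewrite normrM.
    rewrite (_ : C * K * h s t ^+ 3 = (C * h s t) * (K * h s t ^+ 2)); last by ring.
    apply: ler_pM => //.
      by apply: le_trans (dV' l s u s0 su uT) _; exact: ler_wpM2l.
    apply: le_trans (arp_darea arp l i bc cn) _; apply: ler_wpM2l => //.
    by rewrite ler_pXn2r// nnegrE powR_ge0.
  apply: le_trans (ler_normB _ _) _.
  apply: (@le_trans _ _ ((C * K * h s t ^+ 3 + m%:R * (C * K * h s t ^+ 3)) +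
     m%:R * (C * K * h s t ^+ 3))).
    apply: lerD => //; apply: le_trans (ler_normD _ _) _.
    by apply: lerD => //; rewrite normrN.
  have : 0 <= K * h s t ^+ 3 by rewrite mulr_ge0// exprn_ge0.
  rewrite /K'; lra.
have step n k : (k < size (pi n))%N ->
  `|gamma_coeff (pi n) gam V k * (Y i (node (pi n) k.+1) - Y i (node (pi n) k))
    - Xi n k k.+1| <= K' * h (node (pi n) k) (node (pi n) k.+1) ^+ 3.
  move=> kn; have [s0 st tT] := nodeP n k k.+1 (leqnSn k) kn.
  rewrite /Xi /gamma_coeff; move: s0 st tT.
  set s := node (pi n) k; set t := node (pi n) k.+1 => s0 st tT.
  have h0 : 0 <= h s t by exact: powR_ge0.
  rewrite (_ : _ - _ = gam * (V t - V s - \sum_l V' l s * (Y l t - Y l s)) * (Y i t - Y i s) -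
    \sum_l V' l s * (An n l i k k.+1 - gam * (Y l t - Y l s) * (Y i t - Y i s))); last first.
    rewrite (_ : \sum_l V' l s * (An n l i k k.+1 - gam * (Y l t - Y l s) * (Y i t - Y i s)) =
       \sum_l V' l s * An n l i k k.+1 -
       gam * (\sum_l V' l s * (Y l t - Y l s)) * (Y i t - Y i s)); last first.
      by rewrite mulr_sumr mulr_suml -sumrB; apply: eq_bigr => l _; ring.
    by ring.
  have b1 : `|gam * (V t - V s - \sum_l V' l s * (Y l t - Y l s)) * (Y i t - Y i s)| <=
      C * K * h s t ^+ 3.
    rewrite !normrM (_ : C * K * h s t ^+ 3 = (1 * (C * h s t ^+ 2)) * (K * h s t)); last by ring.
    have [gam0 gam1] := andP gam01.
    apply: ler_pM; rewrite ?mulr_ge0//.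
      by apply: ler_pM => //; [rewrite ger0_norm|exact: RV].
    exact: (arp_path arp).
  have b2 : `|\sum_l V' l s * (An n l i k k.+1 - gam * (Y l t - Y l s) * (Y i t - Y i s))|
      <= m%:R * (C * K * h s t ^+ 3).
    apply: sum_bound => l; rewrite normrM -[leRHS]mulrA; apply: ler_pM => //.
      by apply: HV' => //; exact: le_trans tT.
    exact: (arp_dstep arp).
  apply: le_trans (ler_normB _ _) _.
  apply: le_trans (lerD b1 b2) _.
  have : 0 <= K * h s t ^+ 3 by rewrite mulr_ge0// exprn_ge0.
  have : 0 <= m%:R * (C * K * h s t ^+ 3) by rewrite !mulr_ge0// exprn_ge0.
  rewrite /K'; lra.
have Xicvg s t : 0 <= s -> s <= t -> t <= T ->
  Xi n (floor_idx (pi n) s) (floor_idx (pi n) t) @[n --> \oo] -->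
  (V s * (Y i t - Y i s) + \sum_l V' l s * A l i s t).
  move=> s0 st tT; have [_ _ V1 V'1 _] := cV.
  have Y1 l : order_ctrl 1 (fun s t => Y l t - Y l s).
    by exists K => // *; rewrite expr1; exact: (arp_path arp).
  have sT := le_trans st tT; have t0 := le_trans s0 st.
  apply: cvgD; first apply: cvgM.
  - exact: (order_ctrl1_floor_cvg V1).
  - by apply: cvgB; exact: (order_ctrl1_floor_cvg (Y1 i)).
  apply: cvg_big; first exact: add_continuous.
  move=> l _; apply: cvgM; last exact: (arp_dcvg arp).
  exact: (order_ctrl1_floor_cvg (V'1 l)).
split.
  move=> t t0 tT.
  exact: (@gamma_sum_cauchy R T gam p pi g gam01 p23 hpi pi_mesh g_cont g_mono V (Y i) Xi
    _ K' C K'0 HV HY defect step Xicvg t t0 tT).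
exists (gamma_cst p * K').
  apply: mulr_ge0 => //; apply: sewing_cst_ge0; exact: (gamma_exp_gt1 p23).
move=> s t s0 st tT.
exact: (@gamma_integral_estimate R T gam p pi g gam01 p23 hpi pi_mesh g_cont g_mono V (Y i) Xi
    _ K' C K'0 HV HY defect step Xicvg s t s0 st tT).
Qed.

(** The signature coordinates by one recursion for all lengths, without the special cases of lengths
    1 and 2; this suits inductions on words. *)
Fixpoint word_sig (w : seq I) : R -> R :=
  if w is i :: w' then gamma_integral (word_sig w') i else fun=> 1.

(** Integrating against the last letter gives the preceding coordinate as derivative. A letter
    outside [mid] has increments of order 2, which go into the remainder. *)
Definition word_der (w : seq I) (l : I) (t : R) : R :=
  if w is i :: w' then if (i == l) && mid l then word_sig w' t else 0 else 0.

Lemma word_sig0 i w : word_sig (i :: w) 0 = 0.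
Proof.
rewrite /= /gamma_integral (_ : (fun n => _) = fun=> 0) ?lim_cst//.
by apply/funext => n; exact: (scalar_gamma_sum0 (hpi n)).
Qed.

Lemma controlled_bounded V V' : controlled V V' ->
  exists B, forall t, 0 <= t -> t <= T -> `|V t| <= B.
Proof. by case. Qed.

Lemma sum_delta i (F G : I -> R) :
  \sum_l (if (i == l) && mid l then F l else 0) * G l =
  if mid i then F i * G i else 0.
Proof.
rewrite (bigD1 i)//= eqxx big1 ?addr0; last first.
  by move=> l; rewrite eq_sym => /negPf ->; rewrite mul0r.
by case: (mid i); rewrite /= ?mul0r.
Qed.

Lemma order_ctrl_path i : order_ctrl 1 (fun s t => Y i t - Y i s).
Proof.
exists K; first exact: (arp_K0 arp).
by move=> *; rewrite expr1; exact: (arp_path arp).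
Qed.

Lemma order_ctrl_path2 i : ~~ mid i -> order_ctrl 2 (fun s t => Y i t - Y i s).
Proof.
by move=> ni; exists K; [exact: (arp_K0 arp)|move=> *; exact: (arp_path2 arp)].
Qed.

Lemma order_ctrl_area i j : order_ctrl 2 (A i j).
Proof. by exists K; [exact: (arp_K0 arp)|move=> *; exact: (arp_area arp)]. Qed.

Lemma word_sig_controlled w : controlled (word_sig w) (word_der w).
Proof.
elim: w => [|i w IH].
  split.
  - by exists 1 => t _ _ /=; rewrite normr1.
  - by move=> l; exists 0 => t _ _ /=; rewrite normr0.
  - by apply: order_ctrl_ext (order_ctrl0 1) => s t *; rewrite subrr.
  - by move=> l; apply: order_ctrl_ext (order_ctrl0 1) => s t *; rewrite /= subrr.
  - apply: order_ctrl_ext (order_ctrl0 2) => s t *.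
    by rewrite big1 ?subrr ?subr0// => l _; rewrite mul0r.
have [_ E3] := gamma_integral_controlled i IH.
have [wb wdb w1 wd1 w2] := IH.
have wA : order_ctrl 2 (fun s t => \sum_l word_der w l s * A l i s t).
  by apply: order_ctrl_sum => l; apply: order_ctrl_bounded; [exact: wdb|exact: order_ctrl_area].
have E2 : order_ctrl 2 (fun s t => word_sig (i :: w) t - word_sig (i :: w) s -
    word_sig w s * (Y i t - Y i s)).
  apply: order_ctrl_ext (order_ctrlD (order_ctrlW E3) wA) => s t *.
  by rewrite /=; ring.
have wY k : order_ctrl k (fun s t => Y i t - Y i s) ->
    order_ctrl k (fun s t => word_sig w s * (Y i t - Y i s)).
  by move=> H; exact: order_ctrl_bounded.
have E1 : order_ctrl 1 (fun s t => word_sig (i :: w) t - word_sig (i :: w) s).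
  apply: order_ctrl_ext (order_ctrlD (order_ctrlW E2) (wY 1 (order_ctrl_path i))) => s t *.
  by ring.
split=> //.
- have [C C0 H] := E1; exists (C * h 0 T) => t t0 tT.
  have := H 0 t (lexx _) t0 tT; rewrite word_sig0 subr0 expr1 => /le_trans; apply.
  by rewrite ler_wpM2l//; exact: (ctrl_root_le p23 g_mono).
- move=> l /=; case: ((i == l) && mid l); first exact: wb.
  by exists 0 => t _ _; rewrite normr0.
- move=> l /=; case: ((i == l) && mid l); first exact: w1.
  by apply: order_ctrl_ext (order_ctrl0 1) => s t *; rewrite subrr.
- case: (boolP (mid i)) => [mi|ni].
    apply: order_ctrl_ext E2 => s t *.
    by rewrite /= (sum_delta i (fun=> word_sig w s) (fun l => Y l t - Y l s)) mi.
  apply: order_ctrl_ext (order_ctrlD E2 (wY 2 (order_ctrl_path2 ni))) => s t *.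
  by rewrite /= (sum_delta i (fun=> word_sig w s) (fun l => Y l t - Y l s)) (negPf ni) subr0 subrK.
Qed.

Lemma word_sig_expansion i w : order_ctrl 3 (fun s t =>
  word_sig (i :: w) t - word_sig (i :: w) s -
  (word_sig w s * (Y i t - Y i s) + \sum_l word_der w l s * A l i s t)).
Proof. by case: (gamma_integral_controlled i (word_sig_controlled w)). Qed.

Lemma word_sig_cvg i w t : 0 <= t -> t <= T ->
  scalar_gamma_sum (pi n) gam (word_sig w) (Y i) t @[n --> \oo] -->
  word_sig (i :: w) t.
Proof.
have [H _] := gamma_integral_controlled i (word_sig_controlled w).
exact: H.
Qed.

Definition words_sum (L : seq (seq I)) (t : R) : R := \sum_(w <- L) word_sig w t.

Definition words_der (L : seq (seq I)) (l : I) (t : R) : R :=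
  \sum_(w <- L) word_der w l t.

Lemma words_sum_consE w L t : words_sum (w :: L) t = word_sig w t + words_sum L t.
Proof. by rewrite /words_sum big_cons. Qed.

Lemma words_der_cons i L l t :
  words_der (map (cons i) L) l t =
  if (i == l) && mid l then words_sum L t else 0.
Proof.
rewrite /words_der big_map /words_sum /=; case: ifP => // _.
by rewrite big1.
Qed.

Lemma words_sum_cons0 i L : words_sum (map (cons i) L) 0 = 0.
Proof. by rewrite /words_sum big_map big1// => w _; exact: word_sig0. Qed.

Lemma words_sum_expansion i L : order_ctrl 3 (fun s t =>
  words_sum (map (cons i) L) t - words_sum (map (cons i) L) s -
  (words_sum L s * (Y i t - Y i s) + \sum_l words_der L l s * A l i s t)).
Proof.
elim: L => [|w L IH].
  apply: order_ctrl_ext (order_ctrl0 3) => s t *.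
  rewrite /words_sum !big_nil big1; first by ring.
  by move=> l _; rewrite /words_der big_nil mul0r.
apply: order_ctrl_ext (order_ctrlD (word_sig_expansion i w) IH) => s t *.
have -> : \sum_l words_der (w :: L) l s * A l i s t =
    \sum_l word_der w l s * A l i s t + \sum_l words_der L l s * A l i s t.
  by rewrite -big_split; apply: eq_bigr => l _; rewrite /words_der big_cons mulrDl.
rewrite map_cons !words_sum_consE; ring.
Qed.

Lemma words_sum_cat L L' t : words_sum (L ++ L') t = words_sum L t + words_sum L' t.
Proof. by rewrite /words_sum big_cat. Qed.

Lemma words_der_cat L L' l t :
  words_der (L ++ L') l t = words_der L l t + words_der L' l t.
Proof. by rewrite /words_der big_cat. Qed.

Lemma words_sum1 w t : words_sum [:: w] t = word_sig w t.
Proof. by rewrite /words_sum big_seq1. Qed.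

Lemma words_der1 w l t : words_der [:: w] l t = word_der w l t.
Proof. by rewrite /words_der big_seq1. Qed.

(** The Leibniz rule for derivatives is proved along with the product rule, because derivatives of
    shorter products enter the area terms in the expansion of longer ones. *)
Let shuffle_spec (w v : seq I) : Prop :=
  forall t, 0 <= t -> t <= T ->
    words_sum (quasi_shuffle br w v) t = word_sig w t * word_sig v t /\
    forall l, words_der (quasi_shuffle br w v) l t =
      word_der w l t * word_sig v t + word_sig w t * word_der v l t.

(* Both sides of the product rule have the same expansion up to order 3, and
   a path whose increments are of order 3 is constant since 3 / p > 1. *)
Lemma quasi_shuffle_step i w j v :
  shuffle_spec w (j :: v) -> shuffle_spec (i :: w) v -> shuffle_spec w v ->
  shuffle_spec (i :: w) (j :: v).
Proof.
move=> S1 S2 S3.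
pose L3 := if br i j is Some k then map (cons k) (quasi_shuffle br w v) else [::].
pose F := word_sig (i :: w); pose G := word_sig (j :: v).
pose P := word_sig w; pose Q := word_sig v.
have E : quasi_shuffle br (i :: w) (j :: v) =
  map (cons i) (quasi_shuffle br w (j :: v)) ++
  map (cons j) (quasi_shuffle br (i :: w) v) ++ L3 by [].
have cF := word_sig_controlled (i :: w); have cG := word_sig_controlled (j :: v).
have cP := word_sig_controlled w; have cQ := word_sig_controlled v.
have bF := controlled_bounded cF; have bG := controlled_bounded cG.
have bP := controlled_bounded cP; have bQ := controlled_bounded cQ.
have [_ bP' _ _ _] := cP; have [_ bQ' _ _ _] := cQ.
have [_ _ F1 _ _] := cF; have [_ _ G1 _ _] := cG.
have PA : order_ctrl 2 (fun s t => \sum_l word_der w l s * A l i s t).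
  by apply: order_ctrl_sum => l; apply: order_ctrl_bounded; [exact: bP'|exact: order_ctrl_area].
have QA : order_ctrl 2 (fun s t => \sum_l word_der v l s * A l j s t).
  by apply: order_ctrl_sum => l; apply: order_ctrl_bounded; [exact: bQ'|exact: order_ctrl_area].
have F3 := word_sig_expansion i w; have G3 := word_sig_expansion j v.
have FY : order_ctrl 2 (fun s t => F t - F s - P s * (Y i t - Y i s)).
  by apply: order_ctrl_ext (order_ctrlD (order_ctrlW F3) PA) => s t *; rewrite /F /P /=; ring.
have GY : order_ctrl 2 (fun s t => G t - G s - Q s * (Y j t - Y j s)).
  by apply: order_ctrl_ext (order_ctrlD (order_ctrlW G3) QA) => s t *; rewrite /G /Q /=; ring.
(* Both coordinates increase to first order like their last letters, so the product of their
   increments is that of the letters up to order 3. *)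
have FG : order_ctrl 3 (fun s t => (F t - F s) * (G t - G s) -
    P s * Q s * ((Y i t - Y i s) * (Y j t - Y j s))).
  have a1 := order_ctrlM FY G1.
  have a2 : order_ctrl 3 (fun s t => P s * ((Y i t - Y i s) *
      (G t - G s - Q s * (Y j t - Y j s)))).
    by apply: order_ctrl_bounded => //; exact: (order_ctrlM (order_ctrl_path i) GY).
  by apply: order_ctrl_ext (order_ctrlD a1 a2) => s t *; rewrite /F /G /P /Q; ring.
have bPQ : exists B, forall t, 0 <= t -> t <= T -> `|P t * Q t| <= B.
  have [BP HP] := bP; have [BQ HQ] := bQ; exists (BP * BQ) => t t0 tT.
  by rewrite normrM; apply: ler_pM => //; [exact: HP|exact: HQ].
pose Yk s t := if br i j is Some k then Y k t - Y k s else 0.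
have br3 : order_ctrl 3 (fun s t => P s * Q s * ((Y i t - Y i s) * (Y j t - Y j s)
     - A i j s t - A j i s t - Yk s t)).
  apply: order_ctrl_bounded => //; exists K; first exact: (arp_K0 arp).
  by move=> s t *; exact: (arp_bracket arp).
have H1 := words_sum_expansion i (quasi_shuffle br w (j :: v)).
have H2 := words_sum_expansion j (quasi_shuffle br (i :: w) v).
have H3 : order_ctrl 3 (fun s t => words_sum L3 t - words_sum L3 s - P s * Q s * Yk s t).
  rewrite /L3 /Yk; case brij : (br i j) => [k|]; last first.
    by apply: order_ctrl_ext (order_ctrl0 3) => s t *; rewrite /words_sum !big_nil; ring.
  apply: order_ctrl_ext (words_sum_expansion k (quasi_shuffle br w v)) => s t s0 st tT.
  have sT := le_trans st tT.
  rewrite (S3 s s0 sT).1 big1 ?addr0// => l _.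
  by rewrite (arp_area0 arp) ?mulr0// (negPf (arp_br arp brij)) andbF.
(* The increment of [F * G] is [F] times that of [G], plus [G] times that of [F], plus the product
   of both. The last part is expressed by areas and the bracket letter through [br3]. *)
have main : order_ctrl 3 (fun s t =>
    (words_sum (quasi_shuffle br (i :: w) (j :: v)) t - F t * G t) -
    (words_sum (quasi_shuffle br (i :: w) (j :: v)) s - F s * G s)).
  rewrite E.
  have z1 := order_ctrl_bounded bF G3; have z2 := order_ctrl_bounded bG F3.
  have := order_ctrlB (order_ctrlB (order_ctrlB (order_ctrlD (order_ctrlD H1 H2) H3)
    z1) z2) (order_ctrlD FG br3).
  apply: order_ctrl_ext => s t s0 st tT; have sT := le_trans st tT.
  rewrite !words_sum_cat (S1 s s0 sT).1 (S2 s s0 sT).1.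
  under eq_bigr do rewrite (S1 s s0 sT).2 mulrDl.
  under [X in _ + (_ - (_ + X))]eq_bigr do rewrite (S2 s s0 sT).2 mulrDl.
  rewrite !big_split/=.
  (* Where the derivative falls on the last letter of the other factor, it leaves [P * Q] times an
     area. These two areas are the ones in the bracket relation and cancel against it. *)
  have e1 : \sum_l word_sig w s * (if (j == l) && mid l then word_sig v s else 0) * A l i s t =
      P s * Q s * A j i s t.
    under eq_bigr do rewrite -mulrA.
    rewrite -mulr_sumr (sum_delta j (fun=> word_sig v s) (fun l => A l i s t)) /P /Q.
    case: ifP => mj; first by rewrite mulrA.
    by rewrite (arp_area0 arp) ?mulr0// mj.
  have e2 : \sum_l (if (i == l) && mid l then word_sig w s else 0) * word_sig v s * A l j s t =
      P s * Q s * A i j s t.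
    under eq_bigr do rewrite -mulrA.
    rewrite (sum_delta i (fun=> word_sig w s) (fun l => word_sig v s * A l j s t)) /P /Q.
    case: ifP => mi; first by rewrite mulrA.
    by rewrite (arp_area0 arp) ?mulr0// mi.
  rewrite e1 e2.
  under eq_bigr do rewrite mulrAC.
  rewrite -mulr_suml.
  under [X in _ + (_ - (_ + (_ + X)))]eq_bigr do rewrite -mulrA.
  rewrite -mulr_sumr.
  rewrite /F /G /P /Q /=; ring.
move=> t t0 tT; split.
  have := order_ctrl3_const main t0 tT.
  rewrite E !words_sum_cat !words_sum_cons0 /F !word_sig0 mul0r.
  have -> : words_sum L3 0 = 0.
    rewrite /L3; case: (br i j) => [k|]; last by rewrite /words_sum big_nil.
    exact: words_sum_cons0.
  by move/eqP; rewrite !addr0 subrr subr_eq0 => /eqP.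
move=> l; rewrite E !words_der_cat !words_der_cons (S1 t t0 tT).1 (S2 t t0 tT).1.
have -> : words_der L3 l t = 0.
  rewrite /L3; case brij : (br i j) => [k|]; last by rewrite /words_der big_nil.
  rewrite words_der_cons; case: eqVneq => //= <-.
  by rewrite (negPf (arp_br arp brij)).
rewrite addr0 [in RHS]/word_der; congr (_ + _).
  by case: ifP; rewrite ?mul0r.
by case: ifP; rewrite ?mulr0.
Qed.

Lemma quasi_shuffle_product w v t : 0 <= t -> t <= T ->
  words_sum (quasi_shuffle br w v) t = word_sig w t * word_sig v t.
Proof.
suff : shuffle_spec w v by move=> H t0 tT; exact: (H t t0 tT).1.
elim: w v => [v u u0 uT|i w IHw].
  split=> [|l] /=; first by rewrite words_sum1 mul1r.
  by rewrite words_der1 mul0r add0r mul1r.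
elim=> [u u0 uT|j v IHv].
  split=> [|l]; first exact: etrans (words_sum1 _ _) (esym (mulr1 _)).
  apply: etrans (words_der1 _ _ _) _.
  by rewrite [word_sig [::] _]/= mulr1 [word_der [::] _ _]/= mulr0 addr0.
by apply: quasi_shuffle_step.
Qed.

Lemma order_ctrl1_continuous (u : R -> R) :
  order_ctrl 1 (fun s t => u t - u s) -> {within `[0, T], continuous u}.
Proof.
move=> [C C0 H]; apply/within_cvgP => t; rewrite /= in_itv/= => /andP[t0 tT] e e0.
have C1 : 0 < C + 1 by rewrite ltr_wpDl.
have d0 : 0 < (e / (C + 1)) `^ p by rewrite powR_gt0// divr_gt0.
have tin : `[0, T]%classic t by rewrite /= in_itv/= t0.
have := (within_cvgP _ _).1 g_cont t tin _ d0.
apply: filterS => s /[swap] sin /(_ sin); move: sin.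
rewrite /= in_itv/= => /andP[s0 sT] gs.
have p0 := p_gt0 p23.
have key x y : 0 <= x -> x <= y -> y <= T -> `|g t - g s| = g y - g x ->
    `|u y - u x| < e.
  move=> x0 xy yT E; have := H x y x0 xy yT; rewrite expr1 => /le_lt_trans; apply.
  have : h x y < e / (C + 1).
    have -> : e / (C + 1) = ((e / (C + 1)) `^ p) `^ p^-1.
      by rewrite -powRrM mulfV ?gt_eqF// powRr1// ltW// divr_gt0.
    apply: gt0_ltr_powR.
    - by rewrite invr_gt0.
    - by rewrite nnegrE subr_ge0 g_mono.
    - by rewrite nnegrE powR_ge0.
    - by move: gs; rewrite E.
  have := ctrl_root_ge0 p g x y; rewrite ltr_pdivlMr//; nra.
have [st|/ltW ts] := lerP s t.
  by apply: key => //; rewrite ger0_norm// subr_ge0 g_mono.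
by rewrite distrC; apply: key => //; rewrite distrC ger0_norm// subr_ge0 g_mono.
Qed.

Lemma word_sig_continuous w : {within `[0, T], continuous (word_sig w)}.
Proof.
by have [_ _ H _ _] := word_sig_controlled w; exact: order_ctrl1_continuous.
Qed.

Lemma words_sum_continuous L : {within `[0, T], continuous (words_sum L)}.
Proof.
elim: L => [|w L IH].
  rewrite (_ : words_sum [::] = fun=> 0); last first.
    by apply/funext => t; rewrite /words_sum big_nil.
  by apply: continuous_subspaceT => x; exact: cvg_cst.
rewrite (_ : words_sum (w :: L) = fun t => word_sig w t + words_sum L t); last first.
  by apply/funext => t; exact: words_sum_consE.
by move=> x; apply: cvgD; [exact: word_sig_continuous|exact: IH].
Qed.

Section TimeLetter.
Context (i0 : I).
Hypothesis Y_time : forall t, 0 <= t -> t <= T -> Y i0 t = t.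
Hypothesis time_nmid : ~~ mid i0.

(** Over an interval the integral is the left value times the length, with an error of order 1
    (variation of the integrand) times order 2 (length). The coordinate has the same expansion up to
    order 3. *)
Lemma word_sig_time w t : 0 <= t -> t <= T ->
  word_sig (i0 :: w) t = seg_integral (word_sig w) 0 t.
Proof.
move=> t0 tT; apply/eqP; rewrite -subr_eq0; apply/eqP.
pose f t := word_sig (i0 :: w) t - seg_integral (word_sig w) 0 t.
have f0 : f 0 = 0 by rewrite /f word_sig0 seg_integral_same subrr.
rewrite -/(f t) -f0; apply: order_ctrl3_const => //.
have E : order_ctrl 3 (fun s t => seg_integral (word_sig w) 0 t -
    seg_integral (word_sig w) 0 s - word_sig w s * (t - s)).
  have [_ _ [C C0 H] _ _] := word_sig_controlled w.
  exists (C * K); first by rewrite mulr_ge0// (arp_K0 arp).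
  move=> s u s0 su uT; have sT := le_trans su uT.
  have Hr r : s <= r -> r <= u ->
      word_sig w s - C * h s u <= word_sig w r <= word_sig w s + C * h s u.
    move=> sr ru; have := H s r s0 sr (le_trans ru uT); rewrite expr1.
    have : h s r <= h s u by exact: (ctrl_root_le p23 g_mono).
    move=> /(ler_wpM2l C0) a b; have {a b} := le_trans b a.
    rewrite ler_norml => /andP[a b]; apply/andP; split; lra.
  have := seg_integral_bounds (@word_sig_continuous w) s0 su uT Hr.
  have := arp_path2 arp time_nmid s0 su uT.
  rewrite !Y_time ?(le_trans s0 su)// ger0_norm ?subr_ge0// => us.
  have : C * h s u * (u - s) <= C * K * h s u ^+ 3.
    rewrite (_ : C * K * _ = (C * h s u) * (K * h s u ^+ 2)); last by ring.
    by apply: ler_wpM2l us; rewrite mulr_ge0// powR_ge0.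
  move=> a /andP[b c]; rewrite ler_norml; apply/andP; split; lra.
apply: order_ctrl_ext (order_ctrlB (word_sig_expansion i0 w) E) => s u s0 su uT.
rewrite big1; last by move=> l _; rewrite (arp_area0 arp) ?mulr0// (negPf time_nmid) andbF.
rewrite /f !Y_time ?(le_trans s0 su) ?(le_trans su uT)//; ring.
Qed.

Lemma words_sum_time L t : 0 <= t -> t <= T ->
  words_sum (map (cons i0) L) t = seg_integral (words_sum L) 0 t.
Proof.
move=> t0 tT.
have sub (f : R -> R) : {within `[0, T], continuous f} -> {within `[0, t], continuous f}.
  move=> cf; apply: continuous_subspaceW cf => x /=; rewrite !in_itv/=.
  by move=> /andP[-> /le_trans]; apply.
elim: L => [|w L IH].
  rewrite {1}/words_sum big_nil (_ : words_sum [::] = fun=> 0).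
    by rewrite seg_integral_cst// mul0r.
  by apply/funext => u; rewrite /words_sum big_nil.
rewrite map_cons words_sum_consE word_sig_time// IH -seg_integralD.
- by apply: eq_seg_integral => x _ _; rewrite words_sum_consE.
- exact/sub/word_sig_continuous.
- exact/sub/words_sum_continuous.
Qed.

Lemma words_sum_time_words k w t : 0 <= t -> t <= T ->
  words_sum (time_words br i0 k w) t = t ^+ k * word_sig w t.
Proof.
move=> t0 tT; elim: k => [|k IH] /=; first by rewrite words_sum1 mul1r.
have S1 : word_sig [:: i0] t = t.
  by rewrite word_sig_time// seg_integral_cst// subr0 mul1r.
rewrite exprS -mulrA -IH; elim: time_words => [|u L IHL] /=.
  by rewrite /words_sum big_nil mulr0.
rewrite words_sum_cat IHL words_sum_consE mulrDr.
by rewrite (quasi_shuffle_product [:: i0] u t0 tT) S1.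
Qed.

Lemma moment_words k w :
  words_sum (map (cons i0) (time_words br i0 k w)) T =
  seg_integral (fun t => t ^+ k * word_sig w t) 0 T.
Proof.
rewrite words_sum_time//; apply: eq_seg_integral => t t0 tT.
exact: words_sum_time_words.
Qed.

End TimeLetter.

End Words.

(** * Entrywise limits of matrices *)

Section MatrixLimits.
Context {R : realType} (m n : nat).

Lemma cvg_mx_entry {I : Type} {F : set_system I} {FF : Filter F}
    (u : I -> 'M[R]_(m, n)) (M : 'M[R]_(m, n)) i j :
  u @ F --> M -> u x i j @[x --> F] --> M i j.
Proof.
move=> uM; apply: (@cvg_comp _ _ _ u (fun A : 'M[R]_(m, n) => A i j)); first exact: uM.
exact: coord_continuous.
Qed.

Lemma mx_cvg {I : Type} {F : set_system I} {FF : Filter F}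
    (u : I -> 'M[R]_(m, n)) (M : 'M[R]_(m, n)) :
  (forall i j, u x i j @[x --> F] --> M i j) -> u @ F --> M.
Proof.
move=> H; apply/cvg_mx_entourageP => A entA.
have : \forall x \near F, forall ij : 'I_m * 'I_n, A (M ij.1 ij.2, u x ij.1 ij.2).
  apply: filter_forall => -[i j].
  by have /cvg_entourageP := H i j; exact.
by apply: filterS => x Hx i j; rewrite inE; exact: (Hx (i, j)).
Qed.

Lemma enorm_entry (A : 'M[R]_(m, n)) i j : `|A i j| <= enorm A.
Proof.
rewrite /enorm -sqrtr_sqr; apply: ler_wsqrtr.
rewrite (bigD1 i)//= (bigD1 j)//= -addrA lerDl addr_ge0//.
  by apply: sumr_ge0 => k _; exact: sqr_ge0.
by apply: sumr_ge0 => k _; apply: sumr_ge0 => l _; exact: sqr_ge0.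
Qed.

Lemma incr_entry (Z : R -> 'M[R]_(m, n)) s t i j :
  incr Z s t i j = Z t i j - Z s i j.
Proof. by rewrite /incr !mxE. Qed.

End MatrixLimits.

(** * Estimates and limits contained in Property gamma-(RIE) *)

Section RIEConsequences.
Context {R : realType}.

(** For [y = 0] a finite bound forces [x = 0], since a positive number over 0 is infinite. *)
Lemma ediv_le (x y C : R) : 0 <= x -> 0 <= y ->
  (x%:E / y%:E <= C%:E)%E -> x <= C * y.
Proof.
move=> x0; rewrite le_eqVlt => /predU1P[<-|y0].
  rewrite inver eqxx; move: x0; rewrite le_eqVlt => /predU1P[<-|x0].
    by rewrite mulr0.
  by rewrite gt0_muley ?lte_fin.
by rewrite inver gt_eqF// -EFinM lee_fin ler_pdivrMr.
Qed.

Lemma ediv_ge0 (x y : R) : 0 <= x -> 0 <= y -> (0 <= x%:E / y%:E)%E.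
Proof. by move=> x0 y0; rewrite mule_ge0// ?inve_ge0 lee_fin. Qed.

(** Since [0 < T], both suprema range over nonempty sets of nonnegative values, so each is at most
    their sum. *)
Lemma RIE_boundP m (gam T p : R) (pi : nat -> seq R) (X : R -> 'rV[R]_m)
    (c : R -> R -> R) (C : R) : 0 < T ->
  (forall n, itv_partition 0 T (pi n)) -> is_control T c ->
  (RIE_bound gam T p pi X c <= C%:E)%E ->
  (forall s t, 0 <= s -> s <= t -> t <= T ->
     enorm (incr X s t) `^ p <= C * c s t) /\
  (forall n k l, (k < l)%N -> (l <= size (pi n))%N ->
     let s := node 0 (pi n) k in let t := node 0 (pi n) l in
     enorm (incr (gamma_sum gam (pi n) X) s t - tens (X s) (incr X s t))
       `^ (p / 2) <= C * c s t).
Proof.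
move=> T0 hpi [c0 _ _ _]; rewrite /RIE_bound.
set S1 := ereal_sup _; set S2 := ereal_sup _ => HC.
have nodeP n k l : (k < l)%N -> (l <= size (pi n))%N ->
    0 <= c (node 0 (pi n) k) (node 0 (pi n) l).
  move=> kl ln; apply: c0.
  - exact: (node_ge0 (hpi n) (ltnW (leq_trans kl ln))).
  - exact: (node_le (hpi n) (ltnW kl) ln).
  - exact: (node_leT (hpi n) ln).
have pn n : (0 < size (pi n))%N.
  rewrite lt0n; apply/negP => /eqP/size0nil E; have := hpi n.
  by rewrite E => /itv_partition_nil T0'; rewrite T0' ltxx in T0.
have S10 : (0 <= S1)%E.
  apply: le_trans (ereal_sup_ubound _); last first.
    by exists 0, 0; split; [exact: lexx|exact: lexx|exact: ltW|reflexivity].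
  by apply: ediv_ge0; [exact: powR_ge0|exact: c0 (ltW T0)].
have S20 : (0 <= S2)%E.
  apply: le_trans (ereal_sup_ubound _); last first.
    by exists 0%N, 0%N, 1%N; split; [by []|exact: pn|reflexivity].
  by apply: ediv_ge0; [exact: powR_ge0|apply: nodeP].
split.
- move=> s t s0 st tT; apply: ediv_le; [exact: powR_ge0|exact: c0|].
  apply: le_trans HC; apply: (@le_trans _ _ S1); last by rewrite leeDl.
  by apply: ereal_sup_ubound; exists s, t.
- move=> n k l kl ln; apply: ediv_le; [exact: powR_ge0|exact: nodeP|].
  apply: le_trans HC; apply: (@le_trans _ _ S2); last by rewrite leeDr.
  by apply: ereal_sup_ubound; exists n, k, l.
Qed.

Lemma floor_idx_node (T : R) (s : seq R) k : itv_partition 0 T s ->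
  (k <= size s)%N -> floor_idx s (node 0 s k) = k.
Proof.
move=> hs ks; have ss : sorted <%R s by case: hs => /path_sorted.
case: k ks => [_|k ks]; last by have := count_le_nth 0 ss ks.
apply/eqP; rewrite /floor_idx -leqn0 leqNgt -has_count; apply/hasPn => x.
by case: hs => /(order_path_min lt_trans)/allP + _ => /[apply]; rewrite -ltNge.
Qed.

Lemma scalar_gamma_sum_node (T gam : R) (s : seq R) (V Z : R -> R) k :
  itv_partition 0 T s -> (k <= size s)%N ->
  scalar_gamma_sum s gam V Z (node 0 s k) =
  \sum_(0 <= i < k) gamma_coeff s gam V i * (Z (node 0 s i.+1) - Z (node 0 s i)).
Proof.
move=> hs ks; rewrite (scalar_gamma_sum_floor hs).
- by rewrite /floor_node (floor_idx_node hs ks) subrr mulr0 addr0.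
- exact: (node_ge0 hs).
- exact: (node_leT hs).
Qed.

Lemma gamma_sum_entry m (gam : R) (s : seq R) (X : R -> 'rV[R]_m) t i j :
  gamma_sum gam s X t i j =
  scalar_gamma_sum s gam (fun u => X u 0 i) (fun u => X u 0 j) t.
Proof.
rewrite /gamma_sum summxE; apply: eq_bigr => k _.
by rewrite /tens mxE big_ord1 !mxE.
Qed.

Lemma RIE_cvg m (gam T p : R) (pi : nat -> seq R) (X : R -> 'rV[R]_m) t :
  RIE gam T p pi X -> 0 <= t -> t <= T ->
  gamma_sum gam (pi n) X t @[n --> \oo] --> gamma_int gam pi X t.
Proof.
move=> [_ _ [I HI] _] t0 tT.
have : gamma_sum gam (pi n) X t @[n --> \oo] --> I t.
  apply/cvg_entourageP => E entE.
  have : nbhs (I : {uniform` `[0, T]%classic -> 'M[R]_m})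
      [set h | forall y, `[0, T]%classic y -> E (I y, h y)].
    by apply/uniform_nbhs; exists E; split.
  move/HI => H; have {}H : \forall n \near \oo,
    forall y, `[0, T]%classic y -> E (I y, gamma_sum gam (pi n) X y) by exact: H.
  by move: H; apply: filterS => n /(_ t); apply; rewrite /= in_itv/= t0.
exact: cvgP.
Qed.

End RIEConsequences.

(** * Letters of the extended path *)

Section HatLetters.
Context {R : realType} (d : nat).

Definition unmid (l : 'I_(hat_dim d)) : option 'I_d := [pick i | mid i == l].

Definition time_letter : 'I_(hat_dim d) := lshift _ (lshift _ ord0).

Definition bracket_letter (k : 'I_(d * d.+1)./2) : 'I_(hat_dim d) := rshift (1 + d) k.

Lemma mid_inj : injective (@mid d).
Proof. by move=> i j /lshift_inj /rshift_inj. Qed.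

Lemma unmidK i : unmid (mid i) = Some i.
Proof.
rewrite /unmid; case: pickP => [j /eqP /mid_inj -> //|/(_ i)].
by rewrite eqxx.
Qed.

Lemma unmid_someP l i : unmid l = Some i -> l = mid i.
Proof. by rewrite /unmid; case: pickP => // j /eqP <- [->]. Qed.

Lemma unmid_time : unmid time_letter = None.
Proof. by rewrite /unmid; case: pickP => // i /eqP /lshift_inj /eqP; rewrite eq_rlshift. Qed.

Lemma unmid_bracket k : unmid (bracket_letter k) = None.
Proof. by rewrite /unmid; case: pickP => // i /eqP /eqP; rewrite eq_lrshift. Qed.

Lemma letterP (P : 'I_(hat_dim d) -> Prop) :
  P time_letter -> (forall i, P (mid i)) -> (forall k, P (bracket_letter k)) ->
  forall l, P l.
Proof.
move=> Pt Pm Pb l; rewrite -[l](@fintype.splitK (1 + d) (d * d.+1)./2).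
case: (fintype.split l) => [j|k] /=; last exact: Pb.
rewrite -[j](@fintype.splitK 1 d); case: (fintype.split j) => [z|i] /=; last exact: Pm.
by rewrite (ord1 z).
Qed.

Definition ordered_pair (i j : 'I_d) : 'I_d * 'I_d :=
  if (i <= j)%N then (i, j) else (j, i).

Lemma ordered_pair_mem i j : ordered_pair i j \in upper_pairs.
Proof.
rewrite /ordered_pair; case: leqP => [ij|/ltnW ji]; apply/allpairsPdep;
  [exists i, j|exists j, i]; by split; rewrite ?mem_enum// mem_filter mem_enum andbT.
Qed.

Lemma ordered_pair_index i j :
  (index (ordered_pair i j) upper_pairs < (d * d.+1)./2)%N.
Proof. by rewrite -size_upper_pairs index_mem ordered_pair_mem. Qed.

Definition upper_index (i j : 'I_d) : 'I_(d * d.+1)./2 := Ordinal (ordered_pair_index i j).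

(** Only two letters of [X] have a bracket letter; any other product of two increments has a factor
    of order 2 and is of order 3. Sorting the pair is harmless because the bracket is symmetric. *)
Definition hat_bracket (i j : 'I_(hat_dim d)) : option 'I_(hat_dim d) :=
  if unmid i is Some a then
    if unmid j is Some b then Some (bracket_letter (upper_index a b)) else None
  else None.

Lemma hat_vec_time (t : R) (x : 'rV[R]_d) (B : 'M[R]_d) :
  hat_vec t x B 0 time_letter = t.
Proof. by rewrite /hat_vec /time_letter !row_mxEl mxE eqxx mulr1n. Qed.

Lemma hat_vec_mid (t : R) (x : 'rV[R]_d) (B : 'M[R]_d) i :
  hat_vec t x B 0 (mid i) = x 0 i.
Proof. by rewrite /hat_vec /mid row_mxEl row_mxEr. Qed.

Lemma hat_vec_bracket (t : R) (x : 'rV[R]_d) (B : 'M[R]_d) k :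
  hat_vec t x B 0 (bracket_letter k) = upper_entries B 0 k.
Proof. by rewrite /hat_vec /bracket_letter row_mxEr. Qed.

Lemma upper_entries_pair (k : 'I_(d * d.+1)./2) :
  exists ij : 'I_d * 'I_d, forall B : 'M[R]_d, upper_entries B 0 k = B ij.1 ij.2.
Proof.
have ks : (k < size (@upper_pairs d))%N by rewrite size_upper_pairs.
case E : (@upper_pairs d) => [|ij0 s]; first by move: ks; rewrite E.
exists (nth ij0 upper_pairs k) => B.
by rewrite mxE (nth_map ij0).
Qed.

Lemma upper_entries_index (B : 'M[R]_d) i j : (forall a b, B a b = B b a) ->
  upper_entries B 0 (upper_index i j) = B i j.
Proof.
move=> sB; rewrite mxE (nth_map (i, j)) ?index_mem ?ordered_pair_mem//.
rewrite nth_index ?ordered_pair_mem// /ordered_pair.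
by case: leqP => //= _; exact: sB.
Qed.

End HatLetters.

(** * The extended path as an approximate rough path *)

Section HatApproxRoughPath.
Context {R : realType} (T gam p : R) (d : nat) (pi : nat -> seq R) (X : R -> 'rV[R]_d).
Hypothesis T0 : 0 < T.
Hypothesis gam01 : 0 <= gam <= 1.
Hypothesis gam_neq : gam != 2^-1.
Hypothesis p23 : 2 < p < 3.
Hypothesis hpi : forall n, itv_partition 0 T (pi n).
Hypothesis pi_mesh : mesh 0 (pi n) @[n --> \oo] --> 0.
Hypothesis X_RIE : RIE gam T p pi X.

Local Notation node := (node 0).

Lemma within_simplex_slice (f : R * R -> R) : {within simplex T, continuous f} ->
  {within `[0, T], continuous (fun t => f (0, t))}.
Proof.
move=> /within_cvgP H; apply/within_cvgP => t; rewrite /= in_itv/= => /andP[t0 tT] e e0.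
have st : simplex T (0, t) by split.
have [[U V] /= [U0 Vt] UV] := H _ st e e0.
apply: filterS Vt => s Vs /=; rewrite in_itv/= => /andP[s0 sT].
by apply: (UV (0, s)); split=> //=; exact: nbhs_singleton U0.
Qed.

Let p0 : 0 < p. Proof. exact: p_gt0 p23. Qed.

Lemma le_ctrl_root1 (g : R -> R) (e : R) s t : 0 <= e -> e `^ p <= g t - g s ->
  e <= ctrl_root p g s t.
Proof.
move=> e0 H; have -> : e = (e `^ p) `^ p^-1 by rewrite -powRrM mulfV ?gt_eqF// powRr1.
by apply: le_powR_base; rewrite ?invr_ge0 ?(ltW p0) ?powR_ge0.
Qed.

Lemma le_ctrl_root2 (g : R -> R) (e : R) s t : 0 <= s -> s <= t -> t <= T ->
  0 <= e -> e `^ (p / 2) <= g t - g s -> e <= ctrl_root p g s t ^+ 2.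
Proof.
move=> s0 st tT e0 H; rewrite (ctrl_root_exp p g 2 s0 st tT).
have -> : e = (e `^ (p / 2)) `^ (2 / p).
  rewrite -powRrM (_ : p / 2 * (2 / p) = 1) ?powRr1//; field; exact: lt0r_neq0.
by apply: le_powR_base; rewrite ?divr_ge0 ?(ltW p0) ?powR_ge0.
Qed.

(** An entry of the two-point quantity bounded in the second part of Property gamma-(RIE), written
    with partition indices. *)
Definition mid_area (n : nat) (a b : 'I_d) (u v : nat) : R :=
  \sum_(u <= k < v) gamma_coeff (pi n) gam (fun t => X t 0 a) k *
    (X (node (pi n) k.+1) 0 b - X (node (pi n) k) 0 b) -
  X (node (pi n) u) 0 a * (X (node (pi n) v) 0 b - X (node (pi n) u) 0 b).

Lemma RIE_control : exists g : R -> R,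
  [/\ {within `[0, T], continuous g},
      forall s t, 0 <= s -> s <= t -> t <= T -> t - s <= g t - g s,
      forall a s t, 0 <= s -> s <= t -> t <= T ->
        `|X t 0 a - X s 0 a| <= ctrl_root p g s t &
      forall n a b u v, (u <= v)%N -> (v <= size (pi n))%N ->
        `|mid_area n a b u v| <= ctrl_root p g (node (pi n) u) (node (pi n) v) ^+ 2].
Proof.
have [_ _ _ [C [c [cc Hc]]]] := X_RIE.
have [H1 H2] := RIE_boundP T0 hpi cc Hc.
have [c0 cC csup cd] := cc.
(* Superadditivity bounds [c s t] by an increment of [c 0], so one increasing function controls
   everything. The absolute value keeps it increasing whatever the sign of [C], and the summand [t]
   puts time under the same control. *)
pose g t := `|C| * c 0 t + t.
have gP s t : 0 <= s -> s <= t -> t <= T -> C * c s t + (t - s) <= g t - g s.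
  move=> s0 st tT; have := csup 0 s t (lexx _) s0 st tT => H.
  have : `|C| * (c 0 s + c s t) <= `|C| * c 0 t by rewrite ler_wpM2l.
  have : C * c s t <= `|C| * c s t.
    by apply: ler_wpM2r; [exact: c0|exact: ler_norm].
  rewrite /g mulrDr; lra.
have gD s t : 0 <= s -> s <= t -> t <= T -> t - s <= g t - g s.
  move=> s0 st tT; have := csup 0 s t (lexx _) s0 st tT => H.
  have : `|C| * (c 0 s + c s t) <= `|C| * c 0 t by rewrite ler_wpM2l.
  have : 0 <= `|C| * c s t by rewrite mulr_ge0// c0.
  rewrite /g mulrDr; lra.
exists g; split => //.
- have := within_simplex_slice cC => /= cg x.
  by apply: cvgD; [apply: cvgMr; exact: cg|apply: continuous_subspaceT => y; exact: cvg_id].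
- move=> a s t s0 st tT; apply: (@le_trans _ _ (enorm (incr X s t))).
    by have := enorm_entry (incr X s t) 0 a; rewrite /incr !mxE.
  apply: le_ctrl_root1; first exact: enorm_ge0.
  by have := H1 s t s0 st tT; have := gP s t s0 st tT; lra.
- move=> n a b u v; rewrite leq_eqVlt => /predU1P[<- vn|uv vn].
    by rewrite /mid_area big_geq// subrr mulr0 subrr normr0 exprn_ge0// powR_ge0.
  have un := leq_trans (ltnW uv) vn.
  have s0 := node_ge0 (hpi n) un.
  have st := node_le (hpi n) (ltnW uv) vn.
  have tT := node_leT (hpi n) vn.
  set s := node (pi n) u; set t := node (pi n) v.
  pose M := incr (gamma_sum gam (pi n) X) s t - tens (X s) (incr X s t).
  apply: (@le_trans _ _ (enorm M)).
    have := enorm_entry M a b; rewrite /M /incr /tens !mxE big_ord1 !mxE.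
    rewrite !gamma_sum_entry !(scalar_gamma_sum_node _ _ _ (hpi n))//.
    by rewrite (big_cat_nat (leq0n u) (ltnW uv))/= [X in X - _ - _]addrC addrK.
  apply: le_ctrl_root2 => //; first exact: enorm_ge0.
  have H : enorm M `^ (p / 2) <= C * c s t := H2 n u v uv vn.
  move: H (gP s t s0 st tT).
  have : 0 <= t - s by rewrite subr_ge0.
  lra.
Qed.

Definition hat_area (i j : 'I_(hat_dim d)) (s t : R) : R :=
  if unmid i is Some a then
    if unmid j is Some b then gamma_area gam pi X s t a b else 0
  else 0.

Definition hat_discrete_area (n : nat) (i j : 'I_(hat_dim d)) (u v : nat) : R :=
  if unmid i is Some a then
    if unmid j is Some b then mid_area n a b u v else 0
  else 0.

Lemma gamma_area_entry s t a b : gamma_area gam pi X s t a b =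
  gamma_int gam pi X t a b - gamma_int gam pi X s a b -
  X s 0 a * (X t 0 b - X s 0 b).
Proof. by rewrite /gamma_area /tens /incr !mxE big_ord1 !mxE. Qed.

Lemma gamma_bracket_entry t a b : gamma_bracket gam pi X t a b =
  X t 0 a * X t 0 b - X 0 0 a * X 0 0 b -
  gamma_int gam pi X t a b - gamma_int gam pi X t b a.
Proof.
by rewrite /gamma_bracket (negPf gam_neq) /tens !mxE !big_ord1 !mxE.
Qed.

Lemma gamma_bracket_sym t a b : gamma_bracket gam pi X t a b = gamma_bracket gam pi X t b a.
Proof. by rewrite (gamma_bracket_entry t a b) (gamma_bracket_entry t b a); ring. Qed.

Lemma gamma_bracket_increment s t a b :
  gamma_bracket gam pi X t a b - gamma_bracket gam pi X s a b =
  (X t 0 a - X s 0 a) * (X t 0 b - X s 0 b) -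
  gamma_area gam pi X s t a b - gamma_area gam pi X s t b a.
Proof.
rewrite (gamma_bracket_entry t a b) (gamma_bracket_entry s a b).
by rewrite (gamma_area_entry s t a b) (gamma_area_entry s t b a); ring.
Qed.

Lemma X_continuous a : {within `[0, T], continuous (fun t => X t 0 a)}.
Proof.
have [cX _ _ _] := X_RIE => x; apply: (@cvg_mx_entry R 1 d _ _ _ _ (X x)).
exact: cX.
Qed.

Definition hat_coord (l : 'I_(hat_dim d)) (t : R) : R := gamma_hat gam pi X t 0 l.

Lemma hat_coord_time t : hat_coord (time_letter d) t = t.
Proof. exact: hat_vec_time. Qed.

Lemma hat_coord_mid a t : hat_coord (mid a) t = X t 0 a.
Proof. exact: hat_vec_mid. Qed.

Lemma hat_coord_bracket k t :
  hat_coord (bracket_letter k) t = upper_entries (gamma_bracket gam pi X t) 0 k.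
Proof. exact: hat_vec_bracket. Qed.

Definition is_mid (l : 'I_(hat_dim d)) : bool := isSome (unmid l).

(** Between two letters of [X] the bracket relation, the discrete Chen relation and the one-step
    area are exact identities. All other pairs contribute only products of increments, of order 2
    plus 1. *)
Theorem hat_approx_rough_path : exists (g : R -> R) (K : R),
  [/\ {within `[0, T], continuous g},
      forall s t, 0 <= s -> s <= t -> t <= T -> g s <= g t &
      approx_rough_path T gam p pi g is_mid (@hat_bracket d) hat_coord
        hat_area hat_discrete_area K].
Proof.
have [g [cg gD HX HA]] := RIE_control.
have gm s t : 0 <= s -> s <= t -> t <= T -> g s <= g t.
  by move=> s0 st tT; rewrite -subr_ge0; apply: le_trans (gD s t s0 st tT); rewrite subr_ge0.
pose h := ctrl_root p g.
have h0 s t : 0 <= h s t by exact: powR_ge0.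
have hT s t : 0 <= s -> s <= t -> t <= T -> h s t <= h 0 T.
  by move=> s0 st tT; exact: (ctrl_root_le p23 gm).
have fl0 n t : 0 <= t -> 0 <= floor_node (pi n) t by move=> /(floor_node_bound (hpi n))/andP[].
have flT n t : 0 <= t -> floor_node (pi n) t <= T by move=> /(floor_node_bound (hpi n))/andP[].
have dcvg a b s t : 0 <= s -> s <= t -> t <= T ->
    mid_area n a b (floor_idx (pi n) s) (floor_idx (pi n) t) @[n --> \oo] -->
    gamma_area gam pi X s t a b.
  move=> s0 st tT; have t0 := le_trans s0 st; have sT := le_trans st tT.
  have flc c u : 0 <= u -> u <= T ->
      X (floor_node (pi n) u) 0 c @[n --> \oo] --> X u 0 c.
    by move=> u0 uT; exact: (within_floor_node_cvg hpi pi_mesh (@X_continuous c) u0 uT).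
  pose S n u := \sum_(0 <= k < floor_idx (pi n) u)
    gamma_coeff (pi n) gam (fun t => X t 0 a) k *
    (X (node (pi n) k.+1) 0 b - X (node (pi n) k) 0 b).
  have Sc u : 0 <= u -> u <= T -> S n u @[n --> \oo] --> gamma_int gam pi X u a b.
    move=> u0 uT.
    have c1 : gamma_sum gam (pi n) X u a b @[n --> \oo] --> gamma_int gam pi X u a b.
      exact: cvg_mx_entry (RIE_cvg X_RIE u0 uT).
    have bX v : 0 <= v -> v <= T -> `|X v 0 a| <= `|X 0 0 a| + h 0 T.
      move=> v0 vT; rewrite -[X v 0 a](subrK (X 0 0 a)) addrC.
      apply: le_trans (ler_normD _ _) _; rewrite lerD2l.
      apply: le_trans (HX a 0 v (lexx _) v0 vT) _; exact: hT.
    have dX v w : 0 <= v -> v <= w -> w <= T -> `|X w 0 b - X v 0 b| <= 1 * h v w.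
      by move=> *; rewrite mul1r; exact: HX.
    have c2 := gamma_rest_cvg gam01 p23 hpi pi_mesh cg gm bX dX u0 uT.
    (* The sum up to the floor node is the gamma-sum at [u] without its incomplete interval, which
       tends to 0. *)
    have := cvgB c1 c2; rewrite subr0.
    have E n : S n u = gamma_sum gam (pi n) X u a b -
      gamma_coeff (pi n) gam (fun v => X v 0 a) (floor_idx (pi n) u) *
        (X u 0 b - X (floor_node (pi n) u) 0 b).
      by rewrite gamma_sum_entry (scalar_gamma_sum_floor (hpi n))// /S addrK.
    by under [in X in _ -> X]eq_fun do rewrite E; exact.
  rewrite gamma_area_entry.
  have -> : (fun n => mid_area n a b (floor_idx (pi n) s) (floor_idx (pi n) t)) =
    fun n => S n t - S n s - X (floor_node (pi n) s) 0 a *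
      (X (floor_node (pi n) t) 0 b - X (floor_node (pi n) s) 0 b).
    apply/funext => n; rewrite /mid_area /S.
    rewrite (big_cat_nat (leq0n _) (floor_idx_mono (pi n) st))/=.
    by rewrite -!/(floor_node _ _); ring.
  apply: cvgB; first by apply: cvgB; exact: Sc.
  by apply: cvgM; [exact: flc|apply: cvgB; exact: flc].
have HAl a b s t : 0 <= s -> s <= t -> t <= T ->
    `|gamma_area gam pi X s t a b| <= h s t ^+ 2.
  move=> s0 st tT; have t0 := le_trans s0 st.
  rewrite /h (ctrl_root_exp p g 2 s0 st tT).
  have p2 : 0 < 2 / p by rewrite divr_gt0.
  have c1 : `|mid_area n a b (floor_idx (pi n) s) (floor_idx (pi n) t)| @[n --> \oo] -->
      `|gamma_area gam pi X s t a b|.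
    by apply: cvg_norm; exact: dcvg.
  have c2 := h_floor_cvg hpi pi_mesh cg gm p2 s0 st tT.
  apply: (ler_cvg_to c1 c2).
  apply: nearW => n; rewrite -(ctrl_root_exp p g 2 (fl0 n s s0) _ (flT n t t0)).
    by apply: HA; [exact: floor_idx_mono|exact: floor_idx_le].
  exact: (floor_node_mono hpi).
(* The 3 serves a bracket increment, made of one product and two areas. The power serves time: an
   increment [w] of [g] is [w ^ (1 - 2 / p)] times [w ^ (2 / p)], and the first factor is largest on
   the whole of [[0, T]]. *)
pose K2 := 3 + (g T - g 0) `^ (1 - 2 / p).
have e0 : 0 <= 1 - 2 / p.
  by rewrite subr_ge0 ler_pdivrMr// mul1r; case/andP: p23 => /ltW.
have K20 : 0 <= K2 by rewrite addr_ge0// powR_ge0.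
have path2 l s t : ~~ is_mid l -> 0 <= s -> s <= t -> t <= T ->
    `|hat_coord l t - hat_coord l s| <= K2 * h s t ^+ 2.
  elim/letterP: l => [_|i nm|k _] s0 st tT.
  - rewrite !hat_coord_time ger0_norm ?subr_ge0//.
    apply: le_trans (gD s t s0 st tT) _.
    have w0 : 0 <= g t - g s by rewrite subr_ge0 gm.
    rewrite /h (ctrl_root_exp p g 2 s0 st tT).
    have wT : g t - g s <= g T - g 0.
      by apply: lerB; apply: gm => //; [exact: le_trans st|exact: le_trans tT].
    have E : g t - g s = (g t - g s) `^ (1 - 2 / p) * (g t - g s) `^ (2 / p).
      rewrite -powRD ?subrK ?powRr1//.
      by rewrite oner_eq0.
    rewrite [leLHS]E ler_wpM2r ?powR_ge0//.
    have := le_powR_base e0 w0 wT; rewrite /K2; lra.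
  - by move: nm; rewrite /is_mid unmidK.
  - have [[a b] E] := @upper_entries_pair R d k.
    have {}E u : hat_coord (bracket_letter k) u = gamma_bracket gam pi X u a b.
      exact: etrans (hat_coord_bracket k u) (E _).
    rewrite (E t) (E s) gamma_bracket_increment.
    apply: (@le_trans _ _ (h s t ^+ 2 + h s t ^+ 2 + h s t ^+ 2)).
      apply: le_trans (ler_normB _ _) _; apply: lerD; last exact: HAl.
      apply: le_trans (ler_normB _ _) _; apply: lerD; last exact: HAl.
      by rewrite normrM expr2; apply: ler_pM => //; exact: HX.
    have : 0 <= (g T - g 0) `^ (1 - 2 / p) * h s t ^+ 2 by rewrite mulr_ge0 ?powR_ge0 ?exprn_ge0.
    rewrite /K2; lra.
(* Order 2 becomes order 1 at the price of a factor [h 0 T]. *)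
pose K1 := 1 + K2 * h 0 T.
have K10 : 0 <= K1 by rewrite addr_ge0// mulr_ge0.
have path1 l s t : 0 <= s -> s <= t -> t <= T ->
    `|hat_coord l t - hat_coord l s| <= K1 * h s t.
  move=> s0 st tT; have [|ml] := boolP (is_mid l); last first.
    apply: le_trans (path2 l s t ml s0 st tT) _.
    rewrite expr2 mulrA ler_wpM2r//; apply: (@le_trans _ _ (K2 * h 0 T)).
      by apply: ler_wpM2l => //; exact: hT.
    by rewrite /K1 lerDr.
  rewrite /is_mid; case E : (unmid l) => [a|//] _; rewrite (unmid_someP E) !hat_coord_mid.
  apply: le_trans (HX a s t s0 st tT) _; rewrite -/(h s t) ler_peMl// /K1 lerDl mulr_ge0//.
(* The two factors may live on different subintervals, because Chen's relation multiplies increments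
   over adjacent intervals. *)
have prod3 i j s t : ~~ (is_mid i && is_mid j) -> 0 <= s -> s <= t -> t <= T ->
    forall s' t', s <= s' -> s' <= t' -> t' <= t ->
    forall s'' t'', s <= s'' -> s'' <= t'' -> t'' <= t ->
    `|(hat_coord i t' - hat_coord i s') * (hat_coord j t'' - hat_coord j s'')|
      <= K1 * K2 * h s t ^+ 3.
  move=> nij s0 st tT s' t' ss' st' tt' s'' t'' ss'' st'' tt''.
  have s'0 := le_trans s0 ss'; have t'T := le_trans tt' tT.
  have s''0 := le_trans s0 ss''; have t''T := le_trans tt'' tT.
  have h1 : h s' t' <= h s t by exact: (ctrl_root_le p23 gm).
  have h2 : h s'' t'' <= h s t by exact: (ctrl_root_le p23 gm).
  have q1 : h s' t' ^+ 2 <= h s t ^+ 2 by rewrite ler_pXn2r ?nnegrE.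
  have q2 : h s'' t'' ^+ 2 <= h s t ^+ 2 by rewrite ler_pXn2r ?nnegrE.
  rewrite normrM; move: nij; rewrite negb_and => /orP[ni|nj].
    rewrite (_ : K1 * K2 * h s t ^+ 3 = (K2 * h s t ^+ 2) * (K1 * h s t)); last by ring.
    apply: ler_pM => //.
      by apply: le_trans (path2 i s' t' ni s'0 st' t'T) _; exact: ler_wpM2l.
    by apply: le_trans (path1 j s'' t'' s''0 st'' t''T) _; exact: ler_wpM2l.
  rewrite (_ : K1 * K2 * h s t ^+ 3 = (K1 * h s t) * (K2 * h s t ^+ 2)); last by ring.
  apply: ler_pM => //.
    by apply: le_trans (path1 i s' t' s'0 st' t'T) _; exact: ler_wpM2l.
  by apply: le_trans (path2 j s'' t'' nj s''0 st'' t''T) _; exact: ler_wpM2l.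
pose K := 1 + K1 + K2 + K1 * K2.
have K120 : 0 <= K1 * K2 by exact: mulr_ge0.
have K0 : 0 <= K by rewrite /K; move: K10 K20 K120; lra.
have K_ge1 : 1 <= K by rewrite /K; move: K10 K20 K120; lra.
have K_ge12 : K1 * K2 <= K by rewrite /K; move: K10 K20 K120; lra.
have le1 k s t : h s t ^+ k <= K * h s t ^+ k.
  by rewrite ler_peMl ?exprn_ge0.
have le12 k s t : K1 * K2 * h s t ^+ k <= K * h s t ^+ k.
  by rewrite ler_wpM2r ?exprn_ge0.
have Kk k s t : 0 <= K * h s t ^+ k by rewrite mulr_ge0// exprn_ge0.
have nodeP n a b : (a <= b)%N -> (b <= size (pi n))%N ->
    [/\ 0 <= node (pi n) a, node (pi n) a <= node (pi n) b & node (pi n) b <= T].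
  move=> ab bn; split; first exact: (node_ge0 (hpi n) (leq_trans ab bn)).
    exact: (node_le (hpi n)).
  exact: (node_leT (hpi n)).
exists g, K; split => //; split => //; rewrite -?/(h _ _).
- move=> i s t s0 st tT; apply: le_trans (path1 i s t s0 st tT) _.
  by rewrite ler_wpM2r// /K; move: K10 K20 K120; lra.
- move=> i s t ni s0 st tT; apply: le_trans (path2 i s t ni s0 st tT) _.
  by rewrite ler_wpM2r ?exprn_ge0// /K; move: K10 K20 K120; lra.
- move=> i j s t s0 st tT; rewrite /hat_area.
  case: (unmid i) => [a|]; last by rewrite normr0.
  case: (unmid j) => [b|]; last by rewrite normr0.
  by apply: le_trans (le1 _ _ _); exact: HAl.
- by move=> i j s t; rewrite /is_mid /hat_area; case: (unmid i) => //; case: (unmid j).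
- move=> i j k; rewrite /hat_bracket; case: (unmid i) => // a; case: (unmid j) => // b [<-].
  by rewrite /is_mid unmid_bracket.
- move=> i j s t s0 st tT; have [|nij] := boolP (is_mid i && is_mid j).
    rewrite /is_mid /hat_area /hat_bracket; case Ei : (unmid i) => [a|//].
    case Ej : (unmid j) => [b|//] _; rewrite (unmid_someP Ei) (unmid_someP Ej) !hat_coord_mid.
    have E u : hat_coord (bracket_letter (upper_index a b)) u = gamma_bracket gam pi X u a b.
      apply: etrans (hat_coord_bracket _ u) _.
      by apply: upper_entries_index; exact: gamma_bracket_sym.
    rewrite (E t) (E s).
    by rewrite gamma_bracket_increment subrr normr0.
  have -> : hat_area i j s t = 0.
    by move: nij; rewrite /is_mid /hat_area; case: (unmid i) => //; case: (unmid j).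
  have -> : hat_area j i s t = 0.
    by move: nij; rewrite /is_mid /hat_area; case: (unmid j) => //; case: (unmid i).
  have -> : hat_bracket i j = None.
    by move: nij; rewrite /is_mid /hat_bracket; case: (unmid i) => //; case: (unmid j).
  by rewrite !subr0; apply: le_trans (le12 _ _ _); exact: prod3.
- move=> n i j a b ab bn; rewrite /hat_discrete_area.
  case: (unmid i) => [a'|]; last by rewrite normr0.
  case: (unmid j) => [b'|]; last by rewrite normr0.
  by apply: le_trans (le1 _ _ _); exact: HA.
- move=> n i j a b c ab bc cn; have ac := leq_trans ab bc; have bn := leq_trans bc cn.
  have [s0 st tT] := nodeP n a c ac cn.
  have [_ su _] := nodeP n a b ab bn; have [_ ut _] := nodeP n b c bc cn.
  have [|nij] := boolP (is_mid i && is_mid j).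
    rewrite /is_mid /hat_discrete_area; case Ei : (unmid i) => [a'|//].
    case Ej : (unmid j) => [b'|//] _; rewrite (unmid_someP Ei) (unmid_someP Ej) !hat_coord_mid.
    rewrite /mid_area (big_cat_nat ab bc)/=.
    rewrite (_ : _ - _ - _ - _ = 0) ?normr0//; ring.
  have -> : hat_discrete_area n i j = fun _ _ => 0.
    apply/funext => x; apply/funext => y.
    by move: nij; rewrite /is_mid /hat_discrete_area; case: (unmid i) => //; case: (unmid j).
  rewrite !subr0 sub0r normrN; apply: le_trans (le12 _ _ _).
  by apply: (prod3 i j _ _ nij s0 st tT).
- move=> n i j k kn; have [s0 st tT] := nodeP n k k.+1 (leqnSn k) kn.
  have [|nij] := boolP (is_mid i && is_mid j).
    rewrite /is_mid /hat_discrete_area; case Ei : (unmid i) => [a'|//].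
    case Ej : (unmid j) => [b'|//] _; rewrite (unmid_someP Ei) (unmid_someP Ej) !hat_coord_mid.
    rewrite /mid_area big_nat1 /gamma_coeff.
    rewrite (_ : _ - _ - _ = 0) ?normr0//; ring.
  have -> : hat_discrete_area n i j = fun _ _ => 0.
    apply/funext => x; apply/funext => y.
    by move: nij; rewrite /is_mid /hat_discrete_area; case: (unmid i) => //; case: (unmid j).
  rewrite sub0r normrN -mulrA normrM; have [gam0 gam1] := andP gam01.
  apply: le_trans (ler_wpM2r (normr_ge0 _) (_ : `|gam| <= 1)) _; first by rewrite ger0_norm.
  rewrite mul1r; apply: le_trans (le12 _ _ _).
  by apply: (prod3 i j _ _ nij s0 st tT).
- move=> i j s t s0 st tT; rewrite /hat_discrete_area /hat_area.
  case: (unmid i) => [a|]; last exact: cvg_cst.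
  case: (unmid j) => [b|]; last exact: cvg_cst.
  exact: dcvg.
Qed.

End HatApproxRoughPath.

(** * Identification of the gamma-signature with the word coordinates *)

Section GammaSignatureWords.
Context {R : realType} (m : nat) (T gam p : R) (pi : nat -> seq R) (g : R -> R).
Context (mid : pred 'I_m) (br : 'I_m -> 'I_m -> option 'I_m) (Z : R -> 'rV[R]_m).
Context (A : 'I_m -> 'I_m -> R -> R -> R).
Context (An : nat -> 'I_m -> 'I_m -> nat -> nat -> R) (K : R).
Hypothesis T0 : 0 <= T.
Hypothesis gam01 : 0 <= gam <= 1.
Hypothesis p23 : 2 < p < 3.
Hypothesis hpi : forall n, itv_partition 0 T (pi n).
Hypothesis pi_mesh : mesh 0 (pi n) @[n --> \oo] --> 0.
Hypothesis g_cont : {within `[0, T], continuous g}.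
Hypothesis g_mono : forall s t, 0 <= s -> s <= t -> t <= T -> g s <= g t.
Hypothesis arp : approx_rough_path T gam p pi g mid br (fun l t => Z t 0 l) A An K.

Local Notation S := (word_sig gam pi (fun l t => Z t 0 l)).

Lemma word_sig_letter i t : 0 <= t -> t <= T -> S [:: i] t = Z t 0 i - Z 0 0 i.
Proof.
move=> t0 tT; rewrite /= /gamma_integral.
have -> : (fun n => scalar_gamma_sum (pi n) gam (fun=> 1) (fun u => Z u 0 i) t) =
    fun=> Z t 0 i - Z 0 0 i.
  by apply/funext => n; exact: (scalar_gamma_sum_cst (hpi n)).
exact: lim_cst.
Qed.

(** Writing [Z] as its initial value plus an increment splits the gamma-sum into a telescoping part
    and the sum of a two-letter word. This also yields the convergence that gives meaning to
    [gamma_int] for the extended path. *)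
Lemma gamma_int_word t i j : 0 <= t -> t <= T ->
  gamma_int gam pi Z t j i = Z 0 0 j * (Z t 0 i - Z 0 0 i) + S [:: i; j] t.
Proof.
move=> t0 tT.
have entry a b : gamma_sum gam (pi n) Z t a b @[n --> \oo] -->
    Z 0 0 a * (Z t 0 b - Z 0 0 b) + S [:: b; a] t.
  have E n : gamma_sum gam (pi n) Z t a b = Z 0 0 a * (Z t 0 b - Z 0 0 b) +
      scalar_gamma_sum (pi n) gam (S [:: a]) (fun u => Z u 0 b) t.
    rewrite gamma_sum_entry -(scalar_gamma_sum_cst (hpi n) gam (fun u => Z u 0 b) t0 tT).
    rewrite /scalar_gamma_sum mulr_sumr -big_split/=; apply: eq_bigr => k _.
    have nk : (k <= size (pi n))%N by exact: ltnW.
    have L k' : (k' <= size (pi n))%N ->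
        gamma_integral gam pi (fun l u => Z u 0 l) (fun=> 1) a (node 0 (pi n) k') =
        Z (node 0 (pi n) k') 0 a - Z 0 0 a.
      move=> k'n; apply: (word_sig_letter a).
        exact: (node_ge0 (hpi n)).
      exact: (node_leT (hpi n)).
    by rewrite /gamma_coeff /= !L//; ring.
  under eq_fun do rewrite E.
  apply: cvgD; first exact: cvg_cst.
  exact: (word_sig_cvg T0 gam01 p23 hpi pi_mesh g_cont g_mono arp).
have mxc : gamma_sum gam (pi n) Z t @[n --> \oo] --> gamma_int gam pi Z t.
  apply: (@cvgP _ _ (\matrix_(a, b) (Z 0 0 a * (Z t 0 b - Z 0 0 b) + S [:: b; a] t))).
  by apply: mx_cvg => a b; rewrite mxE; exact: entry.
have c1 : gamma_sum gam (pi n) Z t j i @[n --> \oo] --> gamma_int gam pi Z t j i.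
  exact: cvg_mx_entry mxc.
exact: (cvg_unique _ c1 (entry j i)).
Qed.

Lemma gamma_signature_rev_word w t : 0 <= t -> t <= T ->
  gamma_signature_rev gam pi Z w t = S w t.
Proof.
elim: w t => [//|i w IH] t t0 tT.
case: w IH => [_|j [|k w] IH].
- by rewrite word_sig_letter//= /incr !mxE.
- have Z00 := word_sig0 gam hpi (fun l t => Z t 0 l) i [:: j].
  rewrite [LHS]/= /gamma_area /tens /incr !mxE big_ord1 !mxE.
  by rewrite !gamma_int_word// Z00; ring.
have lim_eq (f f' : nat -> R) : f =1 f' -> limn f = limn f' by move=> /funext ->.
rewrite [RHS]/= /gamma_integral; apply: lim_eq => n; apply: eq_bigr => l _.
have ln : (l <= size (pi n))%N by exact: ltnW.
have n0 q : (q <= size (pi n))%N -> 0 <= node 0 (pi n) q by exact: (node_ge0 (hpi n)).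
have nT q : (q <= size (pi n))%N -> node 0 (pi n) q <= T by exact: (node_leT (hpi n)).
have := IH _ (n0 _ ln) (nT _ ln); have := IH _ (n0 _ (ltn_ord l)) (nT _ (ltn_ord l)).
by rewrite /gamma_coeff /incr !mxE [S (j :: _)]/= /= => -> ->.
Qed.

End GammaSignatureWords.

(** * Moments of rough paths: continuity, separation and density *)

Section Moments.
Context {R : realType} (T p : R) (m : nat).
Notation RP := (rough_path T p m).
Hypothesis T0 : 0 < T.

(* The coordinate of level 1 or 2 indexed by a reversed word. *)
Definition rp_feature (y : RP) (w : seq 'I_m) (t : R) : R :=
  match w with
  | [:: i] => rp_path y t 0 i - rp_path y 0 0 i
  | [:: i; j] => rp_area y 0 t j i
  | _ => 0
  end.

Definition rp_moment (k : nat) (w : seq 'I_m) (y : RP) : R :=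
  seg_integral (fun t => t ^+ k * rp_feature y w t) 0 T.

Lemma rp_feature_continuous y w : {within `[0, T], continuous (rp_feature y w)}.
Proof.
have cst : {within `[0, T], continuous (fun=> 0 : R)}.
  by apply: continuous_subspaceT => x; exact: cvg_cst.
case: w => [|i [|j [|k w]]] //=.
  move=> x; apply: cvgB; last exact: cvg_cst.
  by apply: (@cvg_mx_entry R 1 m _ _ _ _ (rp_path y x)); exact: rp_path_continuous.
apply: (@within_simplex_slice R T (fun st : R * R => rp_area y st.1 st.2 j i)) => x.
apply: (@cvg_mx_entry R m m _ _ _ _ (rp_area y x.1 x.2)).
exact: rp_area_continuous.
Qed.

Lemma rp_moment_integrand_continuous k y w :
  {within `[0, T], continuous (fun t => t ^+ k * rp_feature y w t)}.
Proof.
apply: within_continuousM; first exact: within_continuousX.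
exact: rp_feature_continuous.
Qed.

Lemma rp_area00 (y : RP) : rp_area y 0 0 = 0.
Proof.
have := rp_chen y (lexx 0) (lexx 0) (lexx 0) (ltW T0).
rewrite /incr subrr /tens mulmx0 addr0 => /eqP.
by rewrite -subr_eq0 opprD addNKr oppr_eq0 => /eqP.
Qed.

Lemma pvar_increment_le n1 n2 (r e t : R) (A : R -> R -> 'M[R]_(n1, n2)) :
  0 < r -> 0 <= e -> (pvar T r A <= e%:E)%E -> 0 < t -> t <= T ->
  enorm (A 0 t) <= e.
Proof.
move=> r0 e0 /(pvar_leP _ _ r0 e0) H t0 tT.
suff : enorm (A 0 t) `^ r <= e `^ r.
  move=> h; rewrite leNgt; apply/negP => he.
  have := gt0_ltr_powR r0; move=> /(_ e (enorm (A 0 t))).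
  by rewrite !nnegrE e0 enorm_ge0 => /(_ isT isT he); rewrite ltNge h.
(* Partition points increase strictly, so [t = T] takes the partition with one interval and any
   other [t] the one through [t] and [T]. *)
move: tT; rewrite le_eqVlt => /predU1P[->|tT].
  have := H [:: T] (itv_partition1 T0).
  by rewrite /pvar_sum big_ord1.
have hs : itv_partition 0 T [:: t; T] by split => /=; rewrite ?t0 ?tT.
apply: le_trans (H _ hs); rewrite /pvar_sum big_ord_recl/= lerDl.
by apply: sumr_ge0 => k _; exact: powR_ge0.
Qed.

Lemma rp_feature_dist (y y' : RP) e w t : 0 < e -> rp_ball y e y' ->
  0 <= t -> t <= T -> `|rp_feature y w t - rp_feature y' w t| <= e.
Proof.
move=> e0 yy'; have /andP[p2 _] := rp_exponent y.
have p0 : 0 < p by exact: lt_trans p2.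
have [h1 h2] : (pvar T p (incr (fun t => rp_path y t - rp_path y' t)%R) <= e%:E)%E /\
    (pvar T (p / 2) (fun s t => rp_area y s t - rp_area y' s t)%R <= e%:E)%E.
  move/ltW: yy'; rewrite /rp_dist => H; split; apply: le_trans H.
    by rewrite leeDl// pvar_ge0.
  by rewrite leeDr// pvar_ge0.
rewrite le_eqVlt => /predU1P[<-|t0] tT.
  by case: w => [|i [|j [|k w]]]; rewrite /= ?subrr ?normr0 ?(ltW e0)// !rp_area00 subrr normr0 ltW.
have {}h1 := pvar_increment_le p0 (ltW e0) h1 t0 tT.
have {}h2 := pvar_increment_le (divr_gt0 p0 (ltr0Sn R 1)) (ltW e0) h2 t0 tT.
case: w => [|i [|j [|k w]]] /=; rewrite ?subrr ?normr0 ?(ltW e0)//.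
- apply: le_trans h1; apply: le_trans (enorm_entry _ 0 i).
  by rewrite /incr !mxE le_eqVlt; apply/orP; left; apply/eqP; congr `|_|; ring.
- apply: le_trans h2; apply: le_trans (enorm_entry _ j i).
  by rewrite !mxE.
Qed.

Lemma rp_moment_continuous (K : set RP) k w : {within K, continuous (rp_moment k w)}.
Proof.
apply/within_cvgP => y _ e e0.
have c0 : 0 < T ^+ k * T + 1 by rewrite ltr_wpDl// mulr_ge0 ?exprn_ge0 ?ltW.
have d0 : 0 < e / (T ^+ k * T + 1) by exact: divr_gt0.
set dl := e / _ in d0; have := @nbhsx_ballx R RP y _ d0.
apply: filterS => y' yy' _.
have cy := @rp_moment_integrand_continuous k y w.
have cy' := @rp_moment_integrand_continuous k y' w.
have cN : {within `[0, T], continuous (fun t => -1 * (t ^+ k * rp_feature y' w t))}.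
  by move=> x; apply: cvgMr; exact: cy'.
have E : rp_moment k w y - rp_moment k w y' =
    seg_integral (fun t => t ^+ k * rp_feature y w t + -1 * (t ^+ k * rp_feature y' w t)) 0 T.
  by rewrite seg_integralD// seg_integralZ// mulN1r.
have cD : {within `[0, T], continuous
    (fun t => t ^+ k * rp_feature y w t + -1 * (t ^+ k * rp_feature y' w t))}.
  by move=> x; apply: cvgD; [exact: cy|exact: cN].
have := @seg_integral_bounds _ _ T 0 T (- (T ^+ k * dl)) (T ^+ k * dl) cD
  (lexx _) (ltW T0) (lexx _).
case/(_ _)/andP.
  move=> r r0 rT; rewrite -ler_norml mulN1r -mulrBr normrM.
  apply: ler_pM => //; last exact: rp_feature_dist.
  by rewrite ger0_norm ?exprn_ge0//; apply: lerXn2r; rewrite ?nnegrE// ltW.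
rewrite seg_integral_same !subr0 -E mulNr => h1 h2.
have : `|rp_moment k w y - rp_moment k w y'| <= T ^+ k * dl * T.
  by rewrite ler_norml h1.
move/le_lt_trans; apply; rewrite /dl mulrAC mulrA ltr_pdivrMr// mulrC.
by rewrite ltr_pM2l// ltrDl.
Qed.

(** Equal moments give equal coordinates from time 0, and Chen's relation recovers the area between
    arbitrary times. The conclusion is distance 0 and not equality: the distance sees neither the
    initial value nor what happens outside [[0, T]]. *)
Lemma rp_moments_separate (y y' : RP) e : 0 < e ->
  (forall k w, (0 < size w <= 2)%N -> rp_moment k w y = rp_moment k w y') ->
  rp_ball y e y'.
Proof.
move=> e0 H.
have feq w t : (0 < size w <= 2)%N -> 0 <= t -> t <= T ->
    rp_feature y w t = rp_feature y' w t.
  move=> sw t0 tT; apply/eqP; rewrite -subr_eq0; apply/eqP.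
  have cf := @rp_feature_continuous y w; have cf' := @rp_feature_continuous y' w.
  apply: (moments_eq0 T0 (within_continuousB cf cf')) => // k.
  have cy := @rp_moment_integrand_continuous k y w.
  have cy' := @rp_moment_integrand_continuous k y' w.
  have cN : {within `[0, T], continuous (fun t => -1 * (t ^+ k * rp_feature y' w t))}.
    by move=> x; apply: cvgMr; exact: cy'.
  transitivity (rp_moment k w y - rp_moment k w y'); last by rewrite H// subrr.
  rewrite -mulN1r -seg_integralZ// -seg_integralD//; apply: eq_seg_integral => x _ _.
  by ring.
have path0 t : 0 <= t -> t <= T -> rp_path y t - rp_path y 0 = rp_path y' t - rp_path y' 0.
  move=> t0 tT; apply/rowP => i; rewrite !mxE.
  exact: (feq [:: i] t isT t0 tT).
have area0 t : 0 <= t -> t <= T -> rp_area y 0 t = rp_area y' 0 t.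
  by move=> t0 tT; apply/matrixP => j i; exact: (feq [:: i; j] t isT t0 tT).
have incrE s t : 0 <= s -> s <= t -> t <= T ->
    incr (rp_path y) s t = incr (rp_path y') s t.
  move=> s0 st tT; have t0 := le_trans s0 st; have sT := le_trans st tT.
  have sh (z : RP) : incr (rp_path z) s t =
      (rp_path z t - rp_path z 0) - (rp_path z s - rp_path z 0).
    by rewrite /incr opprB addrA subrK.
  by rewrite !sh !path0.
have areaE s t : 0 <= s -> s <= t -> t <= T -> rp_area y s t = rp_area y' s t.
  move=> s0 st tT; have t0 := le_trans s0 st; have sT := le_trans st tT.
  have := area0 t t0 tT.
  rewrite (rp_chen y (lexx 0) s0 st tT) (rp_chen y' (lexx 0) s0 st tT).
  rewrite area0// (incrE 0 s)// (incrE s t)//.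
  by move/addIr/addrI.
have nodeP s k : itv_partition 0 T s -> (k < size s)%N ->
    [/\ 0 <= node 0 s k, node 0 s k <= node 0 s k.+1 & node 0 s k.+1 <= T].
  move=> hs ks; split; first exact: (node_ge0 hs (ltnW ks)).
    exact: (node_le hs (leqnSn k) ks).
  exact: (node_leT hs ks).
have /andP[p2 _] := rp_exponent y; have p0 : 0 < p by exact: lt_trans p2.
have z n1 n2 (r : R) (B : R -> R -> 'M[R]_(n1, n2)) : 0 < r ->
    (forall s t, 0 <= s -> s <= t -> t <= T -> B s t = 0) -> pvar T r B = 0%E.
  move=> r0 B0; apply/eqP; rewrite eq_le pvar_ge0 andbT; apply/pvar_leP => // s hs.
  rewrite /pvar_sum big1 ?powR_ge0// => k _.
  have [a b c] := nodeP s k hs (ltn_ord k).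
  by rewrite B0// enorm0 powR0// gt_eqF.
rewrite /rp_ball /= /rp_dist !z ?adde0 ?lte_fin// ?divr_gt0//.
- by move=> s t s0 st tT; rewrite areaE// subrr.
- move=> s t s0 st tT; have := incrE s t s0 st tT; rewrite /incr => E.
  by rewrite opprD addrACA -opprD E subrr.
Qed.

(** An inductive predicate, so that words can be attached to a function by induction on how it was
    built. *)
Inductive moment_algebra : set (RP -> R) :=
| MomentCst c : moment_algebra (fun=> c)
| Moment k w : (0 < size w <= 2)%N -> moment_algebra (rp_moment k w)
| MomentAdd u v : moment_algebra u -> moment_algebra v ->
    moment_algebra (fun x => u x + v x)
| MomentMul u v : moment_algebra u -> moment_algebra v ->
    moment_algebra (fun x => u x * v x).

Lemma moment_algebra_dense (K : set RP) (f : RP -> R) (e : R) :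
  compact K -> {within K, continuous f} -> 0 < e ->
  exists2 u, moment_algebra u & forall x, K x -> `|f x - u x| < e.
Proof.
move=> cK cf e0; apply: (@stone_weierstrass R RP K cK moment_algebra) => //.
- move=> u0 Au0; elim: u0 / Au0 => [c|k w _|u v _ cu _ cv|u v _ cu _ cv].
  + move=> x; exact: cvg_cst.
  + exact: rp_moment_continuous.
  + by move=> x; apply: cvgD; [exact: cu|exact: cv].
  + by move=> x; apply: cvgM; [exact: cu|exact: cv].
- exact: MomentCst.
- exact: MomentAdd.
- exact: MomentMul.
(* Points not separated by moments lie in every ball around each other, so a continuous [h] takes
   the same value at both. *)
- move=> x y Kx Ky h ch hxy; apply: contrapT => nsep; apply: hxy.
  have sep k w : (0 < size w <= 2)%N -> rp_moment k w x = rp_moment k w y.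
    move=> sw; apply: contrapT => ne; apply: nsep.
    by exists (rp_moment k w) => //; exact: Moment.
  apply/eqP; rewrite -subr_eq0 -normr_le0; apply/ler_addgt0Pr => d d0; rewrite add0r.
  have /nbhs_ballP[r /= r0 Hr] := (within_cvgP K h).1 ch x Kx d d0.
  apply/ltW/Hr => //.
  exact: rp_moments_separate.
Qed.

End Moments.

(** * Linear combinations of words *)

Section LinearCombinations.
Context {R : realType} (m : nat) (br : 'I_m -> 'I_m -> option 'I_m).
Implicit Types (a : seq 'I_m -> R) (L : seq (R * seq 'I_m)).

(** Linear combinations are lists in which words may repeat, so addition is concatenation; equal
    words are collected only in [tensor_pairing_lin]. *)
Definition lin_eval a L : R := \sum_(x <- L) x.1 * a x.2.

Definition lin_mul L L' : seq (R * seq 'I_m) :=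
  flatten [seq [seq (x.1 * y.1, u) | u <- quasi_shuffle br x.2 y.2] | x <- L, y <- L'].

Lemma lin_eval_cat a L L' : lin_eval a (L ++ L') = lin_eval a L + lin_eval a L'.
Proof. exact: big_cat. Qed.

Lemma lin_eval_cons a x L : lin_eval a (x :: L) = x.1 * a x.2 + lin_eval a L.
Proof. exact: big_cons. Qed.

Lemma lin_eval_words a c ws :
  lin_eval a [seq (c, u) | u <- ws] = c * \sum_(u <- ws) a u.
Proof. by rewrite /lin_eval big_map mulr_sumr. Qed.

Lemma lin_eval_mul a L L' :
  (forall w v, \sum_(u <- quasi_shuffle br w v) a u = a w * a v) ->
  lin_eval a (lin_mul L L') = lin_eval a L * lin_eval a L'.
Proof.
move=> Ha; rewrite /lin_mul; elim: L => [|x L IH].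
  by rewrite /lin_eval !big_nil mul0r.
rewrite allpairs_cons flatten_cat lin_eval_cat IH.
rewrite lin_eval_cons mulrDl; congr (_ + _).
elim: L' {IH} => [|y L' IH] /=; first by rewrite /lin_eval !big_nil mulr0.
rewrite lin_eval_cat IH lin_eval_words Ha.
by rewrite lin_eval_cons; ring.
Qed.

Lemma tensor_pairing_lin L : exists l : {fsfun seq 'I_m -> R with 0},
  forall a, tensor_pairing l a = lin_eval (fun w => a (rev w)) L.
Proof.
have [D DE] : exists D : {fset seq 'I_m}, forall J,
    (J \in D) = (J \in [seq rev x.2 | x <- L]).
  by exists (seq_fset tt [seq rev x.2 | x <- L]) => J; rewrite seq_fsetE.
pose F (J : seq 'I_m) : R := \sum_(x <- L | rev x.2 == J) x.1.
exists [fsfun J in D => F J] => a; rewrite /tensor_pairing /lin_eval.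
rewrite (big_fset_incl _ (finsupp_sub _ _ _))/=; last first.
  by move=> J _; rewrite memNfinsupp => /eqP ->; rewrite mul0r.
under eq_big_seq => J JD do rewrite fsfunE JD /F mulr_suml.
(* After the exchange, each list entry contributes to exactly one tensor coordinate, that of its
   reversed word. *)
rewrite (exchange_big_dep xpredT)//=; apply: eq_big_seq => x xL.
rewrite -big_filter (perm_big [:: rev x.2]) ?big_seq1//.
apply: uniq_perm => //; first exact/filter_uniq/fset_uniq.
move=> J; rewrite mem_filter inE eq_sym; case: eqVneq => //= ->.
by rewrite DE; apply/mapP; exists x.
Qed.

End LinearCombinations.

(** * Polynomials in the moments as functionals of the gamma-signature *)

Section GammaMoments.
Context {R : realType} (T gam p : R) (d : nat) (pi : nat -> seq R).
Hypothesis T0 : 0 < T.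
Hypothesis gam01 : 0 <= gam <= 1.
Hypothesis gam_neq : gam != 2^-1.
Hypothesis p23 : 2 < p < 3.
Hypothesis hpi : forall n, itv_partition 0 T (pi n).
Hypothesis pi_mesh : mesh 0 (pi n) @[n --> \oo] --> 0.

Definition rev_signature (X : R -> 'rV[R]_d) (w : seq 'I_(hat_dim d)) : R :=
  gamma_signature_rev gam pi (gamma_hat gam pi X) w T.

Lemma rev_signature_product X w v : RIE gam T p pi X ->
  \sum_(u <- quasi_shuffle (@hat_bracket d) w v) rev_signature X u =
  rev_signature X w * rev_signature X v.
Proof.
move=> HX; have [g [K [cg gm arp]]] :=
  hat_approx_rough_path T0 gam01 gam_neq p23 hpi pi_mesh HX.
have E u : rev_signature X u = word_sig gam pi (hat_coord gam pi X) u T.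
  exact: (gamma_signature_rev_word (ltW T0) gam01 p23 hpi pi_mesh cg gm arp) (ltW T0) (lexx _).
under eq_bigr do rewrite E.
rewrite !E.
exact: (quasi_shuffle_product (ltW T0) gam01 p23 hpi pi_mesh cg gm arp w v (ltW T0) (lexx _)).
Qed.

Lemma rp_moment_signature X (y : rough_path T p (hat_dim d)) k w :
  RIE gam T p pi X -> is_gamma_hat_lift gam pi X y -> (0 < size w <= 2)%N ->
  rp_moment k w y = \sum_(u <- map (cons (time_letter d))
      (time_words (@hat_bracket d) (time_letter d) k w)) rev_signature X u.
Proof.
move=> HX [Hpath Harea] sw; have [g [K [cg gm arp]]] :=
  hat_approx_rough_path T0 gam01 gam_neq p23 hpi pi_mesh HX.
have E u t : 0 <= t -> t <= T -> gamma_signature_rev gam pi (gamma_hat gam pi X) u t =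
    word_sig gam pi (hat_coord gam pi X) u t.
  move=> t0 tT.
  exact: (gamma_signature_rev_word (ltW T0) gam01 p23 hpi pi_mesh cg gm arp).
rewrite /rev_signature; under eq_bigr do rewrite E ?(ltW T0)//.
have time_nmid : ~~ is_mid (time_letter d) by rewrite /is_mid unmid_time.
rewrite -[RHS]/(words_sum gam pi (hat_coord gam pi X) _ T).
rewrite (moment_words (ltW T0) gam01 p23 hpi pi_mesh cg gm arp) //; last first.
  by move=> t _ _; exact: hat_coord_time.
apply: eq_seg_integral => t t0 tT; congr (_ * _); rewrite -E//.
case: w sw => [|i [|j [|l w]]]//= _.
  by rewrite (Hpath t)// (Hpath 0 (lexx 0) (ltW T0)) incr_entry.
by rewrite Harea.
Qed.

(** The list is fixed before the path: products are expanded by quasi-shuffles of words, which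
    involve [hat_bracket] but no property of [X]. *)
Lemma moment_algebra_signature (u : rough_path T p (hat_dim d) -> R) :
  moment_algebra u -> exists L, forall X y,
    RIE gam T p pi X -> is_gamma_hat_lift gam pi X y ->
    u y = lin_eval (rev_signature X) L.
Proof.
elim=> [c|k w sw|v v' _ [L HL] _ [L' HL']|v v' _ [L HL] _ [L' HL']].
- exists [:: (c, [::])] => X y _ _.
  by rewrite /lin_eval big_seq1 /= mulr1.
- exists [seq (1, v) | v <- map (cons (time_letter d))
      (time_words (@hat_bracket d) (time_letter d) k w)] => X y HX Hy.
  by rewrite lin_eval_words mul1r; exact: rp_moment_signature.
- exists (L ++ L') => X y HX Hy.
  by rewrite lin_eval_cat (HL X)// (HL' X).
- exists (lin_mul (@hat_bracket d) L L') => X y HX Hy.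
  rewrite lin_eval_mul ?(HL X)// ?(HL' X)// => w1 w2.
  exact: rev_signature_product.
Qed.

End GammaMoments.

Theorem corollary3p10 (R : realType) (T : R) (d : nat) (gam p : R)
    (pi : nat -> seq R)
    (K : set (rough_path T p (hat_dim d)))
    (f : rough_path T p (hat_dim d) -> R) :
  0 < T ->
  0 <= gam <= 1 -> gam != 2^-1 ->
  2 < p < 3 ->
  (forall n, itv_partition 0 T (pi n)) ->
  mesh 0 (pi n) @[n --> \oo] --> 0 ->
  K `<=` hat_rough_paths T p d ->
  compact K ->
  (exists M : R, forall x, K x -> (rp_norm x <= M%:E)%E) ->
  {within K, continuous f} ->
  forall L : R, 0 < L ->
  forall eps : R, 0 < eps ->
  exists l : {fsfun seq 'I_(hat_dim d) -> R with 0},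
    (ereal_sup [set `| f yX.1 -
         tensor_pairing l (gamma_signature gam pi (gamma_hat gam pi yX.2) T) |%:E
       | yX in K_gamma K gam pi L] < eps%:E)%E.
Proof.
move=> T0 gam01 gam_neq p23 hpi pi_mesh _ cK _ cf L _ eps eps0.
(* Strict bounds pass to the supremum only as weak ones, hence the half of [eps]. *)
have e2 : 0 < eps / 2 by rewrite divr_gt0.
have [u Au Hu] := moment_algebra_dense T0 cK cf e2.
have [L' HL'] := moment_algebra_signature T0 gam01 gam_neq p23 hpi pi_mesh Au.
have [l Hl] := tensor_pairing_lin L'.
exists l; apply: (@le_lt_trans _ _ (eps / 2)%:E); last first.
  by rewrite lte_fin ltr_pdivrMr// ltr_pMr// ltr1n.
apply: ge_ereal_sup => _ [[y X] [/= Ky HX Hy _] <-].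
rewrite lee_fin Hl; apply/ltW; have := Hu y Ky; rewrite (HL' X y HX Hy).
congr (`|_ - _| < _); apply: eq_bigr => x _.
by rewrite /gamma_signature revK.
Qed.
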